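(* Let $\mathcal{C}$ be the category of coherent sheaves on a weighted projective line over an algebraically closed field $K$. Then $\mathcal{C}$ satisfies the following condition: for any objects $X$ and $Y$ of $\mathcal{C}$, the set $\operatorname{Hom}(X,Y)$ is partitioned into finitely many locally closed subsets according to the rank of the morphism, and the sets of monomorphisms and of epimorphisms are open in $\operatorname{Hom}(X,Y)$.
   Context: Weighted projective lines (Geigle–Lenzing). Let $\mathbf{p}=(p_0,\dots,p_n)$ be positive integers (weights) and $\lambda_0,\dots,\lambda_n$ distinct points of $\mathbb{P}^1(K)$. $\mathbf{L}(\mathbf{p})$ is the abelian group with generators $\vec x_0,\dots,\vec x_n$ and relations $p_0\vec x_0=\dots=p_n\vec x_n=:\vec c$. Choose nonzero linear forms $\ell_i\in K[U,V]$ with zero $\lambda_i$ and let $S=K[U,V,X_0,\dots,X_n]/(X_i^{p_i}-\ell_i(U,V),\ 0\le i\le n)$, graded by $\mathbf{L}(\mathbf{p})$ with $\deg U=\deg V=\vec c$, $\deg X_i=\vec x_i$. The category $\mathcal{C}$ of coherent sheaves on the weighted projective line $\mathbb{X}$ can be described as the Serre quotient of the category of finitely generated $\mathbf{L}(\mathbf{p})$-graded $S$-modules by the modules of finite length. It is an abelian $K$-category with finite dimensional Hom spaces. $\operatorname{Hom}(X,Y)$ is regarded as an affine space with the Zariski topology. The dimension type of an object is its class in the Grothendieck group $K_0(\mathcal{C})$, and the rank of a morphism is the dimension type of its image, an element of $K_0(\mathcal{C})$. *)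

(* Defs.v *)
From HB Require Import structures.
From mathcomp Require Import all_boot all_order all_algebra.
From mathcomp Require Import generic_quotient ring_quotient.
From mathcomp Require Import boolp classical_sets mpoly.

Set Implicit Arguments.
Unset Strict Implicit.
Unset Printing Implicit Defensive.

Import GRing.Theory.
Local Open Scope classical_set_scope.
Local Open Scope ring_scope.
Local Open Scope quotient_scope.

Record lincat (K : fieldType) := LinCat {
  ob :> Type;
  hom : ob -> ob -> lmodType K;
  idm : forall X, hom X X;
  cmp : forall X Y Z, hom Y Z -> hom X Y -> hom X Z;
  cmpA : forall X Y Z W (h : hom Z W) (g : hom Y Z) (f : hom X Y),
    cmp h (cmp g f) = cmp (cmp h g) f;
  cmp1m : forall X Y (f : hom X Y), cmp (idm Y) f = f;
  cmpm1 : forall X Y (f : hom X Y), cmp f (idm X) = f;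
  cmp_linear_l : forall X Y Z (f : hom X Y),
    linear (fun g : hom Y Z => cmp g f);
  cmp_linear_r : forall X Y Z (g : hom Y Z), linear (@cmp X Y Z g)
}.

Arguments idm {K l} X.
Arguments cmp {K l X Y Z} g f.

Section LinCat.
Variables (K : fieldType) (C : lincat K).

Definition mono (X Y : C) (f : hom X Y) : Prop :=
  forall (W : C) (g h : hom W X), cmp f g = cmp f h -> g = h.

Definition epi (X Y : C) (f : hom X Y) : Prop :=
  forall (Z : C) (g h : hom Y Z), cmp g f = cmp h f -> g = h.

Definition is_kernel (X Y N : C) (f : hom X Y) (k : hom N X) : Prop :=
  cmp f k = 0 /\
  forall (W : C) (g : hom W X), cmp f g = 0 -> exists! h, cmp k h = g.

Definition is_cokernel (X Y Q : C) (f : hom X Y) (q : hom Y Q) : Prop :=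
  cmp q f = 0 /\
  forall (Z : C) (g : hom Y Z), cmp g f = 0 -> exists! h, cmp h q = g.

Definition short_exact (X Y Z : C) (i : hom X Y) (q : hom Y Z) : Prop :=
  is_kernel q i /\ is_cokernel i q.

Definition is_image (X Y I : C) (f : hom X Y) (i : hom I Y) : Prop :=
  [/\ mono i, (exists e, f = cmp i e) &
      forall (J : C) (j : hom J Y), mono j -> (exists e, f = cmp j e) ->
        exists h, i = cmp j h].

(* The Grothendieck group is presented by generators [X] and relations
   [Y] = [X] + [Z] for 0 -> X -> Y -> Z -> 0 exact: terms of the language of
   abelian groups over the objects, modulo the congruence generated by the
   axioms of abelian groups and these relations. *)
Inductive K0_term : Type :=
  | K0_of of ob C
  | K0_zero
  | K0_add of K0_term & K0_term
  | K0_opp of K0_term.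

Inductive K0_eq : K0_term -> K0_term -> Prop :=
  | K0_refl a : K0_eq a a
  | K0_sym a b : K0_eq a b -> K0_eq b a
  | K0_trans a b c : K0_eq a b -> K0_eq b c -> K0_eq a c
  | K0_addm a a' b b' :
      K0_eq a a' -> K0_eq b b' -> K0_eq (K0_add a b) (K0_add a' b')
  | K0_oppm a a' : K0_eq a a' -> K0_eq (K0_opp a) (K0_opp a')
  | K0_addA a b c : K0_eq (K0_add a (K0_add b c)) (K0_add (K0_add a b) c)
  | K0_addC a b : K0_eq (K0_add a b) (K0_add b a)
  | K0_add0 a : K0_eq (K0_add K0_zero a) a
  | K0_addN a : K0_eq (K0_add (K0_opp a) a) K0_zero
  | K0_ses X Y Z (i : hom X Y) (q : hom Y Z) : short_exact i q ->
      K0_eq (K0_of Y) (K0_add (K0_of X) (K0_of Z)).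

Record K0 := K0Class {
  K0_class :> K0_term -> Prop;
  K0_classP : exists a, K0_class = K0_eq a
}.

Definition dim_type (X : C) : K0 :=
  K0Class (ex_intro (fun a => K0_eq (K0_of X) = K0_eq a) (K0_of X) erefl).

Definition has_rank (X Y : C) (f : hom X Y) (r : K0) : Prop :=
  exists (I : C) (i : hom I Y), is_image f i /\ dim_type I = r.

End LinCat.

Section Zariski.
Variables (K : fieldType) (V : lmodType K).

Inductive polyfun : (V -> K) -> Prop :=
  | polyfun_cst c : polyfun (fun=> c)
  | polyfun_lin (f : {scalar V}) : polyfun f
  | polyfun_add f g : polyfun f -> polyfun g -> polyfun (fun v => f v + g v)
  | polyfun_mul f g : polyfun f -> polyfun g -> polyfun (fun v => f v * g v).

Definition zclosed (Z : set V) : Prop :=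
  exists F : set (V -> K), (forall f, F f -> polyfun f) /\
    Z = [set v | forall f, F f -> f v = 0].

Definition zopen (U : set V) : Prop := zclosed (~` U).

Definition locally_closed (A : set V) : Prop :=
  exists U Z, [/\ zopen U, zclosed Z & A = U `&` Z].

End Zariski.

(* The sets {f | rank f = r} form a partition of Hom(X,Y) because every f has
   exactly one rank; [rs] lists the finitely many r with a nonempty set. *)
Definition rank_stratified (K : fieldType) (C : lincat K) : Prop :=
  forall X Y : C,
    [/\ forall f : hom X Y, exists! r : K0 C, has_rank f r,
        exists N (rs : 'I_N -> K0 C),
          forall (f : hom X Y) r, has_rank f r -> exists k, r = rs k,
        forall r : K0 C, locally_closed [set f : hom X Y | has_rank f r],
        zopen [set f : hom X Y | mono f]
      & zopen [set f : hom X Y | epi f]].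

(* The pair (a, b) stands for the linear form a U + b V, and for the point
   [a : b] of the projective line when it is nonzero. *)
Definition same_point (K : fieldType) (u v : K * K) : Prop :=
  u.1 * v.2 = u.2 * v.1.

Definition vanishes_at (K : fieldType) (l u : K * K) : Prop :=
  l.1 * u.1 + l.2 * u.2 = 0.

Record weights (n : nat) := Weights {
  wt :> 'I_n.+1 -> nat;
  wt_gt0 : forall i, (0 < wt i)%N
}.

Section WeightGroup.
Variables (n : nat) (p : weights n).

Definition basis_vec (i : 'I_n.+1) : {ffun 'I_n.+1 -> int} :=
  [ffun k => (k == i)%:R].

Definition Lp_rel : {pred {ffun 'I_n.+1 -> int}} := fun v =>
  `[< exists c : 'I_n.+1 -> 'I_n.+1 -> int,
        v = \sum_i \sum_j
              (basis_vec i *+ p i - basis_vec j *+ p j) *~ c i j >].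

Lemma Lp_rel_zmod_closed : zmod_closed Lp_rel.
Proof.
split=> [|u v /asboolP[c ->] /asboolP[d ->]]; apply/asboolP.
  by exists (fun _ _ => 0); rewrite big1 // => i _; rewrite big1.
exists (fun i j => c i j - d i j); rewrite -sumrB; apply: eq_bigr => i _.
by rewrite -sumrB; apply: eq_bigr => j _; rewrite mulrzBr.
Qed.

HB.instance Definition _ :=
  GRing.isZmodClosed.Build {ffun 'I_n.+1 -> int} Lp_rel Lp_rel_zmod_closed.

Definition Lp := Quotient.quot Lp_rel.
HB.instance Definition _ := GRing.Zmodule.on Lp.

Definition xdeg (i : 'I_n.+1) : Lp := \pi_Lp (basis_vec i).
Definition cdeg : Lp := xdeg ord0 *+ p ord0.

End WeightGroup.

Section GradedRing.
Variables (K : closedFieldType) (n : nat) (p : weights n).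
Variable l : 'I_n.+1 -> K * K.

(* The variables 0 and 1 are U and V, and X_i is the variable 2 + i. *)
Definition polyUVX := {mpoly K[2 + n.+1]}.

Definition varU : polyUVX := 'X_(lshift n.+1 (0 : 'I_2)).
Definition varV : polyUVX := 'X_(lshift n.+1 (1 : 'I_2)).
Definition varX (i : 'I_n.+1) : polyUVX := 'X_(rshift 2 i).

Definition relS (i : 'I_n.+1) : polyUVX :=
  varX i ^+ p i - ((l i).1 *: varU + (l i).2 *: varV).

Definition idealS : {pred {mpoly K[2 + n.+1]}} := fun f =>
  `[< exists c : 'I_n.+1 -> polyUVX, f = \sum_i c i * relS i >].

Lemma idealS_closed : idealr_closed idealS.
Proof.
split.
- by apply/asboolP; exists (fun=> 0); rewrite big1 // => i _; rewrite mul0r.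
- apply/asboolP => -[c e]; have /eqP := congr1 (meval (fun=> 0)) e.
  rewrite meval1 raddf_sum /= big1 ?oner_eq0 // => i _.
  rewrite mevalM mevalB mevalD !mevalZ rmorphXn /= !mevalXU.
  by rewrite expr0n gtn_eqF ?wt_gt0 // !mulr0 addr0 subr0 mulr0.
- move=> a u v /asboolP[c ->] /asboolP[d ->]; apply/asboolP.
  exists (fun i => a * c i + d i); rewrite mulr_sumr -big_split /=.
  by apply: eq_bigr => i _; rewrite mulrA -mulrDl.
Qed.

HB.instance Definition _ :=
  isIdealr.Build {mpoly K[2 + n.+1]} idealS idealS_closed.

Definition ringS := {ideal_quot idealS}.
HB.instance Definition _ := GRing.ComNzRing.on ringS.

Definition cstS (a : K) : ringS := \pi_ringS (a%:MP_[2 + n.+1]).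

Definition vardeg (i : 'I_(2 + n.+1)) : Lp p :=
  match split i with inl _ => cdeg p | inr j => xdeg p j end.

Definition mdegL (m : 'X_{1.. 2 + n.+1}) : Lp p := \sum_i vardeg i *+ m i.

Definition compS (a : Lp p) (s : ringS) : Prop :=
  exists f : polyUVX,
    s = \pi_ringS f /\ forall m, m \in msupp f -> mdegL m = a.

End GradedRing.

Section GradedModules.
Variables (K : closedFieldType) (n : nat) (p : weights n).
Variable l : 'I_n.+1 -> K * K.
Local Notation L := (Lp p).
Local Notation S := (ringS p l).

Record grmod := GrMod {
  gm_sort :> lmodType S;
  gm_comp : L -> set gm_sort;
  gm_comp0 : forall a, gm_comp a 0;
  gm_compB : forall a x y, gm_comp a x -> gm_comp a y -> gm_comp a (x - y);
  gm_compZ : forall a b s x,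
    compS a s -> gm_comp b x -> gm_comp (a + b) (s *: x);
  gm_span : forall x, exists (r : seq L) (f : L -> gm_sort),
    [/\ uniq r, forall a, gm_comp a (f a) & x = \sum_(a <- r) f a];
  gm_direct : forall (r : seq L) (f : L -> gm_sort),
    uniq r -> (forall a, gm_comp a (f a)) -> \sum_(a <- r) f a = 0 ->
    {in r, forall a, f a = 0};
  gm_fingen : exists (N : nat) (g : 'I_N -> gm_sort),
    forall x, exists c : 'I_N -> S, x = \sum_i c i *: g i
}.

Definition graded_sub (V : lmodType S) (c : L -> set V) (P : set V) : Prop :=
  [/\ P 0, forall s x y, P x -> P y -> P (s *: x + y) &
      forall (r : seq L) (f : L -> V), uniq r -> (forall a, c a (f a)) ->
        P (\sum_(a <- r) f a) -> {in r, forall a, P (f a)}].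

Definition gsub (M : grmod) (P : set M) : Prop := graded_sub (@gm_comp M) P.

(* Graded submodules of the direct sum of M and N. *)
Definition grel (M N : grmod) (T : set (M * N)) : Prop :=
  graded_sub (fun a => gm_comp a `*` gm_comp a) T.

Definition simple_step (M : grmod) (P Q : set M) : Prop :=
  [/\ gsub P, gsub Q, P `<=` Q, P <> Q &
      forall A, gsub A -> P `<=` A -> A `<=` Q -> A = P \/ A = Q].

(* Q/P has a finite composition series in the category of graded modules. *)
Inductive fin_length (M : grmod) : set M -> set M -> Prop :=
  | fin_length_nil P : gsub P -> fin_length P P
  | fin_length_cons P Q R :
      simple_step P Q -> fin_length Q R -> fin_length P R.

Definition rel_dom (M N : grmod) (T : set (M * N)) : set M :=
  [set x | exists y, T (x, y)].
Definition rel_ind (M N : grmod) (T : set (M * N)) : set N :=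
  [set y | T (0, y)].
Definition rel_im (M N : grmod) (T : set (M * N)) (A : set M) : set N :=
  [set y | exists2 x, A x & T (x, y)].
Definition rel_inv (M N : grmod) (T : set (M * N)) : set (N * M) :=
  [set z | T (z.2, z.1)].
Definition rel_id (M : grmod) : set (M * M) := [set z | z.1 = z.2].
Definition rel_comp (M N P : grmod) (T2 : set (N * P)) (T1 : set (M * N)) :
    set (M * P) :=
  [set z | exists y, T1 (z.1, y) /\ T2 (y, z.2)].
Definition rel_zero (M N : grmod) : set (M * N) := [set z | z.2 = 0].
Definition rel_add (M N : grmod) (T1 T2 : set (M * N)) : set (M * N) :=
  [set z | exists y1 y2, [/\ T1 (z.1, y1), T2 (z.1, y2) & z.2 = y1 + y2]].
Definition rel_scale (M N : grmod) (k : K) (T : set (M * N)) : set (M * N) :=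
  [set z | exists2 y, T (z.1, y) & z.2 = cstS p l k *: y].

Lemma cstS_deg0 (k : K) : compS (0 : L) (cstS p l k).
Proof.
exists k%:MP; split=> // m; rewrite msuppC; case: ifP => // _.
by rewrite inE => /eqP->; rewrite /mdegL big1 // => i _; rewrite mnm0E.
Qed.

Lemma cstSD (a b : K) : cstS p l (a + b) = cstS p l a + cstS p l b.
Proof. by rewrite /cstS mpolyCD raddfD. Qed.
Lemma cstSM (a b : K) : cstS p l (a * b) = cstS p l a * cstS p l b.
Proof. by rewrite /cstS mpolyCM rmorphM. Qed.
Lemma cstS1 : cstS p l 1 = 1.
Proof. by rewrite /cstS rmorph1. Qed.

Section Dec.
Variable M : grmod.
Implicit Types (P Q : set M) (x y : M) (r : seq L).

Lemma gm_compN a x : gm_comp a x -> gm_comp a (- x).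
Proof. by move=> ax; rewrite -sub0r; apply: gm_compB (gm_comp0 _ _) ax. Qed.

Lemma gm_compD a x y : gm_comp a x -> gm_comp a y -> gm_comp a (x + y).
Proof. by move=> ax /gm_compN; rewrite -{2}[y]opprK; apply: gm_compB. Qed.

Lemma gm_compC a k x : gm_comp a x -> gm_comp a (cstS p l k *: x).
Proof. by move=> ax; rewrite -[a]add0r; apply: gm_compZ (cstS_deg0 k) ax. Qed.

Lemma gm_pad x : exists r (f : L -> M),
  [/\ uniq r, forall a, gm_comp a (f a), forall a, a \notin r -> f a = 0
    & x = \sum_(a <- r) f a].
Proof.
have [r [f [ur cf ->]]] := gm_span x.
exists r, (fun a => if a \in r then f a else 0); split=> //.
- by move=> a; case: ifP => // _; apply: gm_comp0.
- by move=> a /negPf->.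
- by rewrite big_seq [RHS]big_seq; apply: eq_bigr => a ->.
Qed.

Lemma sum_pad r r' (f : L -> M) : uniq r -> uniq r' -> {subset r <= r'} ->
  (forall a, a \notin r -> f a = 0) -> \sum_(a <- r') f a = \sum_(a <- r) f a.
Proof.
move=> ur ur' s f0; rewrite (bigID (mem r)) /= [X in _ + X]big1 ?addr0 //.
rewrite -big_filter; apply: perm_big; apply: uniq_perm; rewrite ?filter_uniq //.
by move=> a; rewrite mem_filter; case: (boolP (a \in r)) => //= /s->.
Qed.

Definition trunc r (f : L -> M) a := if a \in r then f a else 0.

Lemma gm_trunc r (f : L -> M) :
  (forall a, gm_comp a (f a)) -> forall a, gm_comp a (trunc r f a).
Proof. by move=> cf a; rewrite /trunc; case: ifP => // _; apply: gm_comp0. Qed.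

Lemma truncE r (f : L -> M) a : a \in r -> trunc r f a = f a.
Proof. by rewrite /trunc => ->. Qed.

Lemma sum_trunc r r' (f : L -> M) : uniq r -> uniq r' -> {subset r <= r'} ->
  \sum_(a <- r') trunc r f a = \sum_(a <- r) f a.
Proof.
move=> ur ur' s; rewrite (sum_pad ur ur' s) => [|a /negPf]; last first.
  by rewrite /trunc => ->.
by rewrite big_seq [RHS]big_seq; apply: eq_bigr => a /truncE.
Qed.

Lemma gm_refine r y : uniq r -> exists r' (g : L -> M),
  [/\ uniq r', {subset r <= r'}, forall a, gm_comp a (g a)
    & \sum_(a <- r') g a = y].
Proof.
move=> ur; have [s [g [us cg g0 ->]]] := gm_pad y.
exists (undup (r ++ s)), g; split=> //.
- exact: undup_uniq.
- by move=> a ar; rewrite mem_undup mem_cat ar.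
- apply: sum_pad; rewrite ?undup_uniq // => a.
  by rewrite mem_undup mem_cat orbC => ->.
Qed.

End Dec.

Lemma sum_pair (M N : grmod) (r : seq L) (f : L -> M) (g : L -> N) :
  \sum_(a <- r) (f a, g a) = (\sum_(a <- r) f a, \sum_(a <- r) g a).
Proof. by elim/big_rec3: _ => // a x y _ _ ->. Qed.

Section SubTheory.
Variables (V : lmodType S) (c : L -> set V) (P : set V).
Hypothesis sP : graded_sub c P.

Lemma gs0 : P 0. Proof. by case: sP. Qed.
Lemma gsL s x y : P x -> P y -> P (s *: x + y). Proof. by case: sP => _ + _; apply. Qed.
Lemma gsD x y : P x -> P y -> P (x + y).
Proof. by rewrite -{2}[x]scale1r; apply: gsL. Qed.
Lemma gsZ s x : P x -> P (s *: x).
Proof. by move=> Px; rewrite -[_ *: _]addr0; apply: gsL Px gs0. Qed.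
Lemma gsB x y : P x -> P y -> P (x - y).
Proof. by move=> Px Py; rewrite addrC -scaleN1r; apply: gsL. Qed.
Lemma gsN x : P x -> P (- x).
Proof. by move=> Px; rewrite -scaleN1r; apply: gsZ. Qed.
End SubTheory.

Lemma grelP (M N : grmod) (T : set (M * N)) :
  T (0, 0) -> (forall s x y x' y', T (x, y) -> T (x', y') ->
                 T (s *: x + x', s *: y + y')) ->
  (forall (r : seq L) (f : L -> M) (g : L -> N), uniq r ->
     (forall a, gm_comp a (f a)) -> (forall a, gm_comp a (g a)) ->
     T (\sum_(a <- r) f a, \sum_(a <- r) g a) -> {in r, forall a, T (f a, g a)}) ->
  grel T.
Proof.
move=> T0 TL Th; split=> // [s [x y] [x' y'] /TL h /h|r f ur cf Tf a ar]; first exact.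
rewrite [f a]surjective_pairing.
apply: (Th r (fun a => (f a).1) (fun a => (f a).2)) => // [b|b|].
- by case: (cf b).
- by case: (cf b).
by rewrite -sum_pair; under eq_bigr do rewrite -surjective_pairing.
Qed.

Section RelTheory.
Variables (M N : grmod) (T : set (M * N)).
Hypothesis sT : grel T.
Lemma gr0 : T (0, 0). Proof. exact: gs0 sT. Qed.
Lemma grD x y x' y' : T (x, y) -> T (x', y') -> T (x + x', y + y').
Proof. exact: (gsD sT). Qed.
Lemma grB x y x' y' : T (x, y) -> T (x', y') -> T (x - x', y - y').
Proof. exact: (gsB sT). Qed.
Lemma grL s x y x' y' : T (x, y) -> T (x', y') ->
  T (s *: x + x', s *: y + y').
Proof. exact: (gsL sT). Qed.
Lemma grH (r : seq L) (f : L -> M) (g : L -> N) : uniq r ->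
  (forall a, gm_comp a (f a)) -> (forall a, gm_comp a (g a)) ->
  T (\sum_(a <- r) f a, \sum_(a <- r) g a) -> {in r, forall a, T (f a, g a)}.
Proof.
move=> ur cf cg Tfg; case: (sT) => _ _ h.
by apply: (h r (fun a => (f a, g a))) => //; rewrite sum_pair.
Qed.
End RelTheory.

Lemma gsH (M : grmod) (P : set M) (r : seq L) (f : L -> M) : gsub P -> uniq r ->
  (forall a, gm_comp a (f a)) -> P (\sum_(a <- r) f a) ->
  {in r, forall a, P (f a)}.
Proof. by case=> _ _; apply. Qed.

Lemma gsub_setT (M : grmod) : gsub [set: M]. Proof. by split. Qed.

Lemma gsub_set0 (M : grmod) : gsub [set 0 : M].
Proof.
split=> //= [s x y -> ->|r f ur cf f0 a ar]; first by rewrite scaler0 addr0.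
exact: (gm_direct ur cf f0).
Qed.

Lemma grel_inv (M N : grmod) (T : set (M * N)) : grel T -> grel (rel_inv T).
Proof.
move=> sT; apply: grelP => /= [|s x y x' y'|r f g ur cf cg h].
- exact: (gr0 sT).
- exact: (grL sT).
- exact: (grH sT ur cg cf h).
Qed.

Lemma grel_id (M : grmod) : grel (@rel_id M).
Proof.
apply: grelP => //= [s x y x' y'|r f g ur cf cg /eqP].
  by rewrite /rel_id /= => -> ->.
rewrite -subr_eq0 -sumrB => /eqP h a ar; apply/eqP.
rewrite -subr_eq0; apply/eqP; move: a ar.
by apply: gm_direct h => // a; apply: gm_compB.
Qed.

Lemma grel_zero (M N : grmod) : grel (@rel_zero M N).
Proof.
apply: grelP => //= [s x y x' y'|r f g ur cf cg h a ar].
  by rewrite /rel_zero /= => -> ->; rewrite scaler0 addr0.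
exact: (gm_direct ur cg h).
Qed.

Lemma gm_eq0 (M : grmod) (r : seq L) (f g : L -> M) : uniq r ->
  (forall a, gm_comp a (f a)) -> (forall a, gm_comp a (g a)) ->
  \sum_(a <- r) f a = \sum_(a <- r) g a -> {in r, forall a, f a = g a}.
Proof.
move=> ur cf cg /eqP; rewrite -subr_eq0 -sumrB => /eqP h a ar.
apply/eqP; rewrite -subr_eq0; apply/eqP; move: a ar.
by apply: gm_direct h => // a; apply: gm_compB.
Qed.

Lemma grel_comp (M N P : grmod) (T2 : set (N * P)) (T1 : set (M * N)) :
  grel T2 -> grel T1 -> grel (rel_comp T2 T1).
Proof.
move=> s2 s1; apply: grelP => /= [|s x y x' y' [u [xu uy]] [v [xv vy]]|].
- by exists 0; split; apply: gr0.
- by exists (s *: u + v); split; apply: grL.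
move=> r f g ur cf cg [/= y [fy yg]] a ar.
have [r' [h [ur' sr ch yE]]] := gm_refine y ur.
have := grH s1 ur' (gm_trunc r cf) ch.
have := grH s2 ur' ch (gm_trunc r cg).
rewrite !sum_trunc // yE => /(_ yg a (sr _ ar)) h2 /(_ fy a (sr _ ar)) h1.
by exists (h a); rewrite !truncE // in h1 h2 *.
Qed.

Lemma grel_add (M N : grmod) (T1 T2 : set (M * N)) :
  grel T1 -> grel T2 -> grel (rel_add T1 T2).
Proof.
move=> s1 s2; apply: grelP => /= [||r f g ur cf cg [/= y1 [y2 [fy1 fy2 e]]] a ar].
- by exists 0, 0; rewrite addr0; split=> //; apply: gr0.
- move=> s x y x' y' [/= u1 [u2 [xu1 xu2 ->]]] [/= v1 [v2 [xv1 xv2 ->]]].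
  exists (s *: u1 + v1), (s *: u2 + v2).
  by split; rewrite ?scalerDr 1?addrACA //; apply: grL.
have [r1 [g1 [ur1 sr1 cg1 y1E]]] := gm_refine y1 ur.
have [r2 [g2 [ur2 sr2 cg2 y2E]]] := gm_refine y2 ur1.
have ar1 := sr1 _ ar; have ar2 := sr2 _ ar1.
have sr : {subset r <= r2} by move=> b /sr1/sr2.
have := grH s1 ur2 (gm_trunc r cf) (gm_trunc r1 cg1).
have := grH s2 ur2 (gm_trunc r cf) cg2.
rewrite !sum_trunc // y1E y2E => /(_ fy2 a ar2) h2 /(_ fy1 a ar2) h1.
have := @gm_eq0 N r2 (trunc r g) (fun b => trunc r1 g1 b + g2 b) ur2
  (gm_trunc r cg) (fun b => gm_compD (gm_trunc r1 cg1 b) (cg2 b)).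
rewrite big_split /= !sum_trunc // y1E y2E => /(_ e a ar2) h3.
by exists (g1 a), (g2 a); rewrite !truncE // in h1 h2 h3 *.
Qed.

Lemma grel_scale (M N : grmod) k (T : set (M * N)) :
  grel T -> grel (rel_scale k T).
Proof.
move=> sT; apply: grelP => /= [||r f g ur cf cg [/= y fy e] a ar].
- by exists 0; rewrite ?scaler0 //; apply: gr0.
- move=> s x y x' y' [/= u xu ->] [/= v xv ->].
  exists (s *: u + v); first exact: grL.
  by rewrite scalerDr !scalerA mulrC.
have [r' [h [ur' sr ch yE]]] := gm_refine y ur.
have := grH sT ur' (gm_trunc r cf) ch.
rewrite !sum_trunc // yE => /(_ fy a (sr _ ar)) h1.
have := @gm_eq0 N r' (trunc r g) (fun b => cstS p l k *: h b) ur'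
  (gm_trunc r cg) (fun b => gm_compC k (ch b)).
rewrite -scaler_sumr !sum_trunc // yE => /(_ e a (sr _ ar)) h3.
by exists (h a); rewrite !truncE // in h1 h3 *.
Qed.

Lemma gsub_im (M N : grmod) (T : set (M * N)) (A : set M) :
  grel T -> gsub A -> gsub (rel_im T A).
Proof.
move=> sT sA; split=> [|s x y [u Au ux] [v Av vy]|].
- by exists 0; [apply: gs0 sA|apply: gr0].
- by exists (s *: u + v); [apply: (gsL sA)|apply: grL].
move=> r g ur cg [x Ax xg] a ar.
have [r' [h [ur' sr ch xE]]] := gm_refine x ur.
have := grH sT ur' ch (gm_trunc r cg).
rewrite sum_trunc // xE => /(_ xg a (sr _ ar)) h1.
have := gsH sA ur' ch; rewrite xE => /(_ Ax a (sr _ ar)) h2.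
by exists (h a); rewrite // truncE // in h1 *.
Qed.

Lemma gsubI (M : grmod) (A B : set M) : gsub A -> gsub B -> gsub (A `&` B).
Proof.
move=> sA sB; split=> [|s x y [? ?] [? ?]|r f ur cf [Af Bf] a ar].
- by split; [apply: gs0 sA|apply: gs0 sB].
- by split; [apply: (gsL sA)|apply: (gsL sB)].
- by split; [apply: (gsH sA ur)|apply: (gsH sB ur)].
Qed.

(* The sum and the intersection with Q are images under these relations. *)
Definition rel_plus (M : grmod) (Q : set M) : set (M * M) :=
  [set z | Q (z.2 - z.1)].
Definition rel_res (M : grmod) (Q : set M) : set (M * M) :=
  [set z | Q z.1 /\ z.2 = z.1].

Lemma grel_plus (M : grmod) (Q : set M) : gsub Q -> grel (rel_plus Q).
Proof.
move=> sQ; apply: grelP => /= [||r f g ur cf cg].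
- by rewrite /rel_plus /= subr0; apply: gs0 sQ.
- move=> s x y x' y' h h'; have := gsL sQ s h h'.
  by rewrite /rel_plus /= scalerBr addrACA -opprD.
- rewrite /rel_plus /= -sumrB => h.
  by apply: (gsH sQ ur) h => a; apply: gm_compB.
Qed.

Lemma grel_res (M : grmod) (Q : set M) : gsub Q -> grel (rel_res Q).
Proof.
move=> sQ; apply: grelP => /= [||r f g ur cf cg [/= h e] a ar].
- by split=> //; apply: gs0 sQ.
- by move=> s x y x' y' [/= ? ->] [/= ? ->]; split=> //=; apply: (gsL sQ).
- by split; [apply: (gsH sQ ur cf h)|apply: (gm_eq0 ur cg cf e)].
Qed.

Lemma fin_length_gsub (M : grmod) (A B : set M) :
  fin_length A B -> [/\ gsub A, gsub B & A `<=` B].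
Proof.
elim=> {A B} [P sP|P Q R [sP sQ PQ _ _] _ [_ sR QR]]; split=> //.
exact: subset_trans QR.
Qed.

Lemma fin_length_trans (M : grmod) (A B C : set M) :
  fin_length A B -> fin_length B C -> fin_length A C.
Proof.
elim=> {A B} // P Q R PQ _ IH RC; exact: fin_length_cons PQ (IH RC).
Qed.

Lemma fin_length_im (M N : grmod) (T : set (M * N)) (A B : set M) :
  grel T -> fin_length A B -> fin_length (rel_im T A) (rel_im T B).
Proof.
move=> sT; elim=> {A B} [P sP|P Q R [sP sQ PQ _ PQs] _ IH].
  by apply: fin_length_nil; apply: gsub_im.
have [-> //|ne] := EM (rel_im T P = rel_im T Q).
apply: fin_length_cons IH; split=> //; try exact: gsub_im.
  by move=> y [x Px xy]; exists x => //; apply: PQ.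
move=> C sC PC CQ.
pose D := Q `&` rel_im (rel_inv T) C.
have sD : gsub D by apply: gsubI => //; apply: gsub_im sC; apply: grel_inv.
have sE : gsub (rel_im (rel_plus D) P) by apply: gsub_im => //; apply: grel_plus.
case: (PQs _ sE) => [x Px|x [y Py Dxy]|e|e].
- by exists x; rewrite // /rel_plus /= subrr; apply: gs0 sD.
- rewrite -(subrK y x); apply: (gsD sQ); last exact: PQ.
  by case: Dxy.
- left; apply/seteqP; split=> // y Cy.
  have [x Qx xy] := CQ y Cy; exists x => //; rewrite -e.
  exists 0; first exact: gs0 sP.
  by rewrite /rel_plus /= subr0; split=> //; exists y.
- right; apply/seteqP; split=> // y [x Qx xy].
  move: (Qx); rewrite -e => -[u Pu [_ [v Cv /= uv]]].
  rewrite -(subrK v y); apply: (gsD sC) => //; apply: PC; exists u => //.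
  by have := grB sT xy uv; rewrite subKr.
Qed.

Lemma rel_im_plus (M : grmod) (A B : set M) :
  rel_im (rel_plus B) A = [set x | exists a b, [/\ A a, B b & x = a + b]].
Proof.
apply/seteqP; split=> x /= [a].
  by exists a, (x - a); split=> //; rewrite [RHS]addrC subrK.
by move=> [b [Aa Bb ->]]; exists a => //; rewrite /rel_plus /= [a + b]addrC addrK.
Qed.

Lemma rel_im_res (M : grmod) (A B : set M) : rel_im (rel_res B) A = A `&` B.
Proof.
apply/seteqP; split=> x /=; first by move=> [y Ay [/= By ->]].
by move=> [Ax Bx]; exists x.
Qed.

Definition sub_sum (M : grmod) (A B : set M) :=
  [set x | exists a b, [/\ A a, B b & x = a + b]].

Lemma fin_length_add (M : grmod) (A B : set M) :
  fin_length [set 0] A -> fin_length [set 0] B ->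
  fin_length [set 0] (sub_sum A B).
Proof.
move=> fA fB; have [_ sA _] := fin_length_gsub fA.
have [_ sB _] := fin_length_gsub fB.
have := fin_length_im (grel_plus sB) fA; rewrite !rel_im_plus.
suff -> : [set x | exists a b, [/\ [set 0] a, B b & x = a + b]] = B.
  exact: fin_length_trans fB.
apply/seteqP; split=> [x [_ [b [-> Bb ->]]]|x Bx]; first by rewrite add0r.
by exists 0, x; rewrite add0r.
Qed.

Lemma fin_length_cap (M : grmod) (A B : set M) :
  fin_length A setT -> fin_length B setT -> fin_length (A `&` B) setT.
Proof.
move=> fA fB; have [sA _ _] := fin_length_gsub fA.
have := fin_length_im (grel_res sA) fB; rewrite !rel_im_res setTI setIC.
by move=> /fin_length_trans; apply.
Qed.

(* A homomorphism from X to Y in the quotient category is represented by a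
   homomorphism u : X' -> Y/Y' with X/X' and Y' of finite length. It is encoded
   by the graded submodule {(x, y) | x in X', y in u(x)} of X (+) Y, from which
   X', Y' and u are recovered as its domain, its indeterminacy [rel_ind] and
   the map it induces. Composing u : X' -> Y/Y' with v : Y'' -> Z/Z' in the
   quotient category, i.e. restricting u to the preimage of (Y' + Y'')/Y' and
   enlarging Z' by v(Y' cap Y''), amounts to composing these relations. *)
Record frac (M N : grmod) := Frac {
  fr : set (M * N);
  fr_sub : grel fr;
  fr_dom : fin_length (rel_dom fr) setT;
  fr_ind : fin_length [set 0] (rel_ind fr)
}.

(* Equality in the colimit of Hom(X', Y/Y') over such X' and Y': the two
   homomorphisms agree as maps A -> Y/B for some smaller A and larger B. *)
Definition frac_eqv (M N : grmod) (R1 R2 : frac M N) : Prop :=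
  exists (A : set M) (B : set N),
    [/\ fin_length A setT, fin_length [set 0] B,
        A `<=` rel_dom (fr R1) `&` rel_dom (fr R2)
      & forall x y1 y2, A x -> fr R1 (x, y1) -> fr R2 (x, y2) -> B (y1 - y2)].

Lemma rel_domE (M N : grmod) (T : set (M * N)) :
  rel_dom T = rel_im (rel_inv T) setT.
Proof. by apply/seteqP; split=> x [y]; [exists y|move=> _ ?; exists y]. Qed.

Lemma rel_indE (M N : grmod) (T : set (M * N)) :
  rel_ind T = rel_im T [set 0].
Proof. by apply/seteqP; split=> x; [exists 0|case=> _ ->]. Qed.

Lemma rel_im_comp (M N P : grmod) (T2 : set (N * P)) (T1 : set (M * N)) A :
  rel_im (rel_comp T2 T1) A = rel_im T2 (rel_im T1 A).
Proof.
apply/seteqP; split=> z.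
  by move=> [x Ax [y [xy yz]]]; exists y => //; exists x.
by move=> [y [x Ax xy] yz]; exists x => //; exists y.
Qed.

Lemma rel_inv_comp (M N P : grmod) (T2 : set (N * P)) (T1 : set (M * N)) :
  rel_inv (rel_comp T2 T1) = rel_comp (rel_inv T1) (rel_inv T2).
Proof. by apply/seteqP; split=> -[z x] [y [? ?]]; exists y. Qed.

Lemma frac_id_subproof (M : grmod) :
  fin_length (rel_dom (@rel_id M)) setT /\
  fin_length [set 0] (rel_ind (@rel_id M)).
Proof.
have -> : rel_dom (@rel_id M) = setT by apply/seteqP; split=> // x _; exists x.
have -> : rel_ind (@rel_id M) = [set 0] by apply/seteqP; split=> x /=.
split; apply: fin_length_nil; [exact: gsub_setT|exact: gsub_set0].
Qed.

Definition frac_id (M : grmod) : frac M M :=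
  Frac (@grel_id M) (frac_id_subproof M).1 (frac_id_subproof M).2.

Lemma frac_zero_subproof (M N : grmod) :
  fin_length (rel_dom (@rel_zero M N)) setT /\
  fin_length [set 0] (rel_ind (@rel_zero M N)).
Proof.
have -> : rel_dom (@rel_zero M N) = setT.
  by apply/seteqP; split=> // x _; exists 0.
have -> : rel_ind (@rel_zero M N) = [set 0] by apply/seteqP; split=> x /=.
split; apply: fin_length_nil; [exact: gsub_setT|exact: gsub_set0].
Qed.

Definition frac_zero (M N : grmod) : frac M N :=
  Frac (@grel_zero M N) (frac_zero_subproof M N).1 (frac_zero_subproof M N).2.

Section FracComp.
Variables (M N P : grmod) (R2 : frac N P) (R1 : frac M N).

Lemma frac_pull (A : set N) :
  fin_length A setT -> fin_length (rel_im (rel_inv (fr R1)) A) setT.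
Proof.
move=> /(fin_length_im (grel_inv (fr_sub R1))) /fin_length_trans; apply.
by rewrite -rel_domE; apply: fr_dom.
Qed.

Lemma frac_push (B : set M) :
  fin_length [set 0] B -> fin_length [set 0] (rel_im (fr R1) B).
Proof.
move=> /(fin_length_im (fr_sub R1)); apply: fin_length_trans.
by rewrite -rel_indE; apply: fr_ind.
Qed.

End FracComp.

Lemma frac_comp_subproof (M N P : grmod) (R2 : frac N P) (R1 : frac M N) :
  fin_length (rel_dom (rel_comp (fr R2) (fr R1))) setT /\
  fin_length [set 0] (rel_ind (rel_comp (fr R2) (fr R1))).
Proof.
split.
  rewrite rel_domE rel_inv_comp rel_im_comp -rel_domE.
  by apply: frac_pull; apply: fr_dom.
by rewrite rel_indE rel_im_comp -rel_indE; apply: frac_push; apply: fr_ind.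
Qed.

Definition frac_comp (M N P : grmod) (R2 : frac N P) (R1 : frac M N) :
    frac M P :=
  Frac (grel_comp (fr_sub R2) (fr_sub R1)) (frac_comp_subproof R2 R1).1
    (frac_comp_subproof R2 R1).2.

Lemma frac_add_subproof (M N : grmod) (R1 R2 : frac M N) :
  fin_length (rel_dom (rel_add (fr R1) (fr R2))) setT /\
  fin_length [set 0] (rel_ind (rel_add (fr R1) (fr R2))).
Proof.
split.
  suff -> : rel_dom (rel_add (fr R1) (fr R2)) =
            rel_dom (fr R1) `&` rel_dom (fr R2).
    by apply: fin_length_cap; apply: fr_dom.
  apply/seteqP; split=> x.
    by move=> [y [y1 [y2 [? ? _]]]]; split; [exists y1|exists y2].
  by move=> [[y1 ?] [y2 ?]]; exists (y1 + y2), y1, y2.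
exact: fin_length_add (fr_ind R1) (fr_ind R2).
Qed.

Definition frac_add (M N : grmod) (R1 R2 : frac M N) : frac M N :=
  Frac (grel_add (fr_sub R1) (fr_sub R2)) (frac_add_subproof R1 R2).1
    (frac_add_subproof R1 R2).2.

Lemma grel_mul (M : grmod) (k : K) :
  grel [set z : M * M | z.2 = cstS p l k *: z.1].
Proof.
suff <- : rel_scale k (@rel_id M) = [set z : M * M | z.2 = cstS p l k *: z.1].
  by apply: grel_scale; apply: grel_id.
apply/seteqP; split=> -[x y] /=.
  by move=> [u e /= ->]; rewrite /rel_id /= in e; rewrite e.
by move=> /= ->; exists x.
Qed.

Lemma frac_scale_subproof (M N : grmod) (k : K) (R : frac M N) :
  fin_length (rel_dom (rel_scale k (fr R))) setT /\
  fin_length [set 0] (rel_ind (rel_scale k (fr R))).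
Proof.
split.
  suff -> : rel_dom (rel_scale k (fr R)) = rel_dom (fr R) by apply: fr_dom.
  apply/seteqP; split=> x; first by move=> [_ [/= y ? _]]; exists y.
  by move=> [y ?]; exists (cstS p l k *: y), y.
have -> : rel_ind (rel_scale k (fr R)) =
    rel_im [set z : N * N | z.2 = cstS p l k *: z.1] (rel_ind (fr R)).
  by apply/seteqP; split=> x [y ? /= e]; exists y.
have := fin_length_im (@grel_mul N k) (fr_ind R).
suff -> : rel_im [set z : N * N | z.2 = cstS p l k *: z.1] [set 0] = [set 0].
  by [].
apply/seteqP; split=> x /=; first by move=> [_ -> /= ->]; rewrite scaler0.
by move=> ->; exists 0; rewrite //= scaler0.
Qed.

Definition frac_scale (M N : grmod) (k : K) (R : frac M N) : frac M N :=
  Frac (grel_scale k (fr_sub R)) (frac_scale_subproof k R).1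
    (frac_scale_subproof k R).2.

Section FracEqv.
Variables M N : grmod.
Implicit Types R : frac M N.

Lemma frac_le_eqv R1 R2 : fr R1 `<=` fr R2 -> frac_eqv R1 R2.
Proof.
move=> le; exists (rel_dom (fr R1)), (rel_ind (fr R2)).
split; [exact: fr_dom|exact: fr_ind| |].
  by move=> x [y xy]; split; exists y => //; apply: le.
by move=> x y1 y2 _ /le h1 h2; have := grB (fr_sub R2) h1 h2; rewrite subrr.
Qed.

Lemma frac_eqv_refl R : frac_eqv R R. Proof. exact: frac_le_eqv. Qed.

Lemma frac_eqv_sym R1 R2 : frac_eqv R1 R2 -> frac_eqv R2 R1.
Proof.
move=> [A [B [fA fB AR h]]]; exists A, B; split=> // [x /AR[]//|x y1 y2 Ax h1 h2].
have [_ sB _] := fin_length_gsub fB.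
by rewrite -opprB; apply: (gsN sB); apply: h h1.
Qed.

Lemma frac_eqv_trans R1 R2 R3 :
  frac_eqv R1 R2 -> frac_eqv R2 R3 -> frac_eqv R1 R3.
Proof.
move=> [A [B [fA fB AR h]]] [A' [B' [fA' fB' AR' h']]].
exists (A `&` A'), (sub_sum B B'); split.
- exact: fin_length_cap.
- exact: fin_length_add.
- by move=> x [/AR[? ?] /AR'[? ?]].
move=> x y1 y3 [Ax A'x] h1 h3; have [_ [y2 h2]] := AR _ Ax.
exists (y1 - y2), (y2 - y3); split; first exact: h h2.
  exact: h' h3.
by rewrite addrA subrK.
Qed.

Lemma frac_ext R1 R2 : fr R1 = fr R2 -> frac_eqv R1 R2.
Proof. by move=> e; apply: frac_le_eqv; rewrite e. Qed.

Lemma frac_eqv_add R1 R1' R2 R2' : frac_eqv R1 R1' -> frac_eqv R2 R2' ->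
  frac_eqv (frac_add R1 R2) (frac_add R1' R2').
Proof.
move=> [A [B [fA fB AR h]]] [A' [B' [fA' fB' AR' h']]].
exists (A `&` A'), (sub_sum B B'); split.
- exact: fin_length_cap.
- exact: fin_length_add.
- move=> x [/AR[[u xu] [v xv]] /AR'[[u' xu'] [v' xv']]].
  by split; [exists (u + u'), u, u'|exists (v + v'), v, v'].
move=> x _ _ [Ax A'x] [/= u [u' [xu xu' ->]]] [/= v [v' [xv xv' ->]]].
exists (u - v), (u' - v'); split; [exact: h xv|exact: h' xv'|].
by rewrite opprD addrACA.
Qed.

Lemma frac_eqv_scale k R1 R2 : frac_eqv R1 R2 ->
  frac_eqv (frac_scale k R1) (frac_scale k R2).
Proof.
move=> [A [B [fA fB AR h]]]; have [_ sB _] := fin_length_gsub fB.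
exists A, B; split=> //.
  move=> x /AR[[u xu] [v xv]].
  by split; [exists (cstS p l k *: u), u|exists (cstS p l k *: v), v].
move=> x _ _ Ax [/= u xu ->] [/= v xv ->].
by rewrite -scalerBr; apply: (gsZ sB); apply: h xv.
Qed.

End FracEqv.

Lemma frac_eqv_comp (M N P : grmod) (T T' : frac N P) (R R' : frac M N) :
  frac_eqv T T' -> frac_eqv R R' ->
  frac_eqv (frac_comp T R) (frac_comp T' R').
Proof.
move=> TT' RR'; apply: (@frac_eqv_trans _ _ _ (frac_comp T' R)).
- case: TT' => A [B [fA fB AT h]].
  exists (rel_im (rel_inv (fr R)) A).
  exists (sub_sum (sub_sum (rel_ind (rel_comp (fr T) (fr R))) B)
    (rel_ind (rel_comp (fr T') (fr R)))); split.
  + exact: frac_pull.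
  + apply: fin_length_add; first apply: fin_length_add => //.
      exact: (fr_ind (frac_comp T R)).
    exact: (fr_ind (frac_comp T' R)).
  + move=> x [y Ay xy]; have [[z yz] [z' yz']] := AT _ Ay.
    by split; [exists z, y|exists z', y].
  move=> x z1 z2 [y Ay xy] [y1 [/= xy1 yz1]] [y2 [/= xy2 yz2]].
  have [[z yz] [z' yz']] := AT _ Ay.
  exists (z1 - z + (z - z')), (z' - z2); split; last first.
  + by rewrite !subrKA.
  + exists (y - y2); split=> /=; last exact: (grB (fr_sub T') yz' yz2).
    by have := grB (fr_sub R) xy xy2; rewrite subrr.
  exists (z1 - z), (z - z'); split=> //; last exact: h yz'.
  exists (y1 - y); split=> /=; last exact: (grB (fr_sub T) yz1 yz).
  by have := grB (fr_sub R) xy1 xy; rewrite subrr.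
- case: RR' => A [B [fA fB AR h]].
  exists (A `&` (rel_dom (fr (frac_comp T' R)) `&`
                 rel_dom (fr (frac_comp T' R')))).
  exists (rel_im (fr T') B); split.
  + apply: fin_length_cap => //.
    apply: fin_length_cap; [exact: (fr_dom (frac_comp T' R))|].
    exact: (fr_dom (frac_comp T' R')).
  + exact: frac_push.
  + by move=> x [].
  move=> x z1 z2 [Ax _] [y1 [/= xy1 yz1]] [y2 [/= xy2 yz2]].
  exists (y1 - y2); first exact: h xy2.
  exact: (grB (fr_sub T') yz1 yz2).
Qed.

Section Hom.
Variables M N : grmod.

HB.instance Definition _ := gen_eqMixin (frac M N).
HB.instance Definition _ := gen_choiceMixin (frac M N).

Definition frac_eqvb : rel (frac M N) := fun R1 R2 => `[< frac_eqv R1 R2 >].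

Lemma frac_eqvb_equiv : equiv_class_of frac_eqvb.
Proof.
split=> [R|R1 R2|R2 R1 R3].
- by apply/asboolP; apply: frac_eqv_refl.
- by apply/asboolP/asboolP; apply: frac_eqv_sym.
- by move=> /asboolP h1 /asboolP h2; apply/asboolP; apply: frac_eqv_trans h2.
Qed.

Canonical frac_equiv_rel := EquivRelPack frac_eqvb_equiv.
Canonical frac_encModRel := defaultEncModRel frac_eqvb.

Definition qhom := {eq_quot frac_eqvb}.
HB.instance Definition _ := EqQuotient.on qhom.
HB.instance Definition _ := Choice.on qhom.

Definition qclass (R : frac M N) : qhom := \pi_qhom R.

Lemma qclassP R1 R2 : qclass R1 = qclass R2 <-> frac_eqv R1 R2.
Proof.
split=> [/eqP|h]; last by apply/eqP; rewrite /qclass piE; apply/asboolP.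
by rewrite /qclass piE => /asboolP.
Qed.

Lemma qclass_repr (f : qhom) : qclass (repr f) = f.
Proof. exact: reprK. Qed.

Definition qadd (f g : qhom) : qhom := qclass (frac_add (repr f) (repr g)).
Definition qscale (k : K) (f : qhom) : qhom := qclass (frac_scale k (repr f)).
Definition qzero : qhom := qclass (frac_zero M N).
Definition qopp : qhom -> qhom := qscale (-1).

Lemma qaddE R1 R2 : qadd (qclass R1) (qclass R2) = qclass (frac_add R1 R2).
Proof.
by apply/qclassP; apply: frac_eqv_add; apply/qclassP; rewrite qclass_repr.
Qed.

Lemma qscaleE k R : qscale k (qclass R) = qclass (frac_scale k R).
Proof. by apply/qclassP; apply: frac_eqv_scale; apply/qclassP; rewrite qclass_repr. Qed.

Lemma qaddA : associative qadd.
Proof.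
move=> f g h; rewrite -[f]qclass_repr -[g]qclass_repr -[h]qclass_repr !qaddE.
apply/qclassP/frac_ext/seteqP; split=> -[x y] /=.
  move=> [y1 [_ [/= h1 [/= y2 [y3 [h2 h3 ->]]] ->]]].
  by exists (y1 + y2), y3; split=> //=; [exists y1, y2|rewrite addrA].
move=> [_ [y3 [/= [/= y1 [y2 [h1 h2 ->]]] h3 ->]]].
by exists y1, (y2 + y3); split=> //=; [exists y2, y3|rewrite addrA].
Qed.

Lemma qaddC : commutative qadd.
Proof.
move=> f g; rewrite -[f]qclass_repr -[g]qclass_repr !qaddE.
apply/qclassP/frac_ext/seteqP; split=> -[x y] /= [y1 [y2 [/= h1 h2 ->]]];
by exists y2, y1; split=> //=; rewrite addrC.
Qed.

Lemma qadd0 : left_id qzero qadd.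
Proof.
move=> f; rewrite -[f]qclass_repr qaddE.
apply/qclassP/frac_ext/seteqP; split=> -[x y] /=.
  move=> [y1 [y2 [z1 h2 /= ->]]]; rewrite /rel_zero /= in z1.
  by rewrite z1 add0r.
by exists 0, y; rewrite add0r.
Qed.

Lemma qaddN : left_inverse qzero qopp qadd.
Proof.
move=> f; rewrite -[f]qclass_repr /qopp qscaleE qaddE; apply/qclassP.
set R := repr f.
exists (rel_dom (fr R)), (rel_ind (fr R)).
split; [exact: fr_dom|exact: fr_ind| |].
  move=> x [y xy]; split; last by exists 0.
  by exists (cstS p l (-1) *: y + y), (cstS p l (-1) *: y), y; split=> //; exists y.
move=> x u v _ [/= u1 [u2 [/= [/= w h1 /= ->] h2 /= ->]]].
rewrite /rel_zero /= => ->.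
have -> : cstS p l (-1) = -1 by rewrite -cstS1 /cstS mpolyCN raddfN.
rewrite scaleN1r subr0 addrC.
by have := grB (fr_sub R) h2 h1; rewrite subrr.
Qed.

HB.instance Definition _ := GRing.isZmodule.Build qhom qaddA qaddC qadd0 qaddN.

Lemma qscaleA a b (f : qhom) : qscale a (qscale b f) = qscale (a * b) f.
Proof.
rewrite -[f]qclass_repr !qscaleE.
apply/qclassP/frac_ext/seteqP; split=> -[x y] /=.
  by move=> [/= _ [/= y1 h1 ->] ->]; exists y1; rewrite //= cstSM scalerA.
move=> [/= y1 h1 ->]; exists (cstS p l b *: y1); first by exists y1.
by rewrite /= cstSM scalerA.
Qed.

Lemma qscale1 : left_id 1 qscale.
Proof.
move=> f; rewrite -[f]qclass_repr !qscaleE.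
apply/qclassP/frac_ext/seteqP; split=> -[x y] /=.
  by move=> [/= y1 h1 ->]; rewrite cstS1 scale1r.
by move=> h; exists y; rewrite //= cstS1 scale1r.
Qed.

Lemma qscaleDr : right_distributive qscale +%R.
Proof.
move=> a f g; rewrite -[f]qclass_repr -[g]qclass_repr.
rewrite [_ + _]qaddE !qscaleE [RHS]qaddE.
apply/qclassP/frac_ext/seteqP; split=> -[x y] /=.
  move=> [/= _ [/= y1 [y2 [h1 h2 ->]]] ->].
  exists (cstS p l a *: y1), (cstS p l a *: y2).
  by split; rewrite ?scalerDr //; [exists y1|exists y2].
move=> [/= _ [_ [/= [/= y1 h1 ->] [/= y2 h2 ->] ->]]].
by exists (y1 + y2); rewrite /= ?scalerDr //; exists y1, y2.
Qed.

Lemma qscaleDl (f : qhom) : {morph qscale^~ f : a b / a + b}.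
Proof.
move=> a b /=; rewrite -[f]qclass_repr !qscaleE [RHS]qaddE.
apply/qclassP/frac_le_eqv => -[x y] /= [/= y1 h1 ->].
exists (cstS p l a *: y1), (cstS p l b *: y1).
by split; rewrite /= ?cstSD ?scalerDl //; exists y1.
Qed.

HB.instance Definition _ :=
  GRing.Zmodule_isLmodule.Build K qhom qscaleA qscale1 qscaleDr qscaleDl.

End Hom.

Definition qid (M : grmod) : qhom M M := qclass (frac_id M).

Definition qcomp (M N P : grmod) (g : qhom N P) (f : qhom M N) : qhom M P :=
  qclass (frac_comp (repr g) (repr f)).

Lemma qcompE (M N P : grmod) (T : frac N P) (R : frac M N) :
  qcomp (qclass T) (qclass R) = qclass (frac_comp T R).
Proof.
by apply/qclassP; apply: frac_eqv_comp; apply/qclassP; rewrite qclass_repr.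
Qed.

Lemma qcompA (M N P Q : grmod) (h : qhom P Q) (g : qhom N P) (f : qhom M N) :
  qcomp h (qcomp g f) = qcomp (qcomp h g) f.
Proof.
rewrite -[f]qclass_repr -[g]qclass_repr -[h]qclass_repr !qcompE.
apply/qclassP/frac_ext/seteqP; split=> -[x y] /=.
  by move=> [z [/= [w [/= ? ?]] ?]]; exists w; split=> //; exists z.
by move=> [w [/= ? [z [/= ? ?]]]]; exists z; split=> //; exists w.
Qed.

Lemma qcomp1m (M N : grmod) (f : qhom M N) : qcomp (qid N) f = f.
Proof.
rewrite -[f]qclass_repr qcompE; apply/qclassP/frac_ext/seteqP.
split=> -[x y] /=; last by exists y.
by move=> [z [xz]]; rewrite /rel_id /= => <-.
Qed.

Lemma qcompm1 (M N : grmod) (f : qhom M N) : qcomp f (qid M) = f.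
Proof.
rewrite -[f]qclass_repr qcompE; apply/qclassP/frac_ext/seteqP.
split=> -[x y] /=; last by exists x.
by move=> [z []]; rewrite /rel_id /= => ->.
Qed.

Lemma qcomp_linear_l (M N P : grmod) (f : qhom M N) :
  linear (fun g : qhom N P => qcomp g f).
Proof.
move=> a g h; rewrite -[f]qclass_repr -[g]qclass_repr -[h]qclass_repr.
rewrite [a *: _]qscaleE [X in qcomp X _]qaddE !qcompE.
rewrite [a *: _]qscaleE [RHS]qaddE; apply/qclassP/frac_le_eqv => -[x y] /=.
move=> [z [/= xz [/= _ [u2 [/= [/= u1 zu1 ->] zu2 ->]]]]].
exists (cstS p l a *: u1), u2; split=> //=; last by exists z.
by exists u1 => //; exists z.
Qed.

Lemma qcomp_linear_r (M N P : grmod) (g : qhom N P) :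
  linear (@qcomp M N P g).
Proof.
move=> a f h; rewrite -[f]qclass_repr -[g]qclass_repr -[h]qclass_repr.
rewrite [a *: _]qscaleE [X in qcomp _ X]qaddE !qcompE.
rewrite [a *: _]qscaleE [RHS]qaddE; apply/qclassP/frac_eqv_sym/frac_le_eqv.
move=> -[x y] /= [_ [z2 [/= [/= z1 [y1 [/= h1 k1]] ->] [y2 [/= h2 k2]] ->]]].
exists (cstS p l a *: y1 + y2); split=> /=; last exact: (grL (fr_sub (repr g))).
by exists (cstS p l a *: y1), y2; split=> //; exists y1.
Qed.

(* Serre's description of the coherent sheaves on the weighted projective line:
   finitely generated graded S-modules modulo those of finite length. *)
Definition coh : lincat K :=
  LinCat (hom := fun M N => qhom M N : lmodType K) (idm := qid) (cmp := qcomp)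
    qcompA qcomp1m qcompm1 qcomp_linear_l qcomp_linear_r.

End GradedModules.

(* Main.v *)
From HB Require Import structures.
From mathcomp Require Import all_boot all_order all_algebra.
From mathcomp Require Import generic_quotient ring_quotient.
From mathcomp Require Import boolp classical_sets mpoly.
From mathcomp Require Import zify ring.
Require Import Defs.

Set Implicit Arguments.
Unset Strict Implicit.
Unset Printing Implicit Defensive.

Import Order.TTheory GRing.Theory Num.Theory.
Local Open Scope ring_scope.
Local Open Scope quotient_scope.

(** A coherent sheaf is handled through its graded module in large degrees,
    where the degree of an element of L(p) is its slope, a positive integer on
    each [x_i]. A morphism of sheaves is a graded map defined in large degrees
    ([germ_make], [germ_ext]); it is a monomorphism or an epimorphism iff it
    is injective or surjective in large degrees ([monoP], [epiP]), and short
    exact sequences are those that are exact in large degrees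
    ([short_exactP]). From which degree on this can be seen depends on the
    morphism, and the proof consists in removing this dependence.

    For a module Y, the Koszul complex of multiplication by U and V is exact
    beyond a degree [regdeg Y]. A morphism X -> Y given in degree [a + c] by
    its effect on U x and V x therefore descends to degree [a], and by
    iteration every morphism f has a component in each degree [a] beyond
    [regdeg Y]: a matrix [smat f a] that depends linearly on f. Let
    [drank f a] be its rank. Along a ray [a + k c] the images of these
    matrices form a K[U,V]-module generated in degree 0. Its Hilbert function
    is concave in k, and it is linear from a step on that depends only on Y
    ([gen_dim_linear]), because the final slope bounds it up to a constant
    that is the same for all submodules ([stable_dim_bound]). As finitely many
    rays cover L(p) in large degrees, there is a finite set T of degrees such
    that the values of [drank f] on T determine [drank f] in large degrees,
    that is, the Hilbert function of the image of f ([test_degrees]).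

    On the other hand the class of a sheaf in the Grothendieck group is
    equivalent to its Hilbert function in large degrees. The Hilbert function
    is additive on short exact sequences ([hilb_eq]). Conversely, filtering a
    module by cyclic modules, and torsion modules by quotients of line bundles
    by prime elements, shows that line bundles generate the group ([rep_ex]).
    The sheaves S/X_i and S/z, for z a linear form that vanishes at none of
    the exceptional points, are isomorphic to some of their twists, and the
    resulting relations bring every class to a normal form
    [r u_0 + \sum al_i(s) E_(i,s) + be v_0], whose Hilbert function
    vanishes in large degrees only if the class does ([K0_gdim]).

    So two morphisms have the same rank iff their matrices in the degrees of T
    have the same ranks. This leaves finitely many ranks, and each stratum is
    locally closed since a matrix depending linearly on f has rank at least r
    where some minor of size at least r does not vanish ([zclosed_rank]). The
    monomorphisms and the epimorphisms are the morphisms for which these ranks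
    take the greatest possible values, which is an open condition. *)

(** * Ideals of binary forms *)

Lemma noninc_stable (q : nat -> nat) k0 :
  (forall k, (k0 <= k)%N -> (q k.+1 <= q k)%N) ->
  exists k1, (k0 <= k1)%N /\ forall k, (k1 <= k)%N -> q k = q k1.
Proof.
move=> q_le; have [N le_N] := ubnP (q k0).
elim: N => // N IH in k0 q_le le_N *.
have [[k k0k qk]|no] := EM (exists2 k, (k0 <= k)%N & (q k < q k0)%N).
  have [j kj|//|k1 [kk1 h]] := IH k; first by apply: q_le; lia.
    by apply: leq_trans qk _; rewrite -ltnS.
  by exists k1; split=> //; apply: leq_trans kk1.
exists k0; split=> // k k0k; apply/eqP; rewrite eqn_leq; apply/andP; split.
  elim: k k0k => [|k IHk]; first by rewrite leqn0 => /eqP->.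
  rewrite leq_eqVlt => /orP[/eqP-> //|lt].
  exact: leq_trans (q_le k lt) (IHk lt).
by rewrite leqNgt; apply/negP => h; apply: no; exists k.
Qed.

Section Binary.
Variable K : fieldType.

(** Forms of degree [k] in U and V, dehomogenized at U = 1: the form
    [\sum r_i U^(k-i) V^i] is the row of coefficients [r]. *)
Notation form k := 'rV[K]_k.+1.

Definition mulU k (r : form k) : form k.+1 := poly_rV (rVpoly r).
Definition mulV k (r : form k) : form k.+1 := poly_rV ('X * rVpoly r).

Fact mulU_linear k : linear (@mulU k).
Proof. by move=> a r s; rewrite /mulU !linearP. Qed.
Fact mulV_linear k : linear (@mulV k).
Proof. by move=> a r s; rewrite /mulV linearP mulrDr -scalerAr linearP. Qed.
HB.instance Definition _ k :=
  GRing.isLinear.Build K _ _ _ (@mulU k) (@mulU_linear k).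
HB.instance Definition _ k :=
  GRing.isLinear.Build K _ _ _ (@mulV k) (@mulV_linear k).

Definition formU k : 'Hom(form k, form k.+1) := linfun (@mulU k).
Definition formV k : 'Hom(form k, form k.+1) := linfun (@mulV k).

Lemma formUE k (r : form k) : rVpoly (formU k r) = rVpoly r.
Proof. by rewrite lfunE /= poly_rV_K // ltnW // ltnS; apply: size_poly. Qed.

Lemma formVE k (r : form k) : rVpoly (formV k r) = 'X * rVpoly r.
Proof.
rewrite lfunE /= poly_rV_K // mulrC (leq_trans (size_polyMleq _ _)) //.
by rewrite size_polyX addn2 /= ltnS; apply: size_poly.
Qed.

Lemma rVpoly_inj d : injective (@rVpoly K d).
Proof. exact: can_inj rVpolyK. Qed.

Lemma formU_inj k : injective (formU k).
Proof. by move=> r s /(congr1 rVpoly); rewrite !formUE => /rVpoly_inj. Qed.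

Lemma dim_form_le k (J : {vspace form k}) : (\dim J <= k.+1)%N.
Proof. by rewrite (leq_trans (dimvS (subvf J))) // dimvf /dim /= mul1n. Qed.

(** Were [U J + V J] not larger than [U J], which has the dimension of J, then
    V J would be contained in U J; dehomogenized, J would be stable under
    multiplication by the indeterminate, which is absurd as degrees are
    bounded. *)
Lemma form_growth k (J : {vspace form k}) : J != 0%VS ->
  (\dim J < \dim (formU k @: J + formV k @: J))%N.
Proof.
move=> J0; have dU : \dim (formU k @: J) = \dim J.
  by apply: limg_dim_eq; rewrite (eqP (introT lker0P (@formU_inj k))) capv0.
rewrite ltn_neqAle -{2}dU dimvS ?addvSl // andbT -dU; apply/eqP => e.
have VU : (formV k @: J <= formU k @: J)%VS.
  have /eqP -> : (formU k @: J == formU k @: J + formV k @: J)%VS.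
    by rewrite eqEdim addvSl e /=.
  exact: addvSr.
have step (r : form k) : r \in J -> exists2 s : form k, s \in J & rVpoly s = 'X * rVpoly r.
  move=> Jr; have /memv_imgP[s Js e1] := subvP VU _ (memv_img (formV k) Jr).
  by exists s => //; rewrite -formVE e1 formUE.
have iter_step (r : form k) m : r \in J ->
    exists2 s : form k, s \in J & rVpoly s = 'X^m * rVpoly r.
  move=> Jr; elim: m => [|m [s Js e1]]; first by exists r; rewrite // mul1r.
  by have [t Jt e2] := step s Js; exists t; rewrite // e2 e1 mulrA -exprS.
case: (iter_step (vpick J) k.+1 (memv_pick J)) => s _ /(congr1 (size \o val)) /=.
have p0 : rVpoly (vpick J) != 0.
  by apply: contraNneq J0 => e1; rewrite -vpick0 -(inj_eq (@rVpoly_inj _)) e1 linear0.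
rewrite mulrC size_mulXn // => e1.
have : (size (rVpoly s) <= k.+1)%N by apply: size_poly.
by rewrite e1 -[leqRHS]addn0 leq_add2l leqn0 size_poly_eq0 (negPf p0).
Qed.

Definition form_stable (J : forall k, {vspace form k}) :=
  forall k r, r \in J k -> formU k r \in J k.+1 /\ formV k r \in J k.+1.

Lemma form_stable_img J k : form_stable J ->
  (formU k @: J k + formV k @: J k <= J k.+1)%VS.
Proof.
move=> sJ; rewrite subv_add; apply/andP.
by split; apply/subvP => _ /memv_imgP[r Jr ->]; case: (sJ k r Jr).
Qed.

Lemma form_stable_neq0 J k0 k : form_stable J -> J k0 != 0%VS ->
  (k0 <= k)%N -> J k != 0%VS.
Proof.
move=> sJ J0 /subnK <-; elim: (k - k0)%N => // m; rewrite addSn => Jm.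
rewrite -dimv_eq0 -lt0n; apply: leq_trans (dimvS (form_stable_img (m + k0) sJ)).
exact: leq_ltn_trans (form_growth Jm).
Qed.

Lemma form_growth_stable J k0 k : form_stable J -> J k0 != 0%VS ->
  (k0 <= k)%N -> (\dim (J k) < \dim (J k.+1))%N.
Proof.
move=> sJ J0 k0k; apply: leq_trans (dimvS (form_stable_img k sJ)).
exact: form_growth (form_stable_neq0 sJ J0 k0k).
Qed.

Lemma form_stable_dim_ge J k0 k : form_stable J -> J k0 != 0%VS ->
  (k0 <= k)%N -> (k < \dim (J k) + k0)%N.
Proof.
move=> sJ J0 /subnK <-.
elim: (k - k0)%N => [|m IH]; first by rewrite add0n -{1}[k0]add0n ltn_add2r lt0n dimv_eq0.
have := form_growth_stable sJ J0 (leq_addl m k0); rewrite addSn; lia.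
Qed.

Lemma form_stable_codim J k0 : form_stable J -> J k0 != 0%VS ->
  exists k1, (k0 <= k1)%N /\
    forall k, (k1 <= k)%N -> \dim (J k.+1) = (\dim (J k)).+1.
Proof.
move=> sJ J0; have [|k1 [k01 h]] := @noninc_stable (fun k => k.+1 - \dim (J k))%N k0.
  move=> k k0k; have := form_growth_stable sJ J0 k0k; lia.
exists k1; split=> // k k1k; have := h k k1k; have := h k.+1 (leqW k1k).
have := dim_form_le (J k); have := dim_form_le (J k.+1).
have := form_growth_stable sJ J0 (leq_trans k01 k1k); lia.
Qed.

(** The codimension of a nonzero ideal of binary forms is eventually constant,
    so a form whose products with U and V lie in the ideal already belongs to
    it: adding it would increase the next dimension by one more. *)
Lemma form_stable_soc J : form_stable J ->
  exists k1, forall k, (k1 <= k)%N -> forall r, formU k r \in J k.+1 ->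
    formV k r \in J k.+1 -> r \in J k.
Proof.
move=> sJ; have [[k0 J0]|no] := EM (exists k0, J k0 != 0%VS); last first.
  exists 0%N => k _ r; have e0 j : J j = 0%VS.
    by apply/eqP; apply: contra_notT no => ?; exists j.
  rewrite !e0 !memv0 => /eqP e _; apply/eqP.
  by apply: (@formU_inj k); rewrite e linear0.
have [k1 [k01 h]] := form_stable_codim sJ J0.
exists k1 => k k1k r Ur Vr; apply/negPn/negP => nr.
pose J' := (J k + <[r]>)%VS.
have dJ' : (\dim (J k) < \dim J')%N.
  rewrite ltn_neqAle dimvS ?addvSl // andbT; apply: contra nr => /eqP e.
  have /eqP -> : (J k == J')%VS by rewrite eqEdim addvSl e /=.
  by rewrite (subvP (addvSr _ _)) ?memv_line.
have J'0 : J' != 0%VS by rewrite -dimv_eq0 -lt0n; apply: leq_ltn_trans dJ'.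
have := form_growth J'0; rewrite ltnNge => /negP[].
apply: leq_trans dJ'; rewrite -h //; apply: dimvS; rewrite !limgD.
have := form_stable_img k sJ; rewrite !subv_add => /andP[-> ->] /=.
by rewrite !limg_line -!memvE Ur Vr.
Qed.
End Binary.

(** * Modules over K[U,V] generated in degree 0 *)

Section Ray.
Variable K : fieldType.
Variable V : nat -> vectType K.
Variables u v : forall k, 'Hom(V k, V k.+1).
Hypothesis uvC : forall k x, u k.+1 (v k x) = v k.+1 (u k x).
Notation form k := 'rV[K]_k.+1.

Fixpoint vpow k (g : V 0%N) : V k :=
  if k is j.+1 then v j (vpow j g) else g.

(** The value on [g] of the form [\sum r_i U^(k-i) V^i], where U and V act by
    [u] and [v]. *)
Fixpoint act k (r : {poly K}) (g : V 0%N) : V k :=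
  if k is j.+1 then u j (act j r g) + r`_j.+1 *: vpow j.+1 g else r`_0 *: g.

Lemma act_linear k g : linear (fun r => act k r g).
Proof.
elim: k => [|k IH] a r s /=; first by rewrite coefD coefZ scalerDl scalerA.
rewrite IH linearP coefD coefZ /= scalerDl scalerDr scalerA.
by rewrite addrACA.
Qed.

Lemma act_u k (r : {poly K}) g : (size r <= k.+1)%N -> act k.+1 r g = u k (act k r g).
Proof. by move=> /= sr; rewrite nth_default // scale0r addr0. Qed.

Lemma act_v k r g : act k.+1 ('X * r) g = v k (act k r g).
Proof.
elim: k => [|k IH]; first by rewrite /= !coefXM /= scale0r linear0 add0r linearZ.
rewrite [LHS]/= -/(act k.+1 _ g) IH uvC coefXM /= linearD linearZ /=.
by [].
Qed.

Definition act_form k g (r : form k) : V k := act k (rVpoly r) g.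
Fact act_form_linear k g : linear (@act_form k g).
Proof. by move=> a r s; rewrite /act_form linearP act_linear. Qed.
HB.instance Definition _ k g :=
  GRing.isLinear.Build K _ _ _ (@act_form k g) (@act_form_linear k g).
Definition orb k g : 'Hom(form k, V k) := linfun (@act_form k g).

Lemma orbE k g r : orb k g r = act k (rVpoly r) g.
Proof. by rewrite lfunE. Qed.

Lemma orb_u k g r : orb k.+1 g (formU K k r) = u k (orb k g r).
Proof. by rewrite !orbE formUE act_u // size_poly. Qed.

Lemma orb_v k g r : orb k.+1 g (formV K k r) = v k (orb k g r).
Proof. by rewrite !orbE formVE act_v. Qed.

Lemma form_decomp k (r : form k.+1) :
  exists a b : form k, r = formU K k a + formV K k b.
Proof.
exists (poly_rV ((rVpoly r)`_0)%:P), (poly_rV (\poly_(i < k.+1) (rVpoly r)`_i.+1)).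
apply: (@rVpoly_inj K k.+2); rewrite linearD /= formUE formVE.
rewrite !poly_rV_K ?size_poly //; last exact: leq_trans (size_polyC_leq1 _) _.
apply/polyP => -[|i]; rewrite coefD coefXM coefC /= ?addr0 // add0r [RHS]coef_poly.
case: ltnP => // ki; apply: nth_default; apply: leq_trans (size_poly _ _) _.
by rewrite ltnS.
Qed.

Lemma limg_orb k g : limg (orb k.+1 g) = (u k @: limg (orb k g) + v k @: limg (orb k g))%VS.
Proof.
apply/eqP; rewrite eqEsubv subv_add; apply/and3P; split.
- apply/subvP => _ /memv_imgP[r _ ->]; have [a [b ->]] := form_decomp r.
  by rewrite linearD /= orb_u orb_v memv_add // memv_img // memv_img ?memvf.
- by apply/subvP => _ /memv_imgP[_ /memv_imgP[r _ ->] ->]; rewrite -orb_u memv_img ?memvf.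
- by apply/subvP => _ /memv_imgP[_ /memv_imgP[r _ ->] ->]; rewrite -orb_v memv_img ?memvf.
Qed.

(** The degree [k] part of the K[U,V]-submodule generated by [W]. *)
Fixpoint gen (W : {vspace V 0%N}) k : {vspace V k} :=
  if k is j.+1 then (u j @: gen W j + v j @: gen W j)%VS else W.

Lemma gen_cons g X k : gen <<g :: X>> k = (limg (orb k g) + gen <<X>> k)%VS.
Proof.
elim: k => [|k IH /=].
  rewrite span_cons; congr (_ + _)%VS; apply/eqP; rewrite eqEsubv.
  apply/andP; split.
    rewrite -memvE; apply/memv_imgP; exists (poly_rV 1); rewrite ?memvf //.
    by rewrite orbE /= poly_rV_K ?size_poly1 // coef1 scale1r.
  apply/subvP => _ /memv_imgP[r _ ->]; rewrite orbE /=.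
  by rewrite memvZ ?memv_line.
rewrite IH limg_orb !limgD -!addvA; congr (_ + _)%VS.
by rewrite addvA [RHS]addvA [X in (X + _)%VS = _]addvC.
Qed.

Definition stable (W : forall k, {vspace V k}) :=
  forall k x, x \in W k -> u k x \in W k.+1 /\ v k x \in W k.+1.

Lemma gen_stable W : stable (gen W).
Proof.
move=> k x Wx; split.
  exact: subvP (addvSl _ _) _ (memv_img _ Wx).
exact: subvP (addvSr _ _) _ (memv_img _ Wx).
Qed.

Lemma orb_stable W (g : V 0%N) : stable W ->
  form_stable (fun k => (orb k g @^-1: W k)%VS).
Proof.
by move=> sW k r; rewrite -!memv_preim orb_u orb_v; apply: sW.
Qed.

(** Induction on the number of generators: modulo the others, the last one
    contributes the forms modulo an ideal, to which [form_stable_soc] applies. *)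
Lemma gen_soc X : exists k1, forall k, (k1 <= k)%N -> forall x, x \in gen <<X>> k ->
  u k x = 0 -> v k x = 0 -> x = 0.
Proof.
elim: X => [|g X [k1 IH]].
  exists 0%N => k _ x; suff -> : gen <<[::]>> k = 0%VS by rewrite memv0 => /eqP.
  elim: k {x} => [|k IH]; first exact: span_nil.
  by rewrite /= IH !limg0 addv0.
have [k2 soc] := form_stable_soc (orb_stable (g := g) (@gen_stable <<X>>%VS)).
exists (maxn k1 k2) => k; rewrite geq_max => /andP[k1k k2k] x.
rewrite gen_cons => /memv_addP[_ /memv_imgP[r _ ->] [y Xy ->]].
have [uy vy] := gen_stable Xy.
rewrite !linearD /= => /eqP; rewrite addr_eq0 => /eqP ru.
move=> /eqP; rewrite addr_eq0 => /eqP rv.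
apply: (IH k k1k); last 2 first.
- by rewrite linearD /= ru addNr.
- by rewrite linearD /= rv addNr.
rewrite memvD // memv_preim; apply: soc => //.
  by rewrite -memv_preim orb_u ru memvN.
by rewrite -memv_preim orb_v rv memvN.
Qed.

Lemma dim_preim (aT rT : vectType K) (f : 'Hom(aT, rT)) (A : {vspace rT}) :
  \dim (f @^-1: A) = (\dim (lker f) + \dim (A :&: limg f))%N.
Proof.
rewrite -(limg_ker_dim f (f @^-1: A)) -lpreim_cap_limg lpreimK ?capvSr //.
congr (\dim _ + _)%N; apply/capv_idPr; rewrite -lpreim0.
by apply: lpreimS; apply: sub0v.
Qed.

Lemma dim_preim_add (aT rT : vectType K) (f : 'Hom(aT, rT)) (G W : {vspace rT}) :
  (W <= limg f + G)%VS ->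
  (\dim W + \dim (f @^-1: G) = \dim (W :&: G) + \dim (f @^-1: (W + G)))%N.
Proof.
move=> WfG; rewrite !dim_preim; have := dimv_sum_cap W G.
pose B := ((W + G) :&: limg f)%VS; rewrite -/B.
have e : (W + G = B + G)%VS.
  apply/eqP; rewrite eqEsubv; apply/andP; split; last first.
    by rewrite subv_add capvSl addvSr.
  have /capv_idPl <- : (W + G <= limg f + G)%VS by rewrite subv_add WfG addvSr.
  by rewrite -vspace_modr ?addvSr // addvC.
have := dimv_sum_cap B G; rewrite -e.
have -> : (B :&: G = G :&: limg f)%VS.
  by rewrite /B -capvA [(limg f :&: G)%VS]capvC capvA; congr (_ :&: _)%VS; apply/capv_idPr; apply: addvSr.
lia.
Qed.

(** Here [r] is the rank of the submodule [W], and the point is that the upper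
    bound [C] does not depend on [W]. By induction on the number of generators,
    a new generator [g] adds to [W] an ideal of forms modulo the ideal of those
    that send [g] into the module [G] of the previous generators. If the latter
    ideal is nonzero, then it has bounded codimension, and so the contribution
    is bounded; if it is zero, the contribution is zero or has dimension [k] up
    to a constant, and at most [k + 1]. *)
Lemma stable_dim_bound X : exists C, forall W, stable W ->
  (forall k, (W k <= gen <<X>> k)%VS) ->
  exists r D, forall k, (r * k <= \dim (W k) + D)%N /\ (\dim (W k) <= C + r * k)%N.
Proof.
elim: X => [|g X [C IH]].
  exists 0%N => W _ W0; exists 0%N, 0%N => k; rewrite !mul0n; split=> //.
  suff e : gen <<[::]>> k = 0%VS by have := dimvS (W0 k); rewrite e dimv0.
  by elim: k => [|k IH]; [exact: span_nil|rewrite /= IH !limg0 addv0].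
pose G := gen <<X>>%VS; have sG : stable G := @gen_stable _.
have cap W : stable W -> stable (fun k => W k :&: G k)%VS.
  by move=> sW k x; rewrite !memv_cap => /andP[/sW[-> ->] /sG[-> ->]].
have add W : stable W -> stable (fun k => W k + G k)%VS.
  move=> sW k _ /memv_addP[x /sW[? ?] [y /sG[? ?] ->]].
  by rewrite !linearD /= !memv_add.
pose J k := (orb k g @^-1: G k)%VS.
have sJ : form_stable J := orb_stable (g := g) sG.
pose B W k := (orb k g @^-1: (W k + G k))%VS.
have sB W : stable W -> form_stable (B W).
  by move=> sW; apply: (orb_stable (g := g) (add W sW)).
have JB W k : (J k <= B W k)%VS by apply: lpreimS; apply: addvSr.
have dimW W : (forall k, (W k <= gen <<g :: X>> k)%VS) -> forall k,
    (\dim (W k) + \dim (J k) = \dim (W k :&: G k) + \dim (B W k))%N.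
  by move=> WX k; apply: dim_preim_add; rewrite -gen_cons.
have IHW W : stable W -> exists r D, forall k,
    (r * k <= \dim (W k :&: G k) + D)%N /\ (\dim (W k :&: G k) <= C + r * k)%N.
  by move=> sW; apply: (IH (fun k => W k :&: G k)%VS) (cap W sW) _ => k; apply: capvSr.
have [[k0 Jk0]|no] := EM (exists k0, J k0 != 0%VS).
  have geJ k : (k0 <= k)%N -> (k < \dim (J k) + k0)%N := form_stable_dim_ge sJ Jk0.
  exists (C + k0.+1)%N => W sW WX; have [r [D h]] := IHW W sW.
  exists r, D => k; have [h1 h2] := h k; have e1 := dimW W WX k.
  have e2 := dimvS (JB W k); have e3 : (\dim (B W k) <= k.+1)%N := dim_form_le _.
  have [k0k|kk0] := leqP k0 k; last by lia.
  by have e4 := geJ k k0k; lia.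
have J0 k : J k = 0%VS by apply/eqP; apply: contra_notT no => ?; exists k.
exists C.+1 => W sW WX; have [r [D h]] := IHW W sW.
have [[k0 Bk0]|noB] := EM (exists k0, B W k0 != 0%VS).
  exists r.+1, (D + k0)%N => k; have [h1 h2] := h k; have := dimW W WX k.
  rewrite J0 dimv0 addn0 => ->.
  have e3 : (\dim (B W k) <= k.+1)%N := dim_form_le _; split; last lia.
  have [k0k|kk0] := leqP k0 k; last lia.
  have e4 : (k < \dim (B W k) + k0)%N := form_stable_dim_ge (sB W sW) Bk0 k0k.
  lia.
have B0 k : B W k = 0%VS by apply/eqP; apply: contra_notT noB => ?; exists k.
by exists r, D => k; have [h1 h2] := h k; have := dimW W WX k; rewrite J0 B0; lia.
Qed.

Section Regular.
Hypothesis genV : forall k (x : V k.+1), exists y z : V k, x = u k y + v k z.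
Hypothesis socV : forall k (x : V k), u k x = 0 -> v k x = 0 -> x = 0.

Lemma gen_fullv k : gen fullv k = fullv.
Proof.
elim: k => // k IH; apply/eqP; rewrite eqEsubv subvf /= IH.
by apply/subvP => x _; have [y [z ->]] := genV x; rewrite memv_add // memv_img ?memvf.
Qed.

(** Two-term relations [u y + v z = 0] among elements of a subspace [G] are
    counted through [u G :&: v G], [G :&: ker u] and [G :&: ker v], which all
    receive an injective image of a part of the previous degree. *)
Lemma kos_dim W k (A := gen W k) (G := gen W k.+1) (uv := (u k.+1 \o v k)%VF) :
  [/\ \dim A = (\dim (uv @: A) + \dim (v k @: (A :&: lker uv)) +
                \dim (u k @: (A :&: lker (v k))))%N,
      (2 * \dim G = \dim (gen W k.+2) + \dim (u k.+1 @: G :&: v k.+1 @: G) +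
                \dim (G :&: lker (u k.+1)) + \dim (G :&: lker (v k.+1)))%N &
      [/\ (uv @: A <= u k.+1 @: G :&: v k.+1 @: G)%VS,
      (v k @: (A :&: lker uv) <= G :&: lker (u k.+1))%VS &
      (u k @: (A :&: lker (v k)) <= G :&: lker (v k.+1))%VS]].
Proof.
have uvE x : uv x = u k.+1 (v k x) by rewrite comp_lfunE.
have AG := @gen_stable W k; split; last split.
- have := limg_ker_dim uv A; have := limg_ker_dim (v k) (A :&: lker uv)%VS.
  have -> : (A :&: lker uv :&: lker (v k) = A :&: lker (v k))%VS.
    rewrite -capvA; congr (_ :&: _)%VS; apply/capv_idPr; apply/subvP => x.
    by rewrite !memv_ker uvE => /eqP->; rewrite linear0.
  suff -> : \dim (u k @: (A :&: lker (v k))) = \dim (A :&: lker (v k)) by lia.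
  apply: limg_dim_eq; apply/eqP; rewrite -subv0; apply/subvP => x.
  rewrite !memv_cap !memv_ker memv0 => /andP[/andP[_ /eqP vx] /eqP ux].
  by apply/eqP; apply: socV.
- have := dimv_sum_cap (u k.+1 @: G) (v k.+1 @: G).
  have := limg_ker_dim (u k.+1) G; have := limg_ker_dim (v k.+1) G.
  by rewrite -[gen W k.+2]/(u k.+1 @: G + v k.+1 @: G)%VS; lia.
- apply/subvP => _ /memv_imgP[x /AG[ux vx] ->]; rewrite memv_cap uvE memv_img //=.
  by rewrite uvC memv_img.
- apply/subvP => _ /memv_imgP[x + ->]; rewrite !memv_cap !memv_ker uvE.
  by move=> /andP[/AG[_ ->]].
- apply/subvP => _ /memv_imgP[x + ->]; rewrite !memv_cap !memv_ker -uvC.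
  by move=> /andP[/AG[-> _] /eqP->]; rewrite linear0 eqxx.
Qed.

Lemma gen_dim_concave W k :
  (\dim (gen W k.+2) + \dim (gen W k) <= 2 * \dim (gen W k.+1))%N.
Proof.
have [-> -> [/dimvS h1 /dimvS h2 /dimvS h3]] := kos_dim W k; lia.
Qed.

(** Hilbert functions of submodules generated in degree 0 are concave, hence
    linear as soon as their slope is the final one. By [stable_dim_bound] the
    slope cannot drop late, so linearity starts at a degree independent of the
    submodule. *)
Lemma gen_dim_linear : exists C, forall W, exists r, forall k, (C <= k)%N ->
  \dim (gen W k.+1) = (\dim (gen W k) + r)%N.
Proof.
have [C bnd] := stable_dim_bound (vbasis (fullv : {vspace V 0%N})).
exists C => W; have [r [D h]] : exists r D, forall k,
    (r * k <= \dim (gen W k) + D)%N /\ (\dim (gen W k) <= C + r * k)%N.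
  apply: bnd; first exact: gen_stable.
  move=> k; rewrite (span_basis (vbasisP _)).
  by have -> : gen fullv k = fullv := gen_fullv k; apply: subvf.
exists r.
have [w wE] : exists w : nat -> nat, forall k, \dim (gen W k) = w k.
  by exists (fun k => \dim (gen W k)).
have conc k : (w k.+2 + w k <= 2 * w k.+1)%N.
  by rewrite -!wE; apply: gen_dim_concave.
(* A slope below the final one persists by concavity, against the lower
   bound. *)
have ge_r k : (w k + r <= w k.+1)%N.
  rewrite leqNgt; apply/negP => lt.
  have low m : (w (k + m) + m <= w k + r * m)%N /\ (w (k + m).+1 < w (k + m) + r)%N.
    elim: m => [|m [IH1 IH2]]; first by rewrite !addn0 muln0 addn0.
    have -> : (k + m.+1 = (k + m).+1)%N by lia.
    rewrite mulnS; have := conc (k + m)%N; split; lia.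
  have [h1 _] := h (k + (w k + D).+1)%N; have [h2 _] := low (w k + D).+1.
  rewrite wE mulnDr in h1; lia.
(* By concavity a slope above r in degree k forces dimension at least (r +
   1)(k + 1) in degree k + 1, more than C + r (k + 1) when C <= k. *)
have le_r k : (C <= k)%N -> (w k.+1 <= w k + r)%N.
  move=> Ck; rewrite leqNgt; apply/negP => lt.
  have slope m : (m <= k)%N -> (w (k - m) + r < w (k - m).+1)%N.
    elim: m => [|m IH mk]; first by rewrite subn0.
    have := IH (ltnW mk); have := conc (k - m.+1)%N.
    have -> : (k - m.+1).+1 = (k - m)%N by lia.
    lia.
  have low m : (m <= k.+1)%N -> (r.+1 * m <= w m)%N.
    elim: m => [|m IH mk]; first by rewrite muln0.
    have := slope (k - m)%N (leq_subr _ _); rewrite subKn //.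
    have := IH (ltnW mk); rewrite mulnS; lia.
  have := low k.+1 (leqnn _); have [_] := h k.+1; rewrite wE mulSn; lia.
by move=> k Ck; rewrite !wE; apply/eqP; rewrite eqn_leq le_r ?ge_r.
Qed.

(** Where the Hilbert function of the whole module is linear, the dimension
    count of [kos_dim] leaves no room: its three inclusions are equalities, and
    they say that a relation [v y = u z] comes from an element of degree [k]. *)
Lemma kos_exact : exists C, forall k, (C <= k)%N -> forall y z : V k.+1,
  v k.+1 y = u k.+1 z -> exists2 x, u k x = y & v k x = z.
Proof.
have [C lin] := gen_dim_linear; exists C => k Ck y z e.
have [r h] := lin fullv; have [d1 d2 [s1 s2 s3]] := kos_dim fullv k.
have := h k Ck; have := h k.+1 (leqW Ck).
have := dimvS s1; have := dimvS s2; have := dimvS s3.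
move: d1 d2 s1 s2 s3; rewrite !gen_fullv !capfv => d1 d2 s1 s2 s3 l3 l2 l1 e2 e1.
have /eqP E1 : ((u k.+1 \o v k)%VF @: fullv ==
                u k.+1 @: fullv :&: v k.+1 @: fullv)%VS.
  by rewrite eqEdim s1 /=; lia.
have /eqP E2 : (v k @: lker (u k.+1 \o v k)%VF == lker (u k.+1))%VS.
  by rewrite eqEdim s2 /=; lia.
have /eqP E3 : (u k @: lker (v k) == lker (v k.+1))%VS.
  by rewrite eqEdim s3 /=; lia.
have kv (t : V k.+1) : v k.+1 t = 0 -> exists2 x, v k x = 0 & u k x = t.
  move=> t0; have : t \in lker (v k.+1) by rewrite memv_ker t0.
  by rewrite -E3 => /memv_imgP[x]; rewrite memv_ker => /eqP ? ->; exists x.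
have : v k.+1 y \in (u k.+1 @: fullv :&: v k.+1 @: fullv)%VS.
  by rewrite memv_cap {1}e !memv_img ?memvf.
rewrite -E1 => /memv_imgP[w _]; rewrite comp_lfunE => ew.
have [|w1 vw1 uw1] := kv (y - u k w); first by rewrite linearB /= ew uvC subrr.
have : z - v k w \in lker (u k.+1) by rewrite memv_ker linearB /= -e ew subrr.
rewrite -E2 => /memv_imgP[w2]; rewrite memv_ker comp_lfunE => /eqP vw2 ew2.
have [|w3 vw3 uw3] := kv (u k w2); first by rewrite -uvC.
exists (w + w1 + w2 - w3); rewrite !(linearB, linearD) /=.
  by rewrite uw1 uw3 addrK addrC subrK.
by rewrite vw1 vw3 -ew2 addr0 subr0 addrC subrK.
Qed.
End Regular.
End Ray.

(** * The group L(p) and its degree map *)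

Section DegreeGroup.
Variables (n : nat) (p : weights n).
Local Notation L := (Lp p).
Local Notation x_ := (xdeg p).
Local Notation c := (cdeg p).

Lemma pi_Lp_eq (v w : {ffun 'I_n.+1 -> int}) :
  (\pi_L v == \pi_L w) = (v - w \in Lp_rel p).
Proof. by rewrite Quotient.idealrBE. Qed.

Definition wprod : nat := \prod_(i < n.+1) p i.

Lemma wprod_gt0 : (0 < wprod)%N.
Proof. by rewrite prodn_gt0 // => i; apply: wt_gt0. Qed.

Lemma wt_dvd i : (p i %| wprod)%N.
Proof. by rewrite /wprod (bigD1 i) //= dvdn_mulr. Qed.

(** The slope: the homomorphism L -> Z sending [x_i] to [wprod / p_i]. *)
Definition vdeg (v : {ffun 'I_n.+1 -> int}) : int :=
  \sum_i v i *+ (wprod %/ p i).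

Lemma vdegB : {morph vdeg : v w / v - w}.
Proof.
by move=> v w; rewrite /vdeg -sumrB; apply: eq_bigr => i _; rewrite !ffunE mulrnBl.
Qed.

Lemma vdeg_rel v : v \in Lp_rel p -> vdeg v = 0.
Proof.
move=> /asboolP[d ->].
have vdeg0 : vdeg 0 = 0 by rewrite -{1}[0]subr0 vdegB subrr.
have vdegN w : vdeg (- w) = - vdeg w by rewrite -[- w]sub0r vdegB vdeg0 sub0r.
have vdegD : {morph vdeg : v w / v + w}.
  by move=> w w'; rewrite -{1}[w']opprK vdegB vdegN opprK.
have vdegMn w m : vdeg (w *+ m) = vdeg w *+ m.
  by elim: m => [|m IH]; rewrite ?mulr0n // !mulrS vdegD IH.
have vdegMz w (m : int) : vdeg (w *~ m) = vdeg w *~ m.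
  by case: m => m; rewrite ?NegzE ?mulrNz -!pmulrn ?vdegN vdegMn.
rewrite (big_morph _ vdegD vdeg0) big1 // => i _.
rewrite (big_morph _ vdegD vdeg0) big1 // => j _.
rewrite vdegMz vdegB !vdegMn.
have e k : vdeg (basis_vec k) *+ p k = wprod%:Z.
  rewrite /vdeg (bigD1 k) //= big1 ?addr0 => [|h hk]; last first.
    by rewrite ffunE (negPf hk) mulr0n mul0rn.
  by rewrite ffunE eqxx mulr1n -mulrnA divnK ?wt_dvd // natz.
by rewrite !e subrr mul0rz.
Qed.

Definition deg (a : L) : int := vdeg (repr a).

Lemma deg_pi v : deg (\pi_L v) = vdeg v.
Proof.
apply/eqP; rewrite -subr_eq0 -vdegB; apply/eqP/vdeg_rel.
by rewrite -pi_Lp_eq reprK.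
Qed.

Lemma degB : {morph deg : a b / a - b}.
Proof.
move=> a b; rewrite -[a]reprK -[b]reprK -raddfB /= !deg_pi.
exact: vdegB.
Qed.

Lemma deg0 : deg 0 = 0. Proof. by rewrite -{1}[0]subr0 degB subrr. Qed.
Lemma degN a : deg (- a) = - deg a.
Proof. by rewrite -[- a]sub0r degB deg0 sub0r. Qed.
Lemma degD : {morph deg : a b / a + b}.
Proof. by move=> a b; rewrite -{1}[b]opprK degB degN opprK. Qed.
Lemma degMn a m : deg (a *+ m) = deg a *+ m.
Proof. by elim: m => [|m IH]; rewrite ?mulr0n ?deg0 // !mulrS degD IH. Qed.
Lemma degMz a (m : int) : deg (a *~ m) = deg a *~ m.
Proof. by case: m => m; rewrite ?NegzE ?mulrNz -!pmulrn ?degN degMn. Qed.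

Lemma deg_x i : deg (x_ i) = (wprod %/ p i)%:Z.
Proof.
rewrite /xdeg deg_pi /vdeg (bigD1 i) //= big1 ?addr0 => [|h hk].
  by rewrite ffunE eqxx mulr1n natz.
by rewrite ffunE (negPf hk) mulr0n mul0rn.
Qed.

Lemma deg_x_gt0 i : (0 < deg (x_ i))%R.
Proof.
by rewrite deg_x ltz_nat divn_gt0 ?wt_gt0 // dvdn_leq ?wprod_gt0 ?wt_dvd.
Qed.

Lemma deg_c : deg c = wprod%:Z.
Proof. by rewrite /cdeg degMn deg_x -natz -mulrnA divnK ?wt_dvd // natz. Qed.

Lemma deg_c_gt0 : (0 < deg c)%R.
Proof. by rewrite deg_c ltz_nat wprod_gt0. Qed.

Lemma x_mulp i : x_ i *+ p i = c.
Proof.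
rewrite /cdeg /xdeg -!raddfMn; apply/eqP; rewrite pi_Lp_eq.
apply/asboolP; exists (fun h k => ((h == i) && (k == ord0))%:R).
rewrite (bigD1 i) //= [X in _ = _ + X]big1 ?addr0 => [|h hi]; last first.
  by rewrite big1 // => k _; rewrite (negPf hi) mulr0z.
rewrite (bigD1 ord0) //= [X in _ = _ + X]big1 ?addr0 => [|k k0]; last first.
  by rewrite (negPf k0) andbF mulr0z.
by rewrite !eqxx mulr1z.
Qed.

(** The coordinate of [a] at [x_i], which is defined modulo [p_i]. *)
Definition xres i (a : L) : int := ((repr a : {ffun 'I_n.+1 -> int}) i %% p i)%Z.

Lemma xres_pi i v : xres i (\pi_L v) = (v i %% p i)%Z.
Proof.
have : repr (\pi_L v) - v \in Lp_rel p by rewrite -pi_Lp_eq reprK.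
move=> /asboolP[d e]; rewrite /xres; apply/eqP; rewrite eqz_mod_dvd.
have := congr1 (fun w : {ffun _ -> int} => w i) e; rewrite !ffunE => ->.
rewrite sum_ffunE; apply: rpred_sum => h _; rewrite sum_ffunE.
apply: rpred_sum => k _; rewrite ffunMzE !ffunE !ffunMnE !ffunE.
rewrite -mulrzr; apply: dvdz_mulr; apply: rpredB.
  by case: eqP => [<-|_]; rewrite /= ?mulr1n ?mulr0n ?mul0rn ?natz ?dvdzz ?dvdz0.
by case: eqP => [<-|_]; rewrite /= ?mulr1n ?mulr0n ?mul0rn ?natz ?dvdzz ?dvdz0.
Qed.

(** With [m] reduced this is a normal form of the elements of L(p):
    [nform_exists] and [nform_uniq]. *)
Definition nform (m : 'I_n.+1 -> nat) (k : int) : L :=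
  \sum_i x_ i *+ m i + c *~ k.

Definition reduced (m : 'I_n.+1 -> nat) := forall i, (m i < p i)%N.

Lemma nform_pi m k :
  nform m k = \pi_L (\sum_i basis_vec i *+ m i + basis_vec ord0 *+ p ord0 *~ k).
Proof.
rewrite /nform raddfD /= raddfMz /= raddfMn; congr (_ + _).
by rewrite raddf_sum; apply: eq_bigr => i _; rewrite raddfMn.
Qed.

Lemma sum_basis (f : 'I_n.+1 -> int) i :
  (\sum_j basis_vec j *~ f j) i = f i.
Proof.
rewrite sum_ffunE (bigD1 i) //= big1 ?addr0 => [|h hi].
  by rewrite ffunMzE ffunE eqxx intz.
by rewrite ffunMzE ffunE eq_sym (negPf hi) mulr0n mul0rz.
Qed.

Lemma xres_nform m k i : reduced m -> xres i (nform m k) = (m i)%:Z.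
Proof.
move=> rm; rewrite nform_pi xres_pi ffunE.
have -> : (\sum_j basis_vec j *+ m j) i = (m i)%:Z.
  by have := sum_basis (fun j => (m j)%:Z) i; under eq_bigr do rewrite -pmulrn.
have /dvdzP[q ->] : (p i %| (basis_vec (@ord0 n) *+ p ord0 *~ k) i)%Z.
  rewrite ffunMzE ffunMnE ffunE -mulrzr; apply: dvdz_mulr.
  by case: eqP => [<-|_]; rewrite /= ?mulr1n ?mulr0n ?mul0rn ?natz ?dvdzz ?dvdz0.
by rewrite addrC modzMDl modz_small // ltz_nat rm.
Qed.

Lemma nform_uniq m k m' k' : reduced m -> reduced m' ->
  nform m k = nform m' k' -> m =1 m' /\ k = k'.
Proof.
move=> rm rm' e; have em i : m i = m' i.
  by have := congr1 (xres i) e; rewrite !xres_nform // => -[].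
split=> //; have /(congr1 deg) : c *~ k = c *~ k'.
  apply: (addrI (\sum_i x_ i *+ m i)); rewrite -/(nform m k) e /nform.
  by congr (_ + _); apply: eq_bigr => i _; rewrite em.
rewrite !degMz => /eqP; rewrite -subr_eq0 -mulrzBr mulrz_eq0 subr_eq0.
by case/orP => /eqP // e0; have := deg_c_gt0; rewrite e0 ltxx.
Qed.

Lemma nform_exists a : exists m k, reduced m /\ a = nform m k.
Proof.
pose w : {ffun 'I_n.+1 -> int} := repr a.
exists (fun i => `|(w i %% p i)%Z|%N), (\sum_i (w i %/ p i)%Z).
have pn0 i : (p i : int) != 0 by rewrite eqz_nat -lt0n wt_gt0.
split=> [i|]; first by rewrite -ltz_nat gez0_abs ?modz_ge0 // ltz_pmod // ltz_nat wt_gt0.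
rewrite /nform mulrz_sumr -big_split /= -[LHS]reprK -/w.
have -> : w = \sum_j basis_vec j *~ w j by apply/ffunP => i; rewrite sum_basis.
rewrite raddf_sum; apply: eq_bigr => i _; rewrite raddfMz -/(xdeg p i).
rewrite -(x_mulp i) pmulrn gez0_abs ?modz_ge0 // pmulrn -mulrzA -mulrzDr.
by rewrite sum_basis addrC mulrC -divz_eq.
Qed.

Lemma nformD_c m k j : nform m k + c *~ j = nform m (k + j).
Proof. by rewrite /nform mulrzDr addrA. Qed.

(** All normal forms [nform m 0] occur among these, and so every coset of [Z c]
    does. *)
Definition coset_reps : seq L :=
  [seq nform (fun i => f i) 0 | f : {ffun 'I_n.+1 -> 'I_wprod}].

Lemma coset_repsP a : exists2 r, r \in coset_reps & exists k : int, a = r + c *~ k.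
Proof.
have [m [k [rm ->]]] := nform_exists a.
have ltm i : (m i < wprod)%N.
  by apply: leq_trans (rm i) _; rewrite dvdn_leq ?wprod_gt0 ?wt_dvd.
pose f := [ffun i => Ordinal (ltm i)].
exists (nform (fun i => f i) 0).
  by apply: map_f; rewrite mem_enum.
exists k; rewrite nformD_c add0r /nform; congr (_ + _).
by apply: eq_bigr => i _; rewrite ffunE.
Qed.
End DegreeGroup.

(** * The graded ring S *)

Section RingS.
Variables (K : closedFieldType) (n : nat) (p : weights n).
Variable l : 'I_n.+1 -> K * K.
Local Notation L := (Lp p).
Local Notation S := (ringS p l).
Local Notation poly := {mpoly K[2 + n.+1]}.
Local Notation x_ := (xdeg p).
Local Notation c := (cdeg p).
Local Notation cst := (cstS p l).

Lemma pi_S_eq (f g : poly) : (\pi_S f == \pi_S g) = (f - g \in idealS p l).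
Proof. by rewrite Quotient.idealrBE. Qed.

Definition varS i : S := \pi_S 'X_i.
Definition uS : S := \pi_S (varU K n).
Definition vS : S := \pi_S (varV K n).
Definition xS (i : 'I_n.+1) : S := \pi_S (varX K i).
Definition monS (m : 'X_{1.. 2 + n.+1}) : S := \pi_S 'X_[m].

Lemma cst0 : cst 0 = 0. Proof. by rewrite /cstS mpolyC0 raddf0. Qed.
Lemma cstN a : cst (- a) = - cst a. Proof. by rewrite /cstS mpolyCN raddfN. Qed.
Lemma cstV a : a != 0 -> cst a^-1 * cst a = 1.
Proof. by move=> a0; rewrite -cstSM mulVf ?cstS1. Qed.

Lemma pi_cstZ a (f : poly) : \pi_S (a *: f) = cst a * \pi_S f.
Proof. by rewrite -mul_mpolyC rmorphM. Qed.

Lemma monS_expand (f : poly) :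
  \pi_S f = \sum_(m <- msupp f) cst (f@_m) * monS m.
Proof.
rewrite {1}[f]mpolyE raddf_sum; apply: eq_bigr => m _.
by rewrite /= pi_cstZ.
Qed.

Lemma S_ind (P : S -> Prop) : (forall s t, P s -> P t -> P (s + t)) -> P 0 ->
  (forall a m, P (cst a * monS m)) -> forall s, P s.
Proof.
move=> PD P0 Pm s; rewrite -[s]reprK monS_expand.
by apply: (big_ind P) => // m _; apply: Pm.
Qed.

Lemma mdegL0 : mdegL p 0%MM = 0.
Proof. by rewrite /mdegL big1 // => i _; rewrite mnm0E. Qed.

Lemma mdegLD m1 m2 : mdegL p (m1 + m2)%MM = mdegL p m1 + mdegL p m2.
Proof. by rewrite /mdegL -big_split; apply: eq_bigr => i _; rewrite mnmDE mulrnDr. Qed.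

Lemma mdegL1 i : mdegL p U_(i)%MM = vardeg p i.
Proof.
rewrite /mdegL (bigD1 i) //= mnm1E eqxx mulr1n big1 ?addr0 // => j ji.
by rewrite mnm1E eq_sym (negPf ji).
Qed.

Lemma vardeg_u : vardeg p (lshift n.+1 (0 : 'I_2)) = c.
Proof. by rewrite /vardeg; case: splitP => //= j /eqP; rewrite -val_eqE. Qed.
Lemma vardeg_v : vardeg p (lshift n.+1 (1 : 'I_2)) = c.
Proof. by rewrite /vardeg; case: splitP => //= j /eqP; rewrite -val_eqE. Qed.
Lemma vardeg_x i : vardeg p (rshift 2 i) = x_ i.
Proof.
rewrite /vardeg; case: splitP => [j /= e|k /= [e]].
  by have := ltn_ord j; rewrite -e.
by congr (x_ _); apply: val_inj.
Qed.

Lemma vardeg_gt0 i : 0 < deg (vardeg p i).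
Proof. by rewrite /vardeg; case: split => j; [apply: deg_c_gt0|apply: deg_x_gt0]. Qed.

Definition homL (a : L) (f : poly) := forall m, m \in msupp f -> mdegL p m = a.

Lemma homLX m : homL (mdegL p m) 'X_[m].
Proof. by move=> k; rewrite msuppX inE => /eqP->. Qed.
Lemma homLD a f g : homL a f -> homL a g -> homL a (f + g).
Proof. by move=> hf hg m /msuppD_le; rewrite mem_cat => /orP[/hf|/hg]. Qed.
Lemma homLZ a k f : homL a f -> homL a (k *: f).
Proof. by move=> hf m /msuppZ_le/hf. Qed.
Lemma homLM a b f g : homL a f -> homL b g -> homL (a + b) (f * g).
Proof.
by move=> hf hg m /msuppM_le/allpairsP[[m1 m2] /= [/hf <- /hg <- ->]]; rewrite mdegLD.
Qed.

Lemma homL_rel i : homL c (relS p l i).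
Proof.
rewrite /relS; apply: homLD; last rewrite -scaleN1r; last apply: homLZ.
  rewrite /varX mpolyXn => m; rewrite msuppX inE => /eqP->.
  rewrite -(x_mulp p i); elim: (p i) => [|k IH]; first by rewrite mdegL0.
  by rewrite mulmS mdegLD mdegL1 vardeg_x IH mulrS.
by apply: homLD; apply: homLZ => m; rewrite msuppX inE => /eqP->;
  rewrite mdegL1 ?vardeg_u ?vardeg_v.
Qed.

(** The part of [f] of degree [a]. It preserves the ideal of relations, which
    are homogeneous, and so the components of S are independent
    ([compS_direct]). *)
Definition gpr (a : L) (f : poly) : poly :=
  \sum_(m <- msupp f | mdegL p m == a) f@_m *: 'X_[m].

Lemma gprE a f m : (gpr a f)@_m = if mdegL p m == a then f@_m else 0.
Proof.
rewrite /gpr raddf_sum /=.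
have [mf|mf] := boolP (m \in msupp f); last first.
  rewrite memN_msupp_eq0 // if_same big_seq_cond big1 // => k /andP[kf _].
  by rewrite mcoeffZ mcoeffX; case: eqP kf mf => [->->//|_]; rewrite mulr0.
rewrite big_mkcond (bigD1_seq m) ?msupp_uniq //= mcoeffZ mcoeffX eqxx mulr1.
rewrite [X in _ + X]big1 ?addr0 // => k km; case: ifP => // _.
by rewrite mcoeffZ mcoeffX (negPf km) mulr0.
Qed.

Lemma gpr_hom a b f : homL b f -> gpr a f = if b == a then f else 0.
Proof.
move=> hf; apply/mpolyP => m; rewrite gprE.
have [mf|mf] := boolP (m \in msupp f).
  by rewrite (hf _ mf); case: ifP; rewrite ?mcoeff0.
by rewrite (fun_if (mcoeff m)) memN_msupp_eq0 // mcoeff0 !if_same.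
Qed.

Lemma gprD a : {morph gpr a : f g / f + g}.
Proof.
by move=> f g; apply/mpolyP => m; rewrite !(gprE, mcoeffD); case: ifP; rewrite ?addr0.
Qed.
Lemma gpr0 a : gpr a 0 = 0.
Proof. by apply/mpolyP => m; rewrite !(gprE, mcoeff0) if_same. Qed.

Lemma gpr_ideal a f : f \in idealS p l -> gpr a f \in idealS p l.
Proof.
move=> /asboolP[g ->]; rewrite (big_morph _ (gprD a) (gpr0 a)).
apply: rpred_sum => i _; rewrite [g i]mpolyE mulr_suml.
rewrite (big_morph _ (gprD a) (gpr0 a)); apply: rpred_sum => m _.
have hm : homL (mdegL p m + c) ((g i)@_m *: 'X_[m] * relS p l i).
  by apply: homLM; [apply: homLZ; apply: homLX|apply: homL_rel].
rewrite (gpr_hom _ hm).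
case: ifP => _; rewrite ?rpred0 //; apply: idealMr.
apply/asboolP; exists (fun j => (j == i)%:R).
by rewrite (bigD1 i) //= eqxx mul1r big1 ?addr0 // => j /negPf->; rewrite mul0r.
Qed.

Lemma compS_direct (r : seq L) (f : L -> S) : uniq r ->
  (forall a, compS a (f a)) -> \sum_(a <- r) f a = 0 -> {in r, forall a, f a = 0}.
Proof.
move=> ur cf e b br; have [g hg] := choice cf.
have : \sum_(a <- r) g a \in idealS p l.
  rewrite -[X in X \in _]subr0 -pi_S_eq raddf0 raddf_sum; apply/eqP.
  by rewrite -[RHS]e; apply: eq_bigr => a _; case: (hg a).
move=> /(gpr_ideal b); rewrite (big_morph _ (gprD b) (gpr0 b)).
rewrite (bigD1_seq b) //= big1 ?addr0 => [|a ab]; last first.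
  by case: (hg a) => _ /gpr_hom->; rewrite (negPf ab).
case: (hg b) => -> /gpr_hom->; rewrite eqxx.
by rewrite -[X in X \in _]subr0 -pi_S_eq raddf0 => /eqP.
Qed.

Lemma compS0 a : compS a (0 : S).
Proof. by exists 0; rewrite raddf0; split=> // m; rewrite msupp0. Qed.
Lemma compSD a (s t : S) : compS a s -> compS a t -> compS a (s + t).
Proof.
move=> [f [-> hf]] [g [-> hg]]; exists (f + g); rewrite raddfD.
by split=> //; apply: homLD.
Qed.
Lemma compSM a b (s t : S) : compS a s -> compS b t -> compS (a + b) (s * t).
Proof.
move=> [f [-> hf]] [g [-> hg]]; exists (f * g); rewrite rmorphM.
by split=> //; apply: homLM.
Qed.
Lemma compSZ a k (s : S) : compS a s -> compS a (cst k * s).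
Proof. by rewrite -{2}[a]add0r; apply: compSM; apply: cstS_deg0. Qed.
Lemma compSB a (s t : S) : compS a s -> compS a t -> compS a (s - t).
Proof.
move=> hs ht; apply: compSD => //; have := compSZ (-1) ht.
by rewrite cstN cstS1 mulN1r.
Qed.
Lemma compS_mon m : compS (mdegL p m) (monS m).
Proof. by exists 'X_[m]; split=> //; apply: homLX. Qed.
Lemma compS1 : compS 0 (1 : S).
Proof. by rewrite -cstS1; apply: cstS_deg0. Qed.

Lemma compS_var i : compS (vardeg p i) (varS i).
Proof. by rewrite -mdegL1; apply: compS_mon. Qed.
Lemma compS_u : compS c uS. Proof. by rewrite -vardeg_u; apply: compS_var. Qed.
Lemma compS_v : compS c vS. Proof. by rewrite -vardeg_v; apply: compS_var. Qed.
Lemma compS_x i : compS (x_ i) (xS i).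
Proof. by rewrite -vardeg_x; apply: compS_var. Qed.

Lemma compSX a (s : S) k : compS a s -> compS (a *+ k) (s ^+ k).
Proof.
move=> hs; elim: k => [|k IH]; first by rewrite expr0; apply: compS1.
by rewrite exprS mulrS; apply: compSM.
Qed.

Lemma compS_prod (I : Type) (r : seq I) (a : I -> L) (s : I -> S) :
  (forall i, compS (a i) (s i)) -> compS (\sum_(i <- r) a i) (\prod_(i <- r) s i).
Proof.
move=> h; elim: r => [|i r IH]; first by rewrite !big_nil; apply: compS1.
by rewrite !big_cons; apply: compSM.
Qed.

Definition linS (z : K * K) : S := cst z.1 * uS + cst z.2 * vS.

Lemma linSE z : linS z = cst z.1 * uS + cst z.2 * vS.
Proof. by []. Qed.

Lemma compS_lin z : compS c (linS z).
Proof. by apply: compSD; apply: compSZ; [apply: compS_u|apply: compS_v]. Qed.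

Lemma xS_exp i : xS i ^+ p i = linS (l i).
Proof.
rewrite /xS /linS -rmorphXn -!pi_cstZ -raddfD; apply/eqP; rewrite pi_S_eq.
apply/asboolP; exists (fun j => (j == i)%:R).
by rewrite (bigD1 i) //= eqxx mul1r big1 ?addr0 // => j /negPf->; rewrite mul0r.
Qed.

(** The value at (U, V) of the binary form of degree [k] dehomogenized to [r]. *)
Definition formS k (r : {poly K}) : S :=
  \sum_(i < k.+1) cst r`_i * (uS ^+ (k - i) * vS ^+ i).

Lemma formS_linear k a r s : formS k (a *: r + s) = cst a * formS k r + formS k s.
Proof.
rewrite /formS mulr_sumr -big_split; apply: eq_bigr => i _ /=.
by rewrite coefD coefZ cstSD cstSM mulrDl -mulrA.
Qed.

Lemma formS0 k : formS k 0 = 0.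
Proof. by rewrite /formS big1 // => i _; rewrite coef0 cst0 mul0r. Qed.
Lemma formSD k : {morph formS k : r s / r + s}.
Proof. by move=> r s; have := formS_linear k 1 r s; rewrite cstS1 mul1r scale1r. Qed.
Lemma formSZ k a r : formS k (a *: r) = cst a * formS k r.
Proof. by rewrite -[_ *: _]addr0 formS_linear formS0 addr0. Qed.

Lemma formSX k i : (i <= k)%N -> formS k 'X^i = uS ^+ (k - i) * vS ^+ i.
Proof.
rewrite -ltnS => ik; rewrite /formS (bigD1 (Ordinal ik)) //= coefXn eqxx cstS1 mul1r.
rewrite big1 ?addr0 // => j ji; rewrite coefXn.
by rewrite -[(j : nat) == i]/(j == Ordinal ik :> nat) val_eqE (negPf ji) cst0 mul0r.
Qed.

Lemma formSM j k (r s : {poly K}) : (size r <= j.+1)%N -> (size s <= k.+1)%N ->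
  formS j r * formS k s = formS (j + k) (r * s).
Proof.
move=> sr ss.
have eR d (q : {poly K}) : (size q <= d.+1)%N -> q = \sum_(i < d.+1) q`_i *: 'X^i.
  move=> sq; rewrite -{1}[q]coefK poly_def.
  rewrite (big_ord_widen d.+1 (fun i => q`_i *: 'X^i) sq) big_mkcond.
  apply: eq_bigr => i _; case: ltnP => // h.
  by rewrite nth_default // scale0r.
rewrite [in RHS](eR j r sr) [in RHS](eR k s ss) [in RHS]mulr_suml (big_morph _ (formSD _) (formS0 _)).
rewrite {1}/formS mulr_suml; apply: eq_bigr => i _.
rewrite [in RHS]mulr_sumr (big_morph _ (formSD _) (formS0 _)) mulr_sumr.
apply: eq_bigr => h _; rewrite -scalerAl -scalerAr !formSZ -exprD formSX; last first.
  by apply: leq_add; rewrite -ltnS.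
have -> : (j + k - (i + h) = (j - i) + (k - h))%N.
  by have := ltn_ord i; have := ltn_ord h; rewrite !ltnS; lia.
by rewrite !exprD; ring.
Qed.

Lemma formS_lin z : linS z = formS 1 (z.1%:P + z.2 *: 'X).
Proof.
rewrite /formS !big_ord_recl big_ord0 /= !coefD !coefC !coefZ !coefX /=.
by rewrite mulr0 !addr0 add0r mulr1 [bump 0 0]/= subn0 subnn !expr0 !expr1 mulr1 mul1r.
Qed.

Lemma size_lin (z : K * K) : (size (z.1%:P + z.2 *: 'X)%R <= 2)%N.
Proof.
apply: leq_trans (size_polyD _ _) _; rewrite geq_max.
rewrite (leq_trans (size_polyC_leq1 _)) //=.
by rewrite (leq_trans (size_scale_leq _ _)) // size_polyX.
Qed.

Lemma lin_neq0 (z : K * K) : z != (0, 0) -> z.1%:P + z.2 *: 'X != 0.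
Proof.
move=> z0; apply: contraNneq z0 => e.
have e0 : (z.1%:P + z.2 *: 'X)`_0 = 0 by rewrite e coef0.
have e1 : (z.1%:P + z.2 *: 'X)`_1 = 0 by rewrite e coef0.
move: e0 e1; rewrite !coefD !coefC !coefZ !coefX /= mulr0 mulr1 addr0 add0r.
by case: z {e} => a b /= -> ->.
Qed.

Definition is_form k (s : S) := exists2 r : {poly K}, (size r <= k.+1)%N & s = formS k r.

Lemma is_formM j k s t : is_form j s -> is_form k t -> is_form (j + k) (s * t).
Proof.
move=> [r sr ->] [q sq ->]; exists (r * q); last by rewrite formSM.
by apply: leq_trans (size_polyMleq _ _) _; lia.
Qed.

Lemma is_formD k s t : is_form k s -> is_form k t -> is_form k (s + t).
Proof.
move=> [r sr ->] [q sq ->]; exists (r + q); last by rewrite formSD.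
by rewrite (leq_trans (size_polyD _ _)) // geq_max sr.
Qed.

Lemma is_formZ k a s : is_form k s -> is_form k (cst a * s).
Proof.
move=> [r sr ->]; exists (a *: r); last by rewrite formSZ.
exact: leq_trans (size_scale_leq _ _) sr.
Qed.

Lemma is_form1 : is_form 0 1.
Proof.
exists 1; rewrite ?size_poly1 // /formS big_ord_recl big_ord0 addr0 coef1 /=.
by rewrite cstS1 !expr0 !mul1r.
Qed.

Lemma is_form_lin z : is_form 1 (linS z).
Proof. by exists (z.1%:P + z.2 *: 'X); [apply: size_lin|apply: formS_lin]. Qed.

Lemma linS10 : linS (1, 0) = uS.
Proof. by rewrite /linS /= cstS1 cst0 mul1r mul0r addr0. Qed.
Lemma linS01 : linS (0, 1) = vS.
Proof. by rewrite /linS /= cstS1 cst0 mul1r mul0r add0r. Qed.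

Lemma is_formX j s k : is_form j s -> is_form (j * k) (s ^+ k).
Proof.
move=> fs; elim: k => [|k IH]; first by rewrite muln0 expr0; apply: is_form1.
by rewrite mulnS exprS; apply: is_formM.
Qed.

Lemma is_form_prod (I : Type) (r : seq I) (j : I -> nat) (s : I -> S) :
  (forall i, is_form (j i) (s i)) -> is_form (\sum_(i <- r) j i) (\prod_(i <- r) s i).
Proof.
move=> h; elim: r => [|i r IH]; first by rewrite !big_nil; apply: is_form1.
by rewrite !big_cons; apply: is_formM.
Qed.

Definition xmon (q : 'I_n.+1 -> nat) : S := \prod_i xS i ^+ q i.

Lemma xmonE q : xmon q = \prod_i xS i ^+ q i.
Proof. by []. Qed.

Lemma compS_xmon q : compS (\sum_i x_ i *+ q i) (xmon q).
Proof. by apply: compS_prod => i; apply: compSX; apply: compS_x. Qed.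

Lemma monS_prod m : monS m =
  uS ^+ m (lshift n.+1 (0 : 'I_2)) * vS ^+ m (lshift n.+1 (1 : 'I_2)) *
  xmon (fun i => m (rshift 2 i)).
Proof.
rewrite /monS mpolyXE_id rmorph_prod big_split_ord /= (big_ord_recl 1) (big_ord_recl 0) big_ord0.
rewrite mulr1 !rmorphXn /xmon; congr (_ * _ * _).
  by congr (\pi_S 'X_(_) ^+ m _); apply: val_inj.
by apply: eq_bigr => i _; rewrite rmorphXn.
Qed.

(** Reducing the exponent of each [X_i] modulo [p_i] turns a monomial into a
    binary form in U and V times a reduced monomial. *)
Lemma monS_nform m : exists k q e,
  [/\ reduced p q, is_form k e, monS m = e * xmon q & mdegL p m = nform p q k%:Z].
Proof.
pose m0 := m (lshift n.+1 (0 : 'I_2)); pose m1 := m (lshift n.+1 (1 : 'I_2)).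
pose d i := (m (rshift 2 i) %/ p i)%N; pose q i := (m (rshift 2 i) %% p i)%N.
have mE i : m (rshift 2 i) = (d i * p i + q i)%N by apply: divn_eq.
exists (m0 + m1 + \sum_i d i)%N, q, (uS ^+ m0 * vS ^+ m1 * \prod_i linS (l i) ^+ d i).
split.
- by move=> i; rewrite ltn_mod wt_gt0.
- apply: is_formM; first apply: is_formM.
  + by have := is_formX m0 (is_form_lin (1, 0)); rewrite mul1n linS10.
  + by have := is_formX m1 (is_form_lin (0, 1)); rewrite mul1n linS01.
  + apply: is_form_prod => i.
    by have := is_formX (d i) (is_form_lin (l i)); rewrite mul1n.
- rewrite monS_prod -/m0 -/m1 -!mulrA; congr (_ * (_ * _)).
  rewrite /xmon -big_split; apply: eq_bigr => i _ /=.
  by rewrite mE exprD mulnC exprM xS_exp.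
rewrite /mdegL big_split_ord /= (big_ord_recl 1) (big_ord_recl 0) big_ord0 /nform addr0.
have -> : lift ord0 (ord0 : 'I_1) = (1 : 'I_2) by apply: val_inj.
rewrite vardeg_u vardeg_v -/m0 -/m1 addrC -pmulrn !mulrnDr -addrA addrCA.
under eq_bigr do rewrite vardeg_x mE mulrnDr mulnC mulrnA x_mulp.
rewrite big_split /= sumrMnr [_ + \sum_(i < n.+1) x_ i *+ q i]addrC -!addrA addrCA.
by congr (_ + (_ + _)); apply: addrC.
Qed.

Lemma compS_nform q k s : reduced p q -> compS (nform p q k) s ->
  if k is Posz j then exists2 e, is_form j e & s = e * xmon q else s = 0.
Proof.
move=> rq [f [-> hf]]; rewrite monS_expand big_seq.
pose P (s : S) := if k is Posz j then exists2 e, is_form j e & s = e * xmon q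
                  else s = 0.
apply: (big_ind P); rewrite {}/P.
- case: k hf => // j _; exists 0; last by rewrite mul0r.
  by exists 0; rewrite ?size_poly0 ?formS0.
- case: k hf => // [j _ s1 s2 [e fe ->] [e' fe' ->]|j _ s1 s2 -> ->]; last exact: addr0.
  by exists (e + e'); [apply: is_formD|rewrite mulrDl].
move=> m /hf; have [j [q' [e [rq' fe -> ->]]]] := monS_nform m.
move=> /nform_uniq[] // qq <-; exists (cst f@_m * e); first exact: is_formZ.
by rewrite mulrA; congr (_ * _); apply: eq_bigr => i _; rewrite qq.
Qed.

(** The K-points of the spectrum of S. *)
Definition on_surface u t (y : 'I_n.+1 -> K) :=
  forall i, y i ^+ p i = (l i).1 * u + (l i).2 * t.

Definition point (u t : K) (y : 'I_n.+1 -> K) (i : 'I_(2 + n.+1)) : K :=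
  match split i with inl j => if j == 0 then u else t | inr j => y j end.

Definition evS u t y (s : S) : K := meval (point u t y) (repr s).

Lemma point_u u t y : point u t y (lshift n.+1 (0 : 'I_2)) = u.
Proof. by rewrite /point; case: splitP => //= j /eqP; rewrite eq_sym -[_ == _]/(j == 0) => ->. Qed.
Lemma point_v u t y : point u t y (lshift n.+1 (1 : 'I_2)) = t.
Proof.
rewrite /point; case: splitP => //= j /eqP e; have -> //: (j == 0) = false.
by apply/eqP => j0; rewrite j0 in e.
Qed.
Lemma point_x u t y i : point u t y (rshift 2 i) = y i.
Proof.
rewrite /point; case: splitP => [j /= e|k /= [e]].
  by have := ltn_ord j; rewrite -e.
by congr (y _); apply: val_inj.
Qed.

Lemma on_surface_exists u t : exists y, on_surface u t y.
Proof.
suff h i : exists yi, yi ^+ p i = (l i).1 * u + (l i).2 * t by have [y hy] := choice h; exists y.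
have /closed_rootP[yi] : size ('X^(p i) - ((l i).1 * u + (l i).2 * t)%:P) != 1%N.
  by rewrite size_XnsubC ?wt_gt0 // eqSS -lt0n wt_gt0.
by rewrite /root hornerD hornerN hornerC hornerXn subr_eq0 => /eqP h; exists yi.
Qed.

Section Eval.
Variables (u t : K) (y : 'I_n.+1 -> K).
Hypothesis ty : on_surface u t y.

Lemma evS_pi f : evS u t y (\pi_S f) = meval (point u t y) f.
Proof.
apply/eqP; rewrite -subr_eq0 -mevalB; apply/eqP.
have : repr (\pi_S f) - f \in idealS p l by rewrite -pi_S_eq reprK.
move=> /asboolP[g ->]; rewrite raddf_sum big1 //= => i _.
rewrite mevalM mevalB mevalD !mevalZ rmorphXn /= !mevalXU.
by rewrite point_u point_v point_x ty subrr mulr0.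
Qed.

Lemma evSD : {morph evS u t y : s r / s + r}.
Proof. by move=> s r; rewrite -[s]reprK -[r]reprK -raddfD !evS_pi mevalD. Qed.
Lemma evSM : {morph evS u t y : s r / s * r}.
Proof. by move=> s r; rewrite -[s]reprK -[r]reprK -rmorphM !evS_pi mevalM. Qed.
Lemma evS_cst a : evS u t y (cst a) = a.
Proof. by rewrite evS_pi mevalC. Qed.
Lemma evS1 : evS u t y 1 = 1. Proof. by rewrite -cstS1 evS_cst. Qed.
Lemma evS0 : evS u t y 0 = 0. Proof. by rewrite -cst0 evS_cst. Qed.
Lemma evSX s k : evS u t y (s ^+ k) = evS u t y s ^+ k.
Proof. by elim: k => [|k IH]; rewrite ?expr0 ?evS1 // !exprS evSM IH. Qed.
Lemma evS_u : evS u t y uS = u. Proof. by rewrite evS_pi mevalXU point_u. Qed.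
Lemma evS_v : evS u t y vS = t. Proof. by rewrite evS_pi mevalXU point_v. Qed.
Lemma evS_x i : evS u t y (xS i) = y i. Proof. by rewrite evS_pi mevalXU point_x. Qed.

Lemma evS_lin z : evS u t y (linS z) = z.1 * u + z.2 * t.
Proof. by rewrite evSD !evSM !evS_cst evS_u evS_v. Qed.

Lemma evS_xmon q : evS u t y (xmon q) = \prod_i y i ^+ q i.
Proof.
rewrite /xmon (big_morph _ evSM evS1); apply: eq_bigr => i _.
by rewrite evSX evS_x.
Qed.
End Eval.

Lemma evS_form t y k (r : {poly K}) : on_surface 1 t y -> (size r <= k.+1)%N ->
  evS 1 t y (formS k r) = r.[t].
Proof.
move=> ty sr; rewrite (horner_coef_wide _ sr) /formS (big_morph _ (evSD ty) (evS0 ty)).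
apply: eq_bigr => i _.
by rewrite !evSM // evS_cst // !evSX // evS_u // evS_v // expr1n mul1r.
Qed.

(** Nonzero at the points with [t] outside a finite set: as K is infinite, such
    elements are closed under products. *)
Definition gen_neq0 (s : S) := exists2 g : {poly K}, g != 0 &
  forall t y, on_surface 1 t y -> g.[t] != 0 -> evS 1 t y s != 0.

Lemma gen_neq0_neq0 s : gen_neq0 s -> s != 0.
Proof.
move=> [g g0 h]; have [t gt] := closed_nonrootP _ g0.
have [y ty] := on_surface_exists 1 t; apply: contraNneq (h t y ty gt) => ->.
by rewrite evS0.
Qed.

Lemma gen_neq0M s t : gen_neq0 s -> gen_neq0 t -> gen_neq0 (s * t).
Proof.
move=> [g g0 hg] [h h0 hh]; exists (g * h); first by rewrite mulf_neq0.
move=> a y ay; rewrite hornerM mulf_eq0 negb_or => /andP[ga ha].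
by rewrite evSM // mulf_neq0 ?hg ?hh.
Qed.

Hypothesis l_neq0 : forall i, l i != (0, 0).

Lemma form_xmon_neq0 k (r : {poly K}) q : (size r <= k.+1)%N -> r != 0 ->
  gen_neq0 (formS k r * xmon q).
Proof.
move=> sr r0; exists (r * \prod_i ((l i).1%:P + (l i).2 *: 'X)).
  by rewrite mulf_neq0 //; apply/prodf_neq0 => i _; apply: lin_neq0.
move=> t y ty; rewrite hornerM mulf_eq0 negb_or => /andP[rt].
rewrite horner_prod => /prodf_neq0 lt; rewrite evSM // evS_form // evS_xmon //.
rewrite mulf_neq0 //; apply/prodf_neq0 => i _; rewrite expf_neq0 //.
have := lt i isT; rewrite !hornerE -[(l i).1]mulr1 -ty; apply: contraNneq => ->.
by rewrite expr0n gtn_eqF // wt_gt0.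
Qed.

Lemma form_xmon_inj k (r : {poly K}) q : (size r <= k.+1)%N ->
  formS k r * xmon q = 0 -> r = 0.
Proof.
move=> sr /eqP e; apply/eqP; apply: contraTT e => r0.
exact: gen_neq0_neq0 (form_xmon_neq0 q sr r0).
Qed.

Lemma compS_gen_neq0 a s : compS a s -> s != 0 -> gen_neq0 s.
Proof.
have [q [k [rq ->]]] := nform_exists a => /(compS_nform rq).
case: k => [k [e [r sr ->] ->]|k ->]; last by rewrite eqxx.
move=> h; apply: form_xmon_neq0 => //; apply: contraNneq h => ->.
by rewrite formS0 mul0r.
Qed.

(** Both factors are nonzero at all points of the surface above all but
    finitely many [t], and hence so is the product. *)
Lemma compS_domain a b (s t : S) : compS a s -> compS b t -> s * t = 0 -> s = 0 \/ t = 0.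
Proof.
move=> hs ht e; have [->|s0] := eqVneq s 0; first by left.
have [->|t0] := eqVneq t 0; [by right|].
have := gen_neq0_neq0 (gen_neq0M (compS_gen_neq0 hs s0) (compS_gen_neq0 ht t0)).
by rewrite e eqxx.
Qed.

Lemma formS_prod d rs : formS (d + size rs) (\prod_(z <- rs) ('X - z%:P)) =
  uS ^+ d * \prod_(z <- rs) linS (- z, 1).
Proof.
elim: rs => [|z rs IH].
  rewrite !big_nil addn0 mulr1.
  by have := formSX (leq0n d); rewrite expr0 subn0 expr0 mulr1.
rewrite !big_cons mulrCA -IH formS_lin /= formSM ?(size_lin (- z, 1)) //.
  by rewrite add1n addnS scale1r polyCN addrC.
by rewrite size_prod_XsubC ltnS leq_addl.
Qed.

Lemma form_factor k e : is_form k e -> e != 0 ->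
  exists a zs, [/\ a != 0, all (fun z => z != (0, 0)) zs
    & e = cst a * \prod_(z <- zs) linS z].
Proof.
move=> [r sr ->] e0; have r0 : r != 0.
  by apply: contraNneq e0 => ->; rewrite formS0.
have [rs er] := closed_field_poly_normal r.
have size_r : size r = (size rs).+1.
  by rewrite er size_scale ?lead_coef_eq0 // size_prod_XsubC.
have kE : k = (k - size rs + size rs)%N by rewrite subnK // -ltnS -size_r.
exists (lead_coef r), (nseq (k - size rs) (1, 0) ++ [seq (- z, 1) | z <- rs]).
split; first by rewrite lead_coef_eq0.
  rewrite all_cat all_nseq /= xpair_eqE oner_eq0 orbT /=.
  by apply/allP => _ /mapP[z _ ->]; rewrite xpair_eqE oner_eq0 andbF.
rewrite big_cat big_map {1}kE {1}er formSZ formS_prod; congr (_ * (_ * _)).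
by rewrite big_nseq linS10 iter_mulr_1.
Qed.

(** K being algebraically closed, a binary form is a product of linear forms,
    and each [X_i] divides the linear form [l_i]. *)
Lemma compS_dvd_lin a s : compS a s -> s != 0 ->
  exists t zs, all (fun z => z != (0, 0)) zs /\ t * s = \prod_(z <- zs) linS z.
Proof.
have [q [k [rq ->]]] := nform_exists a => /(compS_nform rq).
case: k => [k [e fe ->]|k ->]; last by rewrite eqxx.
move=> s0; have e0 : e != 0 by apply: contraNneq s0 => ->; rewrite mul0r.
have [b [zs [b0 zs0 ->]]] := form_factor fe e0.
exists (cst b^-1 * xmon (fun i => p i - q i)%N), (zs ++ [seq l i | i <- index_enum _]).
split; first by rewrite all_cat zs0; apply/allP => _ /mapP[i _ ->].
rewrite big_cat big_map /= mulrACA [cst _ * (cst b * _)]mulrA cstV // mul1r.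
congr (_ * _).
rewrite /xmon -big_split; apply: eq_bigr => i _ /=.
by rewrite -exprD subnK ?xS_exp // ltnW.
Qed.
End RingS.

Local Open Scope classical_set_scope.

(** * Homogeneous components of graded modules *)

Lemma linfun_lin (K : fieldType) (aT rT : vectType K) (f : aT -> rT) :
  linear f -> linfun f =1 f.
Proof.
move=> lf; pose g : {linear aT -> rT} := HB.pack f (GRing.isLinear.Build _ _ _ _ f lf).
exact: (lfunE g).
Qed.

(** A subset defined by an arbitrary proposition becomes a subspace by adding
    vectors to 0 as long as possible. *)
Lemma subspace_ex (K : fieldType) (vT : vectType K) (P : vT -> Prop) :
  P 0 -> (forall a x y, P x -> P y -> P (a *: x + y)) ->
  exists U : {vspace vT}, forall v, v \in U <-> P v.
Proof.
move=> P0 PL.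
suff h k (U : {vspace vT}) : (\dim {: vT} - \dim U <= k)%N ->
    (forall v, v \in U -> P v) -> exists U : {vspace vT}, forall v, v \in U <-> P v.
  by apply: (h _ 0%VS (leqnn _)) => v; rewrite memv0 => /eqP->.
elim: k U => [|k IH] U dU UP; have [[v Pv vU]|no] := EM (exists2 v, P v & v \notin U).
- case/negP: vU; suff /eqP -> : U == fullv by rewrite memvf.
  by rewrite eqEdim subvf -subn_eq0 -leqn0.
- exists U => v; split; first exact: UP.
  by move=> Pv; apply/negPn/negP => vU; apply: no; exists v.
- have dU' : (\dim U < \dim (U + <[v]>))%N.
    rewrite ltn_neqAle dimvS ?addvSl // andbT; apply: contra vU => /eqP e.
    have /eqP -> : (U == U + <[v]>)%VS by rewrite eqEdim addvSl e /=.
    by rewrite (subvP (addvSr _ _)) ?memv_line.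
  apply: (IH (U + <[v]>)%VS); first by have := dimvS (subvf (U + <[v]>)); lia.
  by move=> _ /memv_addP[x /UP Px [_ /vlineP[a ->] ->]]; rewrite addrC; apply: PL.
- exists U => v; split; first exact: UP.
  by move=> Pv; apply/negPn/negP => vU; apply: no; exists v.
Qed.

Section Components.
Variables (K : closedFieldType) (n : nat) (p : weights n).
Variable l : 'I_n.+1 -> K * K.
Local Notation L := (Lp p).
Local Notation S := (ringS p l).
Local Notation cst := (cstS p l).
Local Notation monS := (monS p l).
Implicit Types M N : grmod p l.

Lemma decomp_ex M (x : M) : exists f : L -> M, exists r : seq L,
  [/\ uniq r, forall a, gm_comp a (f a), forall a, a \notin r -> f a = 0
    & x = \sum_(a <- r) f a].
Proof. by have [r [f h]] := gm_pad x; exists f, r. Qed.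

(** The homogeneous component of degree [a]. *)
Definition pr M (a : L) (x : M) : M := projT1 (cid (decomp_ex x)) a.

Lemma pr_ex M (x : M) : exists r : seq L,
  [/\ uniq r, forall a, a \notin r -> pr a x = 0 & x = \sum_(a <- r) pr a x].
Proof.
have [r [ur cf f0 e]] := projT2 (cid (decomp_ex x)).
by exists r; split.
Qed.

Lemma pr_comp M a (x : M) : gm_comp a (pr a x).
Proof. by have [r [ur cf f0 e]] := projT2 (cid (decomp_ex x)); apply: cf. Qed.

Lemma pr_unique M (x : M) r f : uniq r -> (forall a, gm_comp a (f a)) ->
  (forall a, a \notin r -> f a = 0) -> x = \sum_(a <- r) f a ->
  forall a, pr a x = f a.
Proof.
move=> ur cf f0 e a; have [r' [ur' p0 e']] := pr_ex x.
pose r2 := undup (r ++ r'); have ur2 : uniq r2 := undup_uniq _.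
have s1 : {subset r <= r2} by move=> b br; rewrite mem_undup mem_cat br.
have s2 : {subset r' <= r2} by move=> b br; rewrite mem_undup mem_cat br orbT.
have [ar|ar] := boolP (a \in r2); last first.
  rewrite f0 ?p0 //; first by apply: contra ar => /s2.
  by apply: contra ar => /s1.
apply: (gm_eq0 ur2 (fun b => pr_comp b x) cf) => //.
by rewrite (sum_pad ur' ur2 s2 p0) (sum_pad ur ur2 s1 f0) -e' -e.
Qed.

Lemma pr_hom M a b (x : M) : gm_comp b x -> pr a x = if a == b then x else 0.
Proof.
move=> cx; apply: (@pr_unique M x [:: b] (fun a => if a == b then x else 0)) => //.
- by move=> d; case: eqP => [->//|_]; apply: gm_comp0.
- by move=> d; rewrite inE => /negPf->.
- by rewrite big_seq1 eqxx.
Qed.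

Lemma pr_id M a (x : M) : gm_comp a x -> pr a x = x.
Proof. by move/pr_hom->; rewrite eqxx. Qed.

Lemma prD M a : {morph pr (M := M) a : x y / x + y}.
Proof.
move=> x y; have [r [ur p0 e]] := pr_ex x; have [r' [ur' p0' e']] := pr_ex y.
pose r2 := undup (r ++ r'); have ur2 : uniq r2 := undup_uniq _.
have s1 : {subset r <= r2} by move=> b br; rewrite mem_undup mem_cat br.
have s2 : {subset r' <= r2} by move=> b br; rewrite mem_undup mem_cat br orbT.
apply: (@pr_unique M (x + y) r2 (fun a => pr a x + pr a y)) => //.
- by move=> b; apply: gm_compD; apply: pr_comp.
- move=> b; rewrite mem_undup mem_cat negb_or => /andP[/p0-> /p0'->].
  by rewrite addr0.
by rewrite big_split /= (sum_pad ur ur2 s1 p0) (sum_pad ur' ur2 s2 p0') -e -e'.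
Qed.

Lemma pr0 M a : pr a (0 : M) = 0.
Proof. by rewrite pr_id //; apply: gm_comp0. Qed.

Lemma pr_sum M a (I : Type) (r : seq I) (P : pred I) (F : I -> M) :
  pr a (\sum_(i <- r | P i) F i) = \sum_(i <- r | P i) pr a (F i).
Proof. exact: (big_morph _ (@prD M a) (pr0 M a)). Qed.

Lemma prZ M a b s (x : M) : compS b s -> pr a (s *: x) = s *: pr (a - b) x.
Proof.
move=> cs; have [r [ur p0 e]] := pr_ex x.
apply: (@pr_unique M (s *: x) [seq d + b | d <- r] (fun d => s *: pr (d - b) x)).
- by rewrite map_inj_uniq //; apply: addIr.
- by move=> d; have := gm_compZ cs (pr_comp (d - b) x); rewrite addrC subrK.
- move=> d dr; rewrite p0 ?scaler0 //; apply: contra dr => dr.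
  by apply/mapP; exists (d - b); rewrite ?subrK.
rewrite {1}e scaler_sumr big_map; apply: eq_bigr => d _.
by rewrite addrK.
Qed.

Lemma prN M a (x : M) : pr a (- x) = - pr a x.
Proof. by apply/eqP; rewrite -addr_eq0 -prD addNr pr0. Qed.

Lemma gsub_pr M (P : set M) a x : gsub P -> P x -> P (pr a x).
Proof.
move=> sP; have [r [ur p0 e]] := pr_ex x => Px.
have [ar|ar] := boolP (a \in r); last by rewrite p0 //; apply: gs0 sP.
by apply: (gsH sP ur (fun b => pr_comp b x)) ar; rewrite -e.
Qed.

Lemma gsub_sum M (P : set M) (I : Type) (r : seq I) (Q : pred I) (F : I -> M) :
  gsub P -> (forall i, Q i -> P (F i)) -> P (\sum_(i <- r | Q i) F i).
Proof.
move=> sP PF; apply: (big_ind (fun y => P y)) => //; first exact: gs0 sP.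
exact: gsD sP.
Qed.

Lemma gsub_prP M (P : set M) x : gsub P -> (forall a, P (pr a x)) -> P x.
Proof. by move=> sP h; have [r [ur p0 ->]] := pr_ex x; apply: gsub_sum. Qed.

Lemma gsub_sub M (P Q : set M) : gsub P -> gsub Q ->
  (forall a x, gm_comp a x -> P x -> Q x) -> P `<=` Q.
Proof.
move=> sP sQ h x Px; apply: gsub_prP => // a; apply: h (pr_comp a x) _.
exact: gsub_pr.
Qed.

(** Graded submodules are determined by their homogeneous parts. *)
Lemma gsub_family M (Q : L -> set M) : (forall a, Q a 0) ->
  (forall a x y, Q a x -> Q a y -> Q a (x + y)) ->
  (forall a b s x, compS b s -> gm_comp a x -> Q a x -> Q (a + b) (s *: x)) ->
  gsub [set x | forall a, Q a (pr a x)].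
Proof.
move=> Q0 QD QZ; split=> [a|s x y hx hy a|r f ur cf h a ar b].
- by rewrite pr0.
- rewrite prD; apply: (QD) => //; elim/S_ind: s a => [s t hs ht|| k m] a.
  + by rewrite scalerDl prD; apply: QD.
  + by rewrite scale0r pr0.
  have cs := compSZ k (compS_mon p l m); rewrite (prZ _ _ cs).
  rewrite -{1}(subrK (mdegL p m) a); apply: QZ => //; exact: pr_comp.
rewrite (pr_hom _ (cf a)); case: eqP => // ->.
by have := h a; rewrite pr_sum (bigD1_seq a) //= (pr_id (cf a)) big1 ?addr0 //
  => d da; rewrite (pr_hom _ (cf d)) eq_sym (negPf da).
Qed.

Lemma grel_pr M N (T : set (M * N)) a (x : M) (y : N) : grel T -> T (x, y) -> T (pr a x, pr a y).
Proof.
move=> sT; have [r [ur p0 e]] := pr_ex x; have [r' [ur' p0' e']] := pr_ex y.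
pose r2 := undup (r ++ r'); have ur2 : uniq r2 := undup_uniq _.
have s1 : {subset r <= r2} by move=> b br; rewrite mem_undup mem_cat br.
have s2 : {subset r' <= r2} by move=> b br; rewrite mem_undup mem_cat br orbT.
rewrite {1}e {1}e' -(sum_pad ur ur2 s1 p0) -(sum_pad ur' ur2 s2 p0') => Txy.
have [ar|] := boolP (a \in r2).
  by apply: (grH sT ur2 (fun b => pr_comp b x) (fun b => pr_comp b y)) ar.
rewrite mem_undup mem_cat negb_or => /andP[/p0-> /p0'->].
exact: gr0 sT.
Qed.

Lemma grel_family M N (Q : L -> set (M * N)) : (forall a, Q a (0, 0)) ->
  (forall a x y x' y', Q a (x, y) -> Q a (x', y') -> Q a (x + x', y + y')) ->
  (forall a b s x y, compS b s -> gm_comp a x -> gm_comp a y -> Q a (x, y) ->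
     Q (a + b) (s *: x, s *: y)) ->
  grel [set z : M * N | forall a, Q a (pr a z.1, pr a z.2)].
Proof.
move=> Q0 QD QZ; apply: grelP => /= [a|s x y x' y' h h' a|r f g ur cf cg h a ar b].
- by rewrite !pr0.
- rewrite !prD; apply: (QD) => //; elim/S_ind: s a => [s t hs ht|| k m] a.
  + by rewrite !scalerDl !prD; apply: QD.
  + by rewrite !scale0r !pr0.
  have cs := compSZ k (compS_mon p l m); rewrite !(prZ _ _ cs).
  rewrite -{1}(subrK (mdegL p m) a).
  by apply: QZ => //; exact: pr_comp.
rewrite (pr_hom _ (cf a)) (pr_hom _ (cg a)); case: eqP => // ->.
have := h a; rewrite !pr_sum (bigD1_seq a) //= (pr_id (cf a)) [in X in Q a (_, X)](bigD1_seq a) //= (pr_id (cg a)).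
rewrite !big1 ?addr0 // => d da; last by rewrite (pr_hom _ (cf d)) eq_sym (negPf da).
by rewrite (pr_hom _ (cg d)) eq_sym (negPf da).
Qed.

Lemma monS0 : monS 0%MM = 1 :> S.
Proof. by rewrite /monS mpolyX0 rmorph1. Qed.

(** Homogeneous generators: the homogeneous components of given generators. *)
Lemma hom_gens M : exists G : seq (L * M), (forall g, g \in G -> gm_comp g.1 g.2) /\
  forall P : set M, P 0 -> (forall x y, P x -> P y -> P (x + y)) ->
    (forall g m k, g \in G -> P ((cst k * monS m) *: g.2)) -> forall x, P x.
Proof.
have [N [g0 hg]] := gm_fingen M.
pose r i := projT1 (cid (pr_ex (g0 i))).
have rP i : g0 i = \sum_(a <- r i) pr a (g0 i).
  by rewrite /r; case: (cid _) => s [].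
exists [seq (a, pr a (g0 i)) | i <- enum 'I_N, a <- r i]; split.
  by move=> _ /allpairsPdep[i [a [_ _ ->]]] /=; apply: pr_comp.
move=> P P0 PD PG x; have [s ->] := hg x.
apply: (big_ind P) => // i _; rewrite rP scaler_sumr big_seq.
apply: (big_ind P) => // a ar; elim/S_ind: (s i) => [u v hu hv||k m].
- by rewrite scalerDl; apply: PD.
- by rewrite scale0r.
apply: (PG (a, pr a (g0 i))); apply/allpairsPdep.
by exists i, a; rewrite mem_enum.
Qed.

Definition hgens M : seq (L * M) := projT1 (cid (hom_gens M)).

Lemma hgens_comp M g : g \in hgens M -> gm_comp g.1 g.2.
Proof. by case: (projT2 (cid (hom_gens M))) => + _; apply. Qed.

Lemma hgens_span M b (P : set M) : P 0 -> (forall x y, P x -> P y -> P (x + y)) ->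
  (forall g m k, g \in hgens M -> mdegL p m + g.1 = b ->
     P ((cst k * monS m) *: g.2)) -> forall x, gm_comp b x -> P x.
Proof.
move=> P0 PD PG x /pr_id <-; case: (projT2 (cid (hom_gens M))) => cG hG.
apply: (hG (fun x => P (pr b x))) => [|y z|g m k gG]; first by rewrite pr0.
  by rewrite prD; apply: PD.
rewrite (@pr_hom M b (mdegL p m + g.1)).
  by case: eqP => // e; apply: PG.
by apply: gm_compZ; [apply: compSZ; apply: compS_mon|apply: cG].
Qed.

Lemma vardeg_ge1 i : 1 <= deg (vardeg p i).
Proof. by have := vardeg_gt0 p i; lia. Qed.

Lemma deg_mdegL (m : 'X_{1.. 2 + n.+1}) : (mdeg m)%:Z <= deg (mdegL p m).
Proof.
rewrite /mdegL (big_morph _ (@degD n p) (deg0 p)) mdegE.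
rewrite (big_morph Posz PoszD (erefl _)); apply: ler_sum => i _.
by have := vardeg_ge1 i; rewrite degMn -mulr_natr natz; nia.
Qed.

Lemma hgens_deg M : exists d : int, forall g, g \in hgens M -> `|deg g.1| <= d.
Proof.
exists (\sum_(g <- hgens M) `|deg g.1|) => g gG.
by rewrite (big_rem g) //= lerDl sumr_ge0.
Qed.

Lemma comp_low M : exists d : int, forall a x, deg a < d -> gm_comp a x -> x = 0 :> M.
Proof.
have [d hd] := hgens_deg M; exists (- d) => a x ad.
apply: (hgens_span (P := fun x => x = 0)) => // [y z -> ->|g m k gG e].
  exact: addr0.
by have := hd g gG; have := deg_mdegL m; move: ad; rewrite -e degD; lia.
Qed.

Lemma comp_findim M b : exists B : seq M, (forall y, y \in B -> gm_comp b y) /\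
  forall x, gm_comp b x -> exists v : 'rV[K]_(size B),
    x = \sum_i cst (v 0 i) *: B`_i.
Proof.
have [d hd] := hgens_deg M; pose D := absz (deg b + d)%R.
pose B := [seq monS (bmnm m) *: g.2 | g <- hgens M,
  m <- [seq m <- enum {: bmultinom (2 + n.+1) D.+1} | mdegL p (bmnm m) + g.1 == b]].
exists B; split.
  move=> _ /allpairsPdep[g [m [gG + ->]]]; rewrite mem_filter => /andP[/eqP<- _].
  by apply: gm_compZ; [apply: compS_mon|apply: hgens_comp].
apply: hgens_span => [|_ _ [v ->] [w ->]|g m k gG e].
- by exists 0; rewrite big1 // => i _; rewrite mxE cst0 scale0r.
- exists (v + w); rewrite -big_split; apply: eq_bigr => i _ /=.
  by rewrite mxE cstSD scalerDl.
have mD : (mdeg m < D.+1)%N.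
  by have := hd g gG; have := deg_mdegL m; rewrite /D -e degD; lia.
have yB : monS m *: g.2 \in B.
  apply/allpairsPdep; exists g, (BMultinom mD); split=> //.
  by rewrite mem_filter mem_enum /= e eqxx.
have iB : (index (monS m *: g.2) B < size B)%N by rewrite index_mem.
exists (k *: delta_mx 0 (Ordinal iB)); rewrite (bigD1 (Ordinal iB)) //= !mxE !eqxx.
rewrite mulr1 nth_index // scalerA big1 ?addr0 // => j ji.
by rewrite !mxE (negPf ji) andbF mulr0 cst0 scale0r.
Qed.
End Components.

(** * Coordinates in the components, and regularity in large degrees *)

Section Coordinates.
Variables (K : closedFieldType) (n : nat) (p : weights n).
Variable l : 'I_n.+1 -> K * K.
Local Notation L := (Lp p).
Local Notation cst := (cstS p l).
Local Notation monS := (monS p l).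
Local Notation c := (cdeg p).
Local Notation U := (uS p l).
Local Notation V := (vS p l).
Implicit Types M N : grmod p l.

Lemma comp_basis M b : exists d, exists vec : 'rV[K]_d -> M,
  [/\ forall k v w, vec (k *: v + w) = cst k *: vec v + vec w,
      forall v, gm_comp b (vec v), injective vec
    & forall x, gm_comp b x -> exists v, vec v = x].
Proof.
have [B [cB sB]] := comp_findim M b.
pose f (v : 'rV[K]_(size B)) := \sum_i cst (v 0 i) *: B`_i.
have fL k v w : f (k *: v + w) = cst k *: f v + f w.
  rewrite /f scaler_sumr -big_split; apply: eq_bigr => i _ /=.
  by rewrite !mxE cstSD cstSM scalerDl scalerA.
have f0 : f 0 = 0 by rewrite /f big1 // => i _; rewrite mxE cst0 scale0r.
have cf v : gm_comp b (f v).
  apply: big_ind => [||i _]; [exact: gm_comp0|exact: gm_compD|].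
  by apply: gm_compC; apply: cB; rewrite mem_nth.
have [ker kerP] : exists A : {vspace 'rV[K]_(size B)}, forall v, v \in A <-> f v = 0.
  by apply: subspace_ex => // k v w fv fw; rewrite fL fv fw scaler0 addr0.
pose C := (ker^C)%VS; pose X := vbasis C.
pose g (w : 'rV[K]_(\dim C)) : 'rV[K]_(size B) := \sum_i w 0 i *: X`_i.
have gL k v w : g (k *: v + w) = k *: g v + g w.
  rewrite /g scaler_sumr -big_split; apply: eq_bigr => i _ /=.
  by rewrite !mxE scalerDl scalerA.
have gC w : g w \in C.
  by apply: rpred_sum => i _; rewrite rpredZ // vbasis_mem // mem_nth ?size_tuple.
exists (\dim C), (fun w => f (g w)); split=> [k v w|w|v w e|x /sB[v ->]] //.
- by rewrite gL fL.
- have e0 : g (v - w) = 0.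
    apply/eqP; rewrite -memv0 -(capv_compl ker) memv_cap gC andbT; apply/kerP.
    rewrite -scaleN1r addrC gL fL e cstN cstS1 scaleN1r addNr.
    by [].
  have /freeP fX : free X := basis_free (vbasisP C).
  apply/eqP; rewrite -subr_eq0; apply/eqP/rowP => i; rewrite [RHS]mxE.
  exact: fX (fun i => (v - w) 0 i) e0 i.
have : v \in (ker + C)%VS by rewrite addv_complf memvf.
move=> /memv_addP[v0 /kerP fv0 [v1 Cv1 ->]].
exists (\row_i coord X i v1); have -> : g (\row_i coord X i v1) = v1.
  by rewrite [RHS](coord_vbasis Cv1); apply: eq_bigr => i _; rewrite mxE.
by have := fL 1 v0 v1; rewrite scale1r /f => ->; rewrite -/(f v0) fv0 scaler0 add0r.
Qed.

(** Coordinates in the homogeneous components, which have finite dimension. *)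
Definition gdim M b : nat := projT1 (cid (comp_basis M b)).
Definition vec M b : 'rV[K]_(gdim M b) -> M :=
  projT1 (cid (projT2 (cid (comp_basis M b)))).

Lemma vec_spec M b : [/\ forall k v w, vec (M := M) (b := b) (k *: v + w) = cst k *: vec v + vec w,
      forall v, gm_comp b (@vec M b v), injective (@vec M b)
    & forall x, gm_comp b x -> exists v, @vec M b v = x].
Proof. exact: projT2 (cid (projT2 (cid (comp_basis M b)))). Qed.

Lemma vecL M b k v w : @vec M b (k *: v + w) = cst k *: vec v + vec w.
Proof. by case: (vec_spec M b). Qed.
Lemma vec_comp M b v : gm_comp b (@vec M b v).
Proof. by case: (vec_spec M b). Qed.
Lemma vec_inj M b : injective (@vec M b).
Proof. by case: (vec_spec M b). Qed.

Definition co M b (x : M) : 'rV[K]_(gdim M b) := xget 0 [set v | @vec M b v = x].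

Lemma vec_co M b (x : M) : gm_comp b x -> vec (co b x) = x.
Proof.
by move=> cx; case: (vec_spec M b) => _ _ _ /(_ x cx)[v vx]; apply: (xgetPex 0 (P := [set v | @vec M b v = x])); exists v.
Qed.

Lemma vec0 M b : @vec M b 0 = 0.
Proof.
have := vecL (M := M) (b := b) (-1) 0 0.
by rewrite scaler0 addr0 cstN cstS1 scaleN1r addNr.
Qed.
Lemma vecD M b v w : @vec M b (v + w) = vec v + vec w.
Proof. by have := @vecL M b 1 v w; rewrite scale1r cstS1 scale1r. Qed.
Lemma vec_eq0 M b v : @vec M b v = 0 -> v = 0.
Proof. by rewrite -(vec0 M b) => /vec_inj. Qed.

Definition klinear M N b (F : M -> N) := forall k x y, gm_comp b x -> gm_comp b y ->
  F (cst k *: x + y) = cst k *: F x + F y.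

Definition hom_of M N a b (F : M -> N) : 'Hom('rV[K]_(gdim M a), 'rV[K]_(gdim N b)) :=
  linfun (fun v => co b (F (vec v))).

Lemma hom_ofE M N a b (F : M -> N) v : klinear a F ->
  (forall x, gm_comp a x -> gm_comp b (F x)) ->
  vec (hom_of a b F v) = F (vec v).
Proof.
move=> FL cF; have cv (x : 'rV[K]_(gdim M a)) : gm_comp b (F (vec x)) by apply: cF; apply: vec_comp.
rewrite linfun_lin ?vec_co // => k x y; apply: (@vec_inj N b).
rewrite vec_co; last exact: cv.
rewrite [RHS](@vecL N b) !vec_co //.
rewrite [X in F X](@vecL M a) FL //; apply: vec_comp.
Qed.

Lemma klinear_scale M b s : klinear b (fun x : M => s *: x).
Proof. by move=> k x y _ _; rewrite scalerDr !scalerA mulrC. Qed.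

Section RayOf.
Variables (M : grmod p l) (a : L).

Definition ray k : vectType K := 'rV[K]_(gdim M (a + c *+ k)).
Definition ray_mul s k : 'Hom(ray k, ray k.+1) :=
  hom_of (a + c *+ k) (a + c *+ k.+1) (fun x : M => s *: x).

Lemma ray_mulE s k v : compS c s -> vec (ray_mul s k v) = s *: vec (v : ray k).
Proof.
move=> cs; apply: hom_ofE; first exact: klinear_scale.
by move=> x cx; rewrite mulrS addrCA; apply: gm_compZ.
Qed.

Lemma ray_mulC k v : ray_mul U k.+1 (ray_mul V k v) = ray_mul V k.+1 (ray_mul U k v).
Proof.
apply: vec_inj; have cu := compS_u p l; have cv := compS_v p l.
by rewrite !ray_mulE // !scalerA mulrC.
Qed.
End RayOf.

Definition gen_at M a := forall x : M, gm_comp (a + c) x ->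
  exists y z, [/\ gm_comp a y, gm_comp a z & x = U *: y + V *: z].
Definition soc_at M a := forall x : M, gm_comp a x -> U *: x = 0 -> V *: x = 0 -> x = 0.
Definition kos_at M a := forall y z : M, gm_comp (a + c) y -> gm_comp (a + c) z ->
  V *: y = U *: z -> exists x, [/\ gm_comp a x, U *: x = y & V *: x = z].

Lemma ray_uniform (Q : L -> Prop) :
  (forall a, exists k0, forall k, (k0 <= k)%N -> Q (a + c *+ k)) ->
  exists d : int, forall a, d <= deg a -> Q a.
Proof.
move=> /choice[k0 h].
pose d := (\sum_(r <- coset_reps p) (`|deg r| + (k0 r)%:Z * wprod p))%R.
exists d => a da; have [r rr [k e]] := coset_repsP a.
have le_d : `|deg r| + (k0 r)%:Z * wprod p <= d.
  by rewrite /d (big_rem r) //= lerDl sumr_ge0 // => i _; rewrite addr_ge0.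
have := wprod_gt0 p; move: da; rewrite {}e degD degMz deg_c -mulrzr intz => da w0.
have k0k : (k0 r)%:Z <= k.
  rewrite leNgt; apply/negP => lt; have := le_trans le_d da; nia.
case: k k0k {da} => k // k0k; exact: h.
Qed.

Lemma ray_reach a (d : int) : exists j, forall k, (j <= k)%N -> d <= deg (a + c *+ k).
Proof.
exists `|(d - deg a)%R|%N => k jk; rewrite degD degMn deg_c -mulr_natr natz.
have := wprod_gt0 p; nia.
Qed.

Lemma monSD (m1 m2 : 'X_{1.. 2 + n.+1}) : monS (m1 + m2)%MM = monS m1 * monS m2.
Proof. by rewrite /monS mpolyXD rmorphM. Qed.

Lemma monS_split (m : 'X_{1.. 2 + n.+1}) j k : (k <= m j)%N -> exists m', m = (m' + U_(j) *+ k)%MM.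
Proof.
move=> km; exists (m - U_(j) *+ k)%MM; rewrite submK //.
apply/mnm_lepP => i; rewrite mulmnE mnm1E; case: eqP => [<-|_]; rewrite ?mul1n //.
Qed.

(** A monomial of large degree is divisible by U, by V or by some [X_i ^+ p_i],
    which is a combination of U and V. *)
Lemma gen_large M : exists d : int, forall a, d <= deg a -> gen_at M a.
Proof.
have [d hd] := hgens_deg M; exists (d + n.+1%:Z * wprod p) => a da.
apply: hgens_span => [|_ _ [y [z [cy cz ->]]] [y' [z' [cy' cz' ->]]]|g m k gG e].
- by exists 0, 0; rewrite !scaler0 addr0; split=> //; apply: gm_comp0.
- exists (y + y'), (z + z'); rewrite !scalerDr addrACA.
  by split=> //; apply: gm_compD.
have cg := hgens_comp gG.
pose ju := lshift n.+1 (0 : 'I_2); pose jv := lshift n.+1 (1 : 'I_2).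
have step m' s t : mdegL p m' + c = mdegL p m ->
    cst k * monS m = U * (cst s * monS m') + V * (cst t * monS m') ->
    exists y z, [/\ gm_comp a y, gm_comp a z & (cst k * monS m) *: g.2 = U *: y + V *: z].
  move=> em es; exists ((cst s * monS m') *: g.2), ((cst t * monS m') *: g.2).
  have cm : mdegL p m' + g.1 = a by apply: (addIr c); rewrite -e -em addrAC.
  split; rewrite -?cm; try by apply: gm_compZ => //; apply: compSZ; apply: compS_mon.
  by rewrite es scalerDl -!scalerA.
have [mu|mu] := ltnP 0 (m ju).
  have [m' em] := monS_split mu; apply: (step m' k 0).
    by rewrite em mdegLD mulm1n mdegL1 vardeg_u.
  by rewrite em monSD mulm1n cst0 mul0r mulr0 addr0 -[monS U_(ju)%MM]/U; ring.
have [mv|mv] := ltnP 0 (m jv).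
  have [m' em] := monS_split mv; apply: (step m' 0 k).
    by rewrite em mdegLD mulm1n mdegL1 vardeg_v.
  by rewrite em monSD mulm1n cst0 mul0r mulr0 add0r -[monS U_(jv)%MM]/V; ring.
have [[i mi]|no] := EM (exists i, (p i <= m (rshift 2 i))%N).
  have [m' em] := monS_split mi; apply: (step m' (k * (l i).1) (k * (l i).2)).
    rewrite em mdegLD -(x_mulp p i); congr (_ + _).
    by elim: (p i) => [|q IH]; rewrite ?mdegL0 // mulmS mdegLD mdegL1 vardeg_x -IH mulrS.
  rewrite em monSD; have -> : monS (U_(rshift 2 i) *+ p i)%MM = xS p l i ^+ p i.
    by rewrite /xS -rmorphXn /monS /varX mpolyXn.
  by rewrite xS_exp /linS !cstSM; ring.
exfalso; have dm : deg (mdegL p m) <= n.+1%:Z * wprod p.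
  rewrite /mdegL big_split_ord /= (big_ord_recl 1) (big_ord_recl 0) big_ord0.
  have -> : m (lshift n.+1 (0 : 'I_2)) = 0%N by apply/eqP; rewrite -leqn0.
  have -> : lift ord0 (ord0 : 'I_1) = (1 : 'I_2) by apply: val_inj.
  have -> : m (lshift n.+1 (1 : 'I_2)) = 0%N by apply/eqP; rewrite -leqn0.
  rewrite !mulr0n !add0r (big_morph _ (@degD n p) (deg0 p)).
  have -> : n.+1%:Z * wprod p = \sum_(i < n.+1) (wprod p)%:Z.
    by rewrite sumr_const card_ord -mulr_natl natz.
  apply: ler_sum => i _; rewrite vardeg_x -deg_c -(x_mulp p i) !degMn.
  have := deg_x_gt0 p i; have : (m (rshift 2 i) < p i)%N.
    by rewrite ltnNge; apply/negP => mi; apply: no; exists i.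
  by rewrite -!(mulr_natr (deg _)) !natz; nia.
have := hd g gG; have := congr1 (@deg n p) e; rewrite !degD deg_c.
have := wprod_gt0 p; lia.
Qed.

Lemma ray_gen M a : (forall k, gen_at M (a + c *+ k)) ->
  forall k (x : ray M a k.+1), exists y z : ray M a k,
    x = ray_mul M a U k y + ray_mul M a V k z.
Proof.
move=> ga k x; have e1 : a + c *+ k.+1 = a + c *+ k + c by rewrite mulrSr addrA.
have : gm_comp (a + c *+ k + c) (@vec M (a + c *+ k.+1) x).
  by rewrite -e1; apply: vec_comp.
move=> /ga[y [z [cy cz e]]].
exists (co (a + c *+ k) y), (co (a + c *+ k) z); apply: vec_inj.
rewrite (@vecD M) !ray_mulE; [|exact: compS_v|exact: compS_u].
by rewrite !vec_co.
Qed.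

Lemma soc_large M : exists d : int, forall a, d <= deg a -> soc_at M a.
Proof.
have [d hd] := gen_large M; apply: ray_uniform => a.
have [j hj] := ray_reach a d; pose b := a + c *+ j.
have gb k : gen_at M (b + c *+ k).
  by apply: hd; rewrite /b -addrA -mulrnDr; apply: hj; apply: leq_addr.
have [k1 h] := gen_soc (@ray_mulC M b) (vbasis fullv).
exists (j + k1)%N => k jk x; have -> : a + c *+ k = b + c *+ (k - j).
  by rewrite /b -addrA -mulrnDr subnKC //; lia.
move=> cx ux vx; rewrite -(vec_co cx); pose X : ray M b (k - j) := co (b + c *+ (k - j)) x.
have EX : vec X = x by apply: vec_co.
suff -> : co (b + c *+ (k - j)) x = 0 by apply: vec0.
apply: (h (k - j)%N _ X); first lia.
- rewrite (span_basis (vbasisP _)).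
  by rewrite (gen_fullv (ray_gen gb)) memvf.
- by apply: vec_eq0; rewrite ray_mulE ?EX //; apply: compS_u.
- by apply: vec_eq0; rewrite ray_mulE ?EX //; apply: compS_v.
Qed.

Lemma ray_soc M a : (forall k, soc_at M (a + c *+ k)) ->
  forall k (x : ray M a k), ray_mul M a U k x = 0 -> ray_mul M a V k x = 0 -> x = 0.
Proof.
move=> sa k x ux vx; apply: vec_eq0; apply: sa; first exact: vec_comp.
  by have := ray_mulE x (compS_u p l); rewrite ux vec0.
by have := ray_mulE x (compS_v p l); rewrite vx vec0.
Qed.

Lemma kos_large M : exists d : int, forall a, d <= deg a -> kos_at M a.
Proof.
have [d1 hd1] := gen_large M; have [d2 hd2] := soc_large M.
apply: ray_uniform => a.
have [j hj] := ray_reach a (Num.max d1 d2); pose b := a + c *+ j.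
have hb k : Num.max d1 d2 <= deg (b + c *+ k).
  by rewrite /b -addrA -mulrnDr; apply: hj; apply: leq_addr.
have gb k : gen_at M (b + c *+ k).
  by apply: hd1; apply: le_trans (hb k); rewrite le_max lexx.
have sb k : soc_at M (b + c *+ k).
  by apply: hd2; apply: le_trans (hb k); rewrite le_max lexx orbT.
have [C hC] := kos_exact (@ray_mulC M b) (ray_gen gb) (ray_soc sb).
exists (j + C)%N => k jk y z; have -> : a + c *+ k = b + c *+ (k - j).
  by rewrite /b -addrA -mulrnDr subnKC //; lia.
set m := (k - j)%N; have Cm : (C <= m)%N by rewrite /m; lia.
have -> : b + c *+ m + c = b + c *+ m.+1 by rewrite mulrSr addrA.
move=> cy cz e; have cu := compS_u p l; have cv := compS_v p l.
have [|x ux vx] := hC m Cm (co _ y) (co _ z).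
  by apply: vec_inj; rewrite !ray_mulE // !vec_co.
exists (vec x); split; first exact: vec_comp.
  by rewrite -ray_mulE // ux vec_co.
by rewrite -ray_mulE // vx vec_co.
Qed.

(** From degree [regdeg M] on, M behaves like the module of sections of a
    sheaf generated by its sections. *)
Definition regular M d := forall a, d <= deg a -> [/\ gen_at M a, soc_at M a & kos_at M a].

Lemma regular_ex M : exists d, regular M d.
Proof.
have [d1 h1] := gen_large M; have [d2 h2] := soc_large M; have [d3 h3] := kos_large M.
exists (Num.max d1 (Num.max d2 d3)) => a; rewrite !ge_max => /and3P[? ? ?].
by split; auto.
Qed.

Definition regdeg M : int := projT1 (cid (regular_ex M)).
Lemma regdegP M : regular M (regdeg M).
Proof. exact: projT2 (cid (regular_ex M)). Qed.
End Coordinates.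

(** * Modules of finite length *)

Section FiniteLength.
Variables (K : closedFieldType) (n : nat) (p : weights n).
Variable l : 'I_n.+1 -> K * K.
Local Notation L := (Lp p).
Local Notation S := (ringS p l).
Local Notation cst := (cstS p l).
Local Notation c := (cdeg p).
Implicit Types M N : grmod p l.

Lemma compS_pos b (s : S) : compS b s ->
  [\/ s = 0, 0 < deg b | b = 0 /\ exists k, s = cst k].
Proof.
move=> [f [-> hf]]; have [fpos|fneg] := ltP 0 (deg b); first by constructor 2.
have m0 m : m \in msupp f -> m = 0%MM.
  move=> /hf e; have := deg_mdegL p m; rewrite e => h.
  by apply/eqP; rewrite -mdeg_eq0 -leqn0 -lez_nat; apply: le_trans h fneg.
have [f0|[m mf]] : f = 0 \/ exists m, m \in msupp f.
- case E: (msupp f) => [|m r]; last by right; exists m; rewrite inE eqxx.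
  by left; apply/eqP; rewrite -msupp_eq0 E.
- by constructor 1; rewrite f0 raddf0.
constructor 3; split; first by rewrite -(hf m mf) (m0 m mf) mdegL0.
exists f@_0%MM; rewrite monS_expand; have := msupp_uniq f; have := m0.
have := mf; case: (msupp f) => [|m1 [|m2 r]] // _ h /andP[].
  by rewrite big_seq1 (h m1) ?inE ?eqxx // monS0 mulr1.
by rewrite (h m1) ?inE ?eqxx // (h m2) ?inE ?eqxx // orbT.
Qed.

(** The submodule that agrees with P up to the degree of some homogeneous
    element of Q outside P, and with Q above it, lies between P and Q and is
    not Q; so it is P. *)
Lemma simple_step_tail M (P Q : set M) : simple_step P Q ->
  exists d : int, forall a, d <= deg a -> forall x, gm_comp a x -> Q x -> P x.
Proof.
move=> [sP sQ PQ neq mid].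
have [a [y [cy Qy Py]]] : exists a y, [/\ gm_comp a y, Q y & ~ P y].
  apply: contrapT => no; apply: neq; apply/seteqP; split=> //.
  apply: gsub_sub => // a x cx Qx; apply: contrapT => Px.
  by apply: no; exists a, x.
pose R (b : L) := [set z : M | if deg b <= deg a then P z else Q z].
have RQ b z : R b z -> Q z by rewrite /R /=; case: ifP => // _ /PQ.
have PR b z : P z -> R b z by rewrite /R /=; case: ifP => // _ /PQ.
have sR : gsub [set z | forall b, R b (pr b z)].
  apply: gsub_family => [b|b x z|b e s x cs cx].
  - by apply: PR; apply: gs0 sP.
  - by rewrite /R /=; case: ifP => _; [exact: (gsD sP)|exact: (gsD sQ)].
  case: (compS_pos cs) => [->|epos|[-> _]]; last 1 first.
  - by rewrite addr0 /R /=; case: ifP => _; [exact: (gsZ sP)|exact: (gsZ sQ)].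
  - by move=> _; rewrite scale0r; apply: PR; apply: gs0 sP.
  rewrite /R /= degD; case: (lerP (deg b) (deg a)) => h; case: ifP => // h'.
  - exact: (gsZ sP).
  - by move=> /PQ; apply: (gsZ sQ).
  - by lia.
  - exact: (gsZ sQ).
case: (mid _ sR) => [x Px b|x Rx|e|e].
- by apply: PR; apply: gsub_pr.
- by apply: gsub_prP => // b; apply: RQ (Rx b).
- exists (deg a + 1) => b hb x cx Qx; rewrite -e => d.
  rewrite (pr_hom _ cx); case: eqP => [->|_]; last by apply: PR; apply: gs0 sP.
  by rewrite /R /=; case: ifP => //; lia.
case: Py; move: Qy; rewrite -e => /(_ a); rewrite /R /= lexx.
by rewrite (pr_id cy).
Qed.

Lemma fin_length_tail M (P Q : set M) : fin_length P Q ->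
  exists d : int, forall a, d <= deg a -> forall x, gm_comp a x -> Q x -> P x.
Proof.
elim=> {P Q} [P sP|P Q R /simple_step_tail[d hd] _ [d' hd']]; first by exists 0.
exists (Num.max d d') => a; rewrite ge_max => /andP[h h'] x cx Rx.
by apply: (hd a) => //; apply: (hd' a).
Qed.

Lemma deg_window (d1 d2 : int) : exists D : seq L,
  forall a, d1 <= deg a -> deg a < d2 -> a \in D.
Proof.
pose N := (`|d1| + `|d2| + \sum_(r <- coset_reps p) `|deg r|)%N.
exists [seq r + c *~ (i%:Z - N%:Z) | r <- coset_reps p, i <- iota 0 (N + N).+1].
move=> a ha1 ha2; have [r rr [k e]] := coset_repsP a.
have hr : (`|deg r| <= \sum_(r <- coset_reps p) `|deg r|)%N.
  by rewrite (big_rem r) //= leq_addr.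
have w0 := wprod_gt0 p; rewrite {}e degD degMz deg_c -mulrzr intz in ha1 ha2 *.
have hk : `|k| <= N%:Z by rewrite /N; nia.
apply/allpairsP; exists (r, `|(k + N%:Z)%R|%N); split=> //.
  by rewrite mem_iota /=; lia.
rewrite /=; congr (_ + c *~ _); lia.
Qed.

(** The homogeneous part of a graded submodule, in coordinates. *)
Definition sp M (P : set M) b : {vspace 'rV[K]_(gdim M b)} :=
  xget 0%VS [set W : {vspace 'rV[K]_(gdim M b)} | forall v, v \in W <-> P (vec v)].

Lemma mem_sp M (P : set M) b (v : 'rV[K]_(gdim M b)) : gsub P -> v \in sp P b <-> P (vec v).
Proof.
move=> sP; have h : exists W : {vspace 'rV[K]_(gdim M b)}, forall v, v \in W <-> P (vec v).
  apply: subspace_ex => [|k x y Px Py]; first by rewrite vec0; apply: gs0 sP.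
  by rewrite vecL; apply: (gsL sP).
exact: (xgetPex 0%VS (P := [set W | _]) h).
Qed.

Lemma sp_sub M (P Q : set M) b : gsub P -> gsub Q -> P `<=` Q -> (sp P b <= sp Q b)%VS.
Proof. by move=> sP sQ PQ; apply/subvP => v /(mem_sp _ sP)/PQ/(mem_sp _ sQ). Qed.

(** Between the degrees where M vanishes and the degree [d] there are finitely
    many degrees, with finite dimensional components. Adding to P a homogeneous
    element of Q outside P, of the largest possible degree, is a step with
    simple quotient, since elements of S of positive degree send it into P. *)
Lemma tail_fin_length M (P Q : set M) (d : int) : gsub P -> gsub Q -> P `<=` Q ->
  (forall a, d <= deg a -> forall x, gm_comp a x -> Q x -> P x) -> fin_length P Q.
Proof.
move=> sP sQ PQ tail; have [e low] := comp_low M; have [D hD] := deg_window e d.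
have [m] := ubnP (\sum_(b <- D) (gdim M b - \dim (sp P b))).
elim: m => // m IH in P sP PQ tail *; rewrite ltnS => hm.
have [QP|nQP] := EM (Q `<=` P).
  by have -> : P = Q by [apply/seteqP]; apply: fin_length_nil.
pose bad b (y : M) := [/\ gm_comp b y, Q y & ~ P y].
have [b0 [y0 bad0]] : exists b y, bad b y.
  apply: contrapT => no; apply: nQP; apply: gsub_sub => // a x cx Qx.
  by apply: contrapT => Px; apply: no; exists a, x.
have bad_deg b y : bad b y -> e <= deg b /\ deg b < d.
  move=> [cy Qy Py]; split.
    by rewrite leNgt; apply/negP => h; apply: Py; rewrite (low _ _ h cy); apply: gs0 sP.
  by rewrite ltNge; apply/negP => h; apply: Py; apply: tail cy Qy.
have [b [x [[cx Qx Px] xmax]]] : exists b x, bad b x /\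
    forall b' y, bad b' y -> deg b' <= deg b.
  have exP : exists k, `[< exists b y, bad b y /\ deg b = e + k%:Z >].
    exists `|(deg b0 - e)%R|%N; apply/asboolP; exists b0, y0; split=> //.
    by have [h _] := bad_deg _ _ bad0; lia.
  have ubP k : `[< exists b y, bad b y /\ deg b = e + k%:Z >] -> (k <= `|(d - e)%R|)%N.
    by move=> /asboolP[b [y [/bad_deg[h1 h2] h3]]]; lia.
  case: (ex_maxnP exP ubP) => k /asboolP[b [x [bx bk]]] kmax.
  exists b, x; split=> // b' y by'; have [h1 h2] := bad_deg _ _ by'.
  have := kmax `|(deg b' - e)%R|%N; rewrite bk => h; suff : (`|(deg b' - e)%R| <= k)%N by lia.
  by apply: h; apply/asboolP; exists b', y; split=> //; lia.
have above b' y : deg b < deg b' -> gm_comp b' y -> Q y -> P y.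
  move=> bb' cy Qy; apply: contrapT => Py.
  by have := xmax b' y (And3 cy Qy Py); lia.
(* P together with the scalar multiples of x *)
pose R (b' : L) := [set y : M | if b' == b then exists k, P (y - cst k *: x) else P y].
have RP b' y : P y -> R b' y.
  by rewrite /R /=; case: ifP => // _ Py; exists 0; rewrite cst0 scale0r subr0.
have RQ b' y : R b' y -> Q y.
  rewrite /R /=; case: ifP => // _ => [[k /PQ h]|/PQ//].
  by rewrite -(subrK (cst k *: x) y); apply: (gsD sQ) => //; apply: (gsZ sQ).
pose P' := [set z : M | forall b', R b' (pr b' z)].
have sP' : gsub P'.
  apply: gsub_family => [b'|b' y z|b' a s y cs cy].
  - by apply: RP; apply: gs0 sP.
  - rewrite /R /=; case: ifP => _; last exact: (gsD sP).
    move=> [k h] [k' h']; exists (k + k'); rewrite cstSD scalerDl opprD addrACA.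
    exact: (gsD sP).
  case: (compS_pos cs) => [->|apos|[-> [t ->]]].
  - by move=> _; rewrite scale0r; apply: RP; apply: gs0 sP.
  - rewrite {1}/R /=; case: eqP => [->|_] h; last by apply/RP/(gsZ sP).
    case: h => k h; apply: RP; rewrite -(subrK (cst k *: x) y) scalerDr.
    apply: (gsD sP); first exact: (gsZ sP).
    apply: (above (b + a)); first by rewrite degD; lia.
      by rewrite addrC; apply: gm_compZ cs _; apply: gm_compC.
    by do 2!apply: (gsZ sQ).
  rewrite addr0 /R /=; case: ifP => _; last exact: (gsZ sP).
  move=> [k h]; exists (t * k); rewrite cstSM -scalerA -scalerBr; exact: (gsZ sP).
have PP' : P `<=` P' by move=> y Py b'; apply: RP; apply: gsub_pr.
have P'Q : P' `<=` Q by move=> y P'y; apply: gsub_prP => // b'; apply: RQ (P'y b').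
have P'x : P' x.
  move=> b'; rewrite (pr_hom _ cx) /R /=; case: eqP => _; last exact: gs0 sP.
  by exists 1; rewrite cstS1 scale1r subrr; apply: gs0 sP.
apply: (@fin_length_cons _ _ _ _ _ P P' Q).
  split=> // [e1|A sA PA AP']; first by apply: Px; rewrite e1.
  have [[y [cy Ay Py]]|no] := EM (exists y, [/\ gm_comp b y, A y & ~ P y]).
    right; apply/seteqP; split=> //; apply: gsub_sub => // b' z cz P'z.
    have := AP' y Ay b; have := P'z b'; rewrite /R /= (pr_id cz) (pr_id cy) eqxx.
    case: eqP => [_ [k hk] [t ht]|_ Pz _]; last exact: PA.
    have t0 : t != 0.
      by apply/eqP => t0; apply: Py; move: ht; rewrite t0 cst0 scale0r subr0.
    have Ax : A x.
      have : A (cst t^-1 *: (y - (y - cst t *: x))).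
        by apply: (gsZ sA); apply: (gsB sA) => //; apply: PA.
      by rewrite opprB addrC subrK scalerA cstV // scale1r.
    by rewrite -(subrK (cst k *: x) z); apply: (gsD sA); [apply: PA|apply: (gsZ sA)].
  left; apply/seteqP; split=> //; apply: gsub_sub => // b' z cz Az.
  have := AP' z Az b'; rewrite /R /= (pr_id cz); case: eqP => // bb' _.
  by apply: contrapT => Pz; apply: no; exists z; rewrite -bb'.
apply: IH => // [a da y cy Qy|]; first by apply: PP'; apply: (tail a).
have bD : b \in D by have [h1 h2] := bad_deg _ _ (And3 cx Qx Px); apply: hD.
have le_sp b' : (\dim (sp P b') <= \dim (sp P' b'))%N by apply/dimvS/sp_sub.
have lt_sp : (\dim (sp P b) < \dim (sp P' b))%N.
  rewrite ltn_neqAle le_sp andbT; apply/eqP => e1.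
  have /eqP e2 : (sp P b == sp P' b)%VS by rewrite eqEdim sp_sub // e1 /=.
  apply: Px; rewrite -(vec_co cx); apply/(mem_sp _ sP); rewrite e2.
  by apply/(mem_sp _ sP'); rewrite vec_co.
have le_g b' : (\dim (sp P' b') <= gdim M b')%N.
  by have := dimvS (subvf (sp P' b')); rewrite dimvf /dim /= mul1n.
apply: leq_trans hm; rewrite (big_rem b) //= [in X in (_ < X)%N](big_rem b) //=.
rewrite -addSn leq_add //; first by have := le_g b; lia.
by apply: leq_sum => b' _; have := le_sp b'; have := le_g b'; lia.
Qed.

End FiniteLength.

(** * Quotient modules *)

Section Quotients.
Variables (K : closedFieldType) (n : nat) (p : weights n).
Variable l : 'I_n.+1 -> K * K.
Local Notation L := (Lp p).
Local Notation S := (ringS p l).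
Variables (M : grmod p l) (P : set M).
Hypothesis sP : gsub P.

Definition gsub_pred (sP : gsub P) : {pred M} := fun x => `[<P x>].

Lemma gsub_pred_closed : zmod_closed (gsub_pred sP).
Proof.
split=> [|x y /asboolP Px /asboolP Py]; apply/asboolP; first exact: gs0 sP.
exact: (gsB sP).
Qed.

HB.instance Definition _ :=
  GRing.isZmodClosed.Build M (gsub_pred sP) gsub_pred_closed.

Definition quo := Quotient.quot (gsub_pred sP).
HB.instance Definition _ := GRing.Zmodule.on quo.

Definition qpi (x : M) : quo := \pi_quo x.

Lemma qpiP x y : qpi x = qpi y <-> P (x - y).
Proof.
split=> [/eqP|h]; last apply/eqP.
  by rewrite /qpi -Quotient.idealrBE => /asboolP.
by rewrite /qpi -Quotient.idealrBE; apply/asboolP.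
Qed.

Lemma qpi_surj y : exists x, qpi x = y.
Proof. by exists (repr y); rewrite /qpi reprK. Qed.

Lemma qpiD : {morph qpi : x y / x + y}.
Proof. by move=> x y; rewrite /qpi raddfD. Qed.
Lemma qpiB : {morph qpi : x y / x - y}.
Proof. by move=> x y; rewrite /qpi raddfB. Qed.
Lemma qpi0 : qpi 0 = 0. Proof. by rewrite /qpi raddf0. Qed.

Definition quo_scale (s : S) (y : quo) : quo := qpi (s *: repr y).

Lemma qpi_scale s x : qpi (s *: x) = quo_scale s (qpi x).
Proof.
apply/qpiP; rewrite -scalerBr; apply: (gsZ sP); apply/qpiP.
by rewrite /qpi reprK.
Qed.

Lemma quo_scaleA s t y : quo_scale s (quo_scale t y) = quo_scale (s * t) y.
Proof. by have [x <-] := qpi_surj y; rewrite -!qpi_scale scalerA. Qed.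
Lemma quo_scale1 : left_id 1 quo_scale.
Proof. by move=> y; have [x <-] := qpi_surj y; rewrite -qpi_scale scale1r. Qed.
Lemma quo_scaleDr : right_distributive quo_scale +%R.
Proof.
move=> s y z; have [x <-] := qpi_surj y; have [x' <-] := qpi_surj z.
by rewrite -qpiD -!qpi_scale -qpiD scalerDr.
Qed.
Lemma quo_scaleDl y : {morph quo_scale^~ y : s t / s + t}.
Proof.
by move=> s t; have [x <-] := qpi_surj y; rewrite -!qpi_scale -qpiD scalerDl.
Qed.

HB.instance Definition _ := GRing.Zmodule_isLmodule.Build S quo
  quo_scaleA quo_scale1 quo_scaleDr quo_scaleDl.

Lemma qpiZ s x : qpi (s *: x) = s *: qpi x. Proof. exact: qpi_scale. Qed.

Lemma qpi_sum (I : Type) (r : seq I) (Q : pred I) (F : I -> M) :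
  qpi (\sum_(i <- r | Q i) F i) = \sum_(i <- r | Q i) qpi (F i).
Proof. exact: (big_morph _ qpiD qpi0). Qed.

Definition quo_comp (a : L) : set quo := [set y | exists2 x, gm_comp a x & qpi x = y].

Definition gquo : grmod p l.
Proof.
refine (@GrMod K n p l (quo : lmodType S) quo_comp _ _ _ _ _ _).
- by move=> a; exists 0; [apply: gm_comp0|apply: qpi0].
- move=> a _ _ [x cx <-] [y cy <-]; exists (x - y); first exact: gm_compB.
  exact: qpiB.
- move=> a b s _ cs [x cx <-]; exists (s *: x); first exact: gm_compZ.
  exact: qpiZ.
- move=> y; have [x <-] := qpi_surj y; have [r [f [ur cf ->]]] := gm_span x.
  exists r, (fun a => qpi (f a)); split=> // [a|]; first by exists (f a).
  exact: qpi_sum.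
- move=> r f ur cf; have /choice[g hg] : forall a, exists x, gm_comp a x /\ qpi x = f a.
    by move=> a; have [x ? ?] := cf a; exists x.
  have -> : \sum_(a <- r) f a = qpi (\sum_(a <- r) g a).
    by rewrite qpi_sum; apply: eq_bigr => a _; case: (hg a).
  move=> e; have /qpiP : qpi (\sum_(a <- r) g a) = qpi 0 by rewrite qpi0.
  rewrite subr0 => Pg a ar.
  have [_ <-] := hg a; rewrite -[RHS]qpi0; apply/qpiP; rewrite subr0.
  by apply: (gsH sP ur) Pg a ar => b; case: (hg b).
have [N [g hg]] := gm_fingen M; exists N, (fun i => qpi (g i)) => y.
have [x <-] := qpi_surj y; have [s ->] := hg x; exists s.
by rewrite qpi_sum; apply: eq_bigr => i _; rewrite qpiZ.
Defined.

Definition gproj (x : M) : gquo := qpi x.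
End Quotients.

(** * Free modules of rank one *)

Section Twists.
Variables (K : closedFieldType) (n : nat) (p : weights n).
Variable l : 'I_n.+1 -> K * K.
Local Notation L := (Lp p).
Local Notation S := (ringS p l).

Lemma gpr_homL (b : L) (f : {mpoly K[2 + n.+1]}) : homL b (gpr b f).
Proof.
by move=> m; rewrite mcoeff_msupp gprE; case: (mdegL p m =P b) => // _; rewrite eqxx.
Qed.

Lemma compS_span (s : S) : exists (r : seq L) (f : L -> S),
  [/\ uniq r, forall b, compS b (f b) & s = \sum_(b <- r) f b].
Proof.
rewrite -[s]reprK; set g : {mpoly K[2 + n.+1]} := repr s.
pose r := undup [seq mdegL p m | m <- msupp g].
exists r, (fun b => \pi_S (gpr b g)); split; first exact: undup_uniq.
  by move=> b; exists (gpr b g); split=> //; apply: gpr_homL.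
rewrite -raddf_sum; congr \pi_S; apply/mpolyP => m; rewrite raddf_sum /=.
have [mg|mg] := boolP (m \in msupp g); last first.
  by rewrite memN_msupp_eq0 // big1 // => b _; rewrite gprE memN_msupp_eq0 // if_same.
rewrite (bigD1_seq (mdegL p m)) ?undup_uniq ?mem_undup ?map_f //= gprE eqxx.
by rewrite big1 ?addr0 // => b bm; rewrite gprE eq_sym (negPf bm).
Qed.

(** The free module with generator 1 in degree [a]. *)
Definition free_mod (a : L) : grmod p l.
Proof.
refine (@GrMod K n p l (S^o : lmodType S) (fun b => [set s : S^o | compS (b - a) (s : S)]) _ _ _ _ _ _).
- by move=> b; apply: compS0.
- by move=> b x y; apply: compSB.
- by move=> b d s x cs cx; rewrite /= -addrA; apply: compSM.
- move=> x; have [r [f [ur cf ->]]] := compS_span x.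
  exists [seq b + a | b <- r], (fun b => f (b - a)); split.
  + by rewrite map_inj_uniq //; apply: addIr.
  + by move=> b; apply: cf.
  + by rewrite big_map; apply: eq_bigr => b _; rewrite addrK.
- move=> r f ur cf e b br; rewrite -(subrK a b).
  apply: (@compS_direct K n p l [seq b - a | b <- r] (fun b => f (b + a))).
  + by rewrite map_inj_uniq //; apply: addIr.
  + by move=> d; have := cf (d + a); rewrite /= addrK.
  + by rewrite big_map -[RHS]e; apply: eq_bigr => d _; rewrite subrK.
  + by apply/mapP; exists b.
exists 1%N, (fun _ => 1) => x; exists (fun _ => x).
by rewrite big_ord1 /GRing.scale /= mulr1.
Defined.

Lemma free_compE a b (s : S) : @gm_comp K n p l (free_mod a) b s = compS (b - a) s.
Proof. by []. Qed.
End Twists.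

(** * Morphisms of sheaves in large degrees *)

Section Germs.
Variables (K : closedFieldType) (n : nat) (p : weights n).
Variable l : 'I_n.+1 -> K * K.
Local Notation L := (Lp p).
Local Notation S := (ringS p l).
Local Notation cst := (cstS p l).
Implicit Types M N X Y Z : grmod p l.

Lemma gsub_dom M N (T : set (M * N)) : grel T -> gsub (rel_dom T).
Proof.
by move=> sT; rewrite rel_domE; apply: gsub_im; [apply: grel_inv|apply: gsub_setT].
Qed.

Lemma gsub_ind M N (T : set (M * N)) : grel T -> gsub (rel_ind T).
Proof. by move=> sT; rewrite rel_indE; apply: gsub_im => //; apply: gsub_set0. Qed.

Lemma frac_tail X Y (R : frac X Y) : exists d : int, forall a, d <= deg a ->
  forall x, gm_comp a x -> exists y, [/\ gm_comp a y, fr R (x, y)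
    & forall y', gm_comp a y' -> fr R (x, y') -> y' = y].
Proof.
have [d1 h1] := fin_length_tail (fr_dom R); have [d2 h2] := fin_length_tail (fr_ind R).
exists (Num.max d1 d2) => a; rewrite ge_max => /andP[a1 a2] x cx.
have [y xy] := h1 a a1 x cx I; have sR := fr_sub R; exists (pr a y); split.
- exact: pr_comp.
- by rewrite -{1}(pr_id cx); apply: (grel_pr a sR).
move=> y' cy' xy'; apply/eqP; rewrite -subr_eq0; apply/eqP.
apply: (h2 a a2); first by apply: gm_compB => //; apply: pr_comp.
rewrite /rel_ind /= -(subrr x); apply: (grB sR) => //.
by rewrite -{1}(pr_id cx); apply: (grel_pr a sR).
Qed.

Definition tail M (d : int) : set M := [set x | forall a, deg a < d -> pr a x = 0].

Lemma compS_deg_ge0 b (s : S) : compS b s -> s = 0 \/ 0 <= deg b.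
Proof.
by case/compS_pos => [->|h|[-> _]]; [left|right; apply: ltW|right; rewrite deg0].
Qed.

Lemma gsub_tail M d : gsub (tail (M := M) d).
Proof.
apply: (@gsub_family _ _ _ _ M (fun a => [set x | deg a < d -> x = 0])) => //=.
  by move=> a x y hx hy h; rewrite hx // hy // addr0.
move=> a b s x cs cx hx h; case: (compS_deg_ge0 cs) => [->|b0]; first exact: scale0r.
by rewrite hx ?scaler0 //; move: h; rewrite degD; lia.
Qed.

Lemma fin_length_tailT M d : fin_length (tail (M := M) d) setT.
Proof.
apply: (@tail_fin_length _ _ _ _ M _ _ d); [exact: gsub_tail|exact: gsub_setT|by []|].
move=> a da x cx _ b hb; rewrite (pr_hom _ cx); case: eqP => // e.
by move: hb; rewrite e ltNge da.
Qed.

(** The submodules of finite length and of finite colength in the definition of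
    equivalence are zero, respectively everything, in large degrees; conversely
    [tail_fin_length] provides them. *)
Lemma frac_eqvP X Y (R1 R2 : frac X Y) : frac_eqv R1 R2 <->
  exists d : int, forall a, d <= deg a -> forall x y1 y2, gm_comp a x ->
    gm_comp a y1 -> gm_comp a y2 -> fr R1 (x, y1) -> fr R2 (x, y2) -> y1 = y2.
Proof.
split=> [[A [B [fA fB AR h]]]|[d0 h0]].
  have [d1 h1] := fin_length_tail fA; have [d2 h2] := fin_length_tail fB.
  exists (Num.max d1 d2) => a; rewrite ge_max => /andP[a1 a2] x y1 y2 cx c1 c2 r1 r2.
  apply/eqP; rewrite -subr_eq0; apply/eqP; apply: (h2 a a2); first exact: gm_compB.
  by apply: h r1 r2; apply: (h1 a).
have [d1 h1] := frac_tail R1; have [d2 h2] := frac_tail R2.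
pose d := Num.max d0 (Num.max d1 d2).
have sB : fin_length [set 0] (sub_sum (rel_ind (fr R1)) (rel_ind (fr R2))).
  by apply: fin_length_add; apply: fr_ind.
have [_ gB _] := fin_length_gsub sB.
exists (tail d), (sub_sum (rel_ind (fr R1)) (rel_ind (fr R2))); split=> //.
- exact: fin_length_tailT.
- move=> x tx; split; (apply: gsub_prP => [|a]; first by apply: gsub_dom; apply: fr_sub).
    have [ad|da] := ltP (deg a) d.
      by rewrite tx //; exists 0; apply: gr0; apply: fr_sub.
    move: da; rewrite !ge_max => /and3P[_ a1 _].
    by have [y [_ ? _]] := h1 a a1 _ (pr_comp a x); exists y.
  have [ad|da] := ltP (deg a) d.
    by rewrite tx //; exists 0; apply: gr0; apply: fr_sub.
  move: da; rewrite !ge_max => /and3P[_ _ a2].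
  by have [y [_ ? _]] := h2 a a2 _ (pr_comp a x); exists y.
move=> x y1 y2 tx r1 r2; apply: gsub_prP => // a; rewrite prD prN.
have r1a := grel_pr a (fr_sub R1) r1; have r2a := grel_pr a (fr_sub R2) r2.
have [ad|da] := ltP (deg a) d.
  move: r1a r2a; rewrite tx // => r1a r2a; exists (pr a y1), (- pr a y2); split=> //.
  by have := grB (fr_sub R2) (gr0 (fr_sub R2)) r2a; rewrite !sub0r oppr0.
move: da; rewrite !ge_max => /and3P[a0 _ _].
rewrite (h0 a a0 _ _ _ (pr_comp a x) (pr_comp a y1) (pr_comp a y2) r1a r2a) subrr.
exact: gs0 gB.
Qed.

(** The graph of a morphism in degree [a]. In large degrees it is the graph of
    a map, but from which degree on depends on the morphism. *)
Definition germ X Y (f : qhom X Y) (a : L) (x : X) (y : Y) :=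
  [/\ gm_comp a x, gm_comp a y & fr (repr f) (x, y)].

Lemma germ_tail X Y (f : qhom X Y) : exists d : int, forall a, d <= deg a ->
  forall x, gm_comp a x -> exists y, germ f a x y /\
    forall y', germ f a x y' -> y' = y.
Proof.
have [d h] := frac_tail (repr f); exists d => a da x cx.
have [y [cy xy u]] := h a da x cx; exists y; split=> // y' [_ c' r']; exact: u.
Qed.

Lemma germ_class X Y (R : frac X Y) : exists d : int, forall a, d <= deg a ->
  forall x y, germ (qclass R) a x y <-> [/\ gm_comp a x, gm_comp a y & fr R (x, y)].
Proof.
have /frac_eqvP[d0 h0] : frac_eqv (repr (qclass R)) R by apply/qclassP/qclass_repr.
have [d1 h1] := frac_tail (repr (qclass R)); have [d2 h2] := frac_tail R.
exists (Num.max d0 (Num.max d1 d2)) => a; rewrite !ge_max => /and3P[a0 a1 a2] x y.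
split=> -[cx cy xy]; split=> //.
  have [y' [cy' xy' _]] := h2 a a2 x cx.
  by rewrite (h0 a a0 x y y').
have [y' [cy' xy' _]] := h1 a a1 x cx.
by rewrite -(h0 a a0 x y' y).
Qed.

Lemma germ_ext X Y (f g : qhom X Y) : (exists d : int, forall a, d <= deg a ->
  forall x y y', germ f a x y -> germ g a x y' -> y = y') -> f = g.
Proof.
move=> [d h]; rewrite -[f]qclass_repr -[g]qclass_repr; apply/qclassP/frac_eqvP.
by exists d => a da x y1 y2 cx c1 c2 r1 r2; apply: (h a da x).
Qed.

Lemma germL X Y (f : qhom X Y) a k x y x' y' : germ f a x y -> germ f a x' y' ->
  germ f a (cst k *: x + x') (cst k *: y + y').
Proof.
move=> [cx cy xy] [cx' cy' xy']; split.
- by apply: gm_compD => //; apply: gm_compC.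
- by apply: gm_compD => //; apply: gm_compC.
exact: (grL (fr_sub (repr f))).
Qed.

Lemma germD X Y (f : qhom X Y) a x y x' y' : germ f a x y -> germ f a x' y' ->
  germ f a (x + x') (y + y').
Proof. by move=> h h'; have := germL 1 h h'; rewrite cstS1 !scale1r. Qed.

Lemma germ0 X Y (f : qhom X Y) a : germ f a 0 0.
Proof. by split; try apply: gm_comp0; apply: gr0; apply: fr_sub. Qed.

Lemma germZ X Y (f : qhom X Y) a b s x y : compS b s -> germ f a x y ->
  germ f (b + a) (s *: x) (s *: y).
Proof.
move=> cs [cx cy xy]; split; try exact: gm_compZ.
by have := grL (fr_sub (repr f)) s xy (gr0 (fr_sub (repr f))); rewrite !addr0.
Qed.

Lemma germ_comp X Y Z (g : qhom Y Z) (f : qhom X Y) : exists d : int,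
  forall a, d <= deg a -> forall x z,
    germ (qcomp g f) a x z <-> exists y, germ f a x y /\ germ g a y z.
Proof.
have [d h] := germ_class (frac_comp (repr g) (repr f)).
exists d => a da x z; split=> [/(h a da)[cx cz [y [/= xy yz]]]|[y [[cx cy xy] [_ cz yz]]]].
  exists (pr a y); split; split=> //; try exact: pr_comp.
    by rewrite -[x](pr_id cx); apply: (grel_pr a (fr_sub (repr f))).
  by rewrite -[z](pr_id cz); apply: (grel_pr a (fr_sub (repr g))).
by apply/(h a da); split=> //; exists y.
Qed.

Lemma germ_add X Y (f g : qhom X Y) : exists d : int,
  forall a, d <= deg a -> forall x y1 y2, germ f a x y1 -> germ g a x y2 ->
    germ (f + g) a x (y1 + y2).
Proof.
have [d h] := germ_class (frac_add (repr f) (repr g)).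
exists d => a da x y1 y2 [cx c1 r1] [_ c2 r2]; apply/(h a da); split=> //.
  exact: gm_compD.
by exists y1, y2.
Qed.

Lemma germ_scale X Y k (f : qhom X Y) : exists d : int,
  forall a, d <= deg a -> forall x y, germ f a x y -> germ (k *: f) a x (cst k *: y).
Proof.
have [d h] := germ_class (frac_scale k (repr f)).
exists d => a da x y [cx cy r]; apply/(h a da); split=> //; first exact: gm_compC.
by exists y.
Qed.

Lemma germ_zero X Y : exists d : int, forall a, d <= deg a ->
  forall (x : X) (y : Y), germ (0 : qhom X Y) a x y -> y = 0.
Proof.
have [d h] := germ_class (frac_zero X Y).
by exists d => a da x y /(h a da)[_ _].
Qed.

(** Morphisms are the graded maps defined in large degrees: the finite length
    conditions on a fraction then hold by [tail_fin_length]. *)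
Lemma germ_make X Y (d : int) (Q : L -> X -> Y -> Prop) :
  (forall a, d <= deg a -> Q a 0 0) ->
  (forall a, d <= deg a -> forall x, gm_comp a x -> exists2 y, gm_comp a y & Q a x y) ->
  (forall a, d <= deg a -> forall y, gm_comp a y -> Q a 0 y -> y = 0) ->
  (forall a, d <= deg a -> forall x y x' y', Q a x y -> Q a x' y' ->
     Q a (x + x') (y + y')) ->
  (forall a b s, d <= deg a -> compS b s -> forall x y, gm_comp a x -> gm_comp a y ->
     Q a x y -> Q (a + b) (s *: x) (s *: y)) ->
  exists f : qhom X Y, exists d' : int, forall a, d' <= deg a -> forall x y,
    germ f a x y <-> [/\ gm_comp a x, gm_comp a y & Q a x y].
Proof.
move=> Q0 Qtot Qfun QD QZ.
pose R (a : L) := [set z : X * Y | if d <= deg a then Q a z.1 z.2 else z = (0, 0)].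
pose T : set (X * Y) := [set z | forall a, R a (pr a z.1, pr a z.2)].
have sT : grel T.
  apply: grel_family => [a|a x y x' y'|a b s x y cs cx cy].
  - by rewrite /R /=; case: ifP => // h; apply: Q0.
  - rewrite /R /=; case: ifP => [da|_ [-> ->] [-> ->]]; first exact: QD.
    by rewrite !addr0.
  case: (compS_deg_ge0 cs) => [->|b0].
    by rewrite !scale0r /R /= => _; case: ifP => // h; apply: Q0.
  rewrite /R /= degD; case: ifP => [da|_ [-> ->]].
    by have -> : d <= deg a + deg b by [lia]; apply: QZ.
  by rewrite !scaler0; case: ifP => //; rewrite -degD => h; apply: Q0.
have TQ a x y : d <= deg a -> gm_comp a x -> gm_comp a y -> T (x, y) <-> Q a x y.
  move=> da cx cy; split=> [/(_ a)|Qxy b]; rewrite /R /=.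
    by rewrite da !pr_id.
  rewrite (pr_hom _ cx) (pr_hom _ cy); case: eqP => [->|_]; first by rewrite da.
  by case: ifP => // h; apply: Q0.
have fd : fin_length (rel_dom T) setT.
  apply: (@tail_fin_length _ _ _ _ X _ _ d); [exact: gsub_dom|exact: gsub_setT|by []|].
  by move=> a da x cx _; have [y cy Qxy] := Qtot a da x cx; exists y; apply/(TQ a).
have fi : fin_length [set 0] (rel_ind T).
  apply: (@tail_fin_length _ _ _ _ Y _ _ d); [exact: gsub_set0|exact: gsub_ind| |].
    by move=> _ ->; apply: gr0 sT.
  move=> a da y cy /(TQ a _ _ da (gm_comp0 _ a) cy); exact: Qfun.
have [d' h] := germ_class (Frac sT fd fi).
exists (qclass (Frac sT fd fi)), (Num.max d d') => a.
rewrite ge_max => /andP[da da'] x y; split=> [/(h a da')[cx cy xy]|[cx cy xy]].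
  by split=> //; apply/(TQ a).
by apply/(h a da'); split=> //; apply/(TQ a).
Qed.
End Germs.

(** * Monomorphisms, epimorphisms and short exact sequences *)

Section Category.
Variables (K : closedFieldType) (n : nat) (p : weights n).
Variable l : 'I_n.+1 -> K * K.
Local Notation L := (Lp p).
Local Notation S := (ringS p l).
Local Notation c := (cdeg p).
Local Notation C := (coh p l).
Implicit Types M N X Y Z : grmod p l.

Lemma germ_fun X Y (f : qhom X Y) : exists d : int, forall a, d <= deg a ->
  forall x y y', germ f a x y -> germ f a x y' -> y = y'.
Proof.
have [d h] := germ_tail f; exists d => a da x y y' g1 g2; have [cx _ _] := g1.
by have [y0 [_ u]] := h a da x cx; rewrite (u y g1) (u y' g2).
Qed.

Definition germ_inj X Y (f : qhom X Y) (d : int) :=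
  forall a, d <= deg a -> forall x, germ f a x 0 -> x = 0.
Definition germ_surj X Y (f : qhom X Y) (d : int) :=
  forall a, d <= deg a -> forall y, gm_comp a y -> exists x, germ f a x y.

Lemma soc_iter M a x k : regdeg M <= deg a -> gm_comp a x ->
  (forall s, compS (c *+ k) s -> s *: x = 0) -> x = 0 :> M.
Proof.
elim: k a x => [|k IH] a x da cx h.
  by have := h 1 (compS1 p l); rewrite scale1r.
have dac : regdeg M <= deg (c + a) by rewrite degD; have := deg_c_gt0 p; lia.
have step t : compS c t -> t *: x = 0.
  move=> ct; apply: (IH (c + a)) => // [|s cs]; first exact: gm_compZ.
  by rewrite scalerA; apply: h; rewrite mulrSr; apply: compSM.
have [_ soc _] := regdegP da; apply: soc => //; apply: step.
  exact: compS_u.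
exact: compS_v.
Qed.

(** Free modules play the part of elements in the category of sheaves: they
    test monomorphisms in [monoP]. *)
Lemma hom_free M a (m : M) : gm_comp a m -> exists f : qhom (free_mod l a) M,
  exists d : int, forall b, d <= deg b -> forall (s : free_mod l a) y,
    germ f b s y <-> compS (b - a) (s : S) /\ y = (s : S) *: m.
Proof.
move=> cm.
have cs b s : compS (b - a) (s : S) -> gm_comp b ((s : S) *: m).
  by move=> cs; have := gm_compZ cs cm; rewrite subrK.
have [||||b b' s _ ct x y cx cy ->|f [d h]] := @germ_make _ _ _ _ (free_mod l a) M 0
  (fun b (s : free_mod l a) y => y = (s : S) *: m).
- by move=> b _; rewrite scale0r.
- by move=> b _ s css; exists ((s : S) *: m) => //; apply: cs.
- by move=> b _ y _ ->; rewrite scale0r.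
- by move=> b _ s y s' y' -> ->; rewrite scalerDl.
- by rewrite scalerA.
exists f, d => b db s y; split=> [/(h b db)[css cy e]|[css e]] //.
by apply/(h b db); split=> //; rewrite e; apply: cs.
Qed.

(** An element [x] killed by [f] defines a morphism from a free module whose
    composite with [f] is zero. If [f] is mono then [x] is killed by all
    elements of S of large degree, and it vanishes by [soc_iter]. *)
Lemma monoP X Y (f : qhom X Y) : mono (C := C) f <-> exists d, germ_inj f d.
Proof.
split=> [mf|[d inj] W g h e].
  have [d1 h1] := germ_fun f; exists (Num.max d1 (regdeg X)) => a.
  rewrite ge_max => /andP[a1 ax] x fx; have [cx _ _] := fx.
  have [g [d2 hg]] := hom_free cx.
  have g0 : g = 0.
    apply: (mf (free_mod l a)); apply: germ_ext.
    have [d3 h3] := germ_comp f g; have [d4 h4] := germ_comp f (0 : qhom (free_mod l a) X).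
    have [d5 h5] := germ_zero (free_mod l a) X.
    exists (Num.max d1 (Num.max d2 (Num.max d3 (Num.max d4 d5)))) => b.
    rewrite !ge_max => /and5P[b1 b2 b3 b4 b5] s y y'.
    move=> /(h3 b b3)[x1 [/(hg b b2)[css ->] fy]].
    move=> /(h4 b b4)[x2 [/(h5 b b5)-> fy']].
    have sx0 := germZ css fx; rewrite subrK scaler0 in sx0.
    rewrite (h1 b b1 _ _ _ fy sx0); apply: esym.
    by apply: (h1 b b1 _ _ _ fy' (germ0 f b)).
  have [d3 h3] := germ_zero (free_mod l a) X.
  have [k /(_ k (leqnn k))] := ray_reach a (Num.max d2 d3).
  rewrite ge_max => /andP[k2 k3].
  apply: (@soc_iter X a x k) => // s cs; apply: (h3 _ k3 (s : free_mod l a)).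
  by rewrite -g0; apply/(hg _ k2); rewrite addrC addKr.
apply: germ_ext; have [d1 h1] := germ_comp f g; have [d2 h2] := germ_comp f h.
have [d3 h3] := germ_tail f; have [d4 h4] := germ_fun (qcomp f g).
exists (Num.max d (Num.max d1 (Num.max d2 (Num.max d3 d4)))) => a.
rewrite !ge_max => /and5P[a0 a1 a2 a3 a4] w x x' gx hx'.
have [cw cx _] := gx; have [_ cx' _] := hx'.
have [y [fy _]] := h3 a a3 x cx; have [y' [fy' _]] := h3 a a3 x' cx'.
have e1 : germ (qcomp f g) a w y by apply/(h1 a a1); exists x.
have e2 : germ (qcomp f g) a w y' by rewrite [qcomp f g]e; apply/(h2 a a2); exists x'.
have ey := h4 a a4 w y y' e1 e2; rewrite -{}ey in fy'.
apply/eqP; rewrite -subr_eq0; apply/eqP; apply: (inj a a0).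
have := germL (-1) fy' fy; rewrite cstN cstS1 !scaleN1r addNr.
by rewrite addrC.
Qed.

Definition germ_im X Y (f : qhom X Y) (d : int) : set Y := [set y | forall a,
  if d <= deg a then exists x, germ f a x (pr a y) else pr a y = 0].

Lemma gsub_germ_im X Y (f : qhom X Y) d : gsub (germ_im f d).
Proof.
pose Q (a : L) := [set y : Y | if d <= deg a then exists x, germ f a x y else y = 0].
have Q0 a : Q a 0.
  by rewrite /Q /=; case: ifP => // _; exists 0; apply: germ0.
apply: (gsub_family (Q := Q)) => // [a x y|a b s y cs cy].
  rewrite /Q /=; case: ifP => _ => [[u fu] [v fv]|-> ->]; last exact: addr0.
  by exists (u + v); apply: germD.
case: (compS_deg_ge0 cs) => [->|b0]; first by move=> _; rewrite scale0r.
rewrite {1}/Q /=; case: ifP => [da [u fu]|_ ->]; last by rewrite scaler0.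
rewrite /Q /= degD; have -> : d <= deg a + deg b by lia.
by exists (s *: u); rewrite addrC; apply: germZ.
Qed.

Lemma germ_imP X Y (f : qhom X Y) d a (y : Y) : d <= deg a -> gm_comp a y ->
  germ_im f d y <-> exists x, germ f a x y.
Proof.
move=> da cy; split=> [/(_ a)|h b]; first by rewrite da pr_id.
rewrite (pr_hom _ cy); case: eqP => [->|_]; first by rewrite da.
by case: ifP => // _; exists 0; apply: germ0.
Qed.

Lemma hom_proj M (P : set M) (sP : gsub P) : exists f : qhom M (gquo sP),
  exists d : int, forall a, d <= deg a -> forall x y,
    germ f a x y <-> gm_comp a x /\ y = gproj sP x.
Proof.
have [||||a b s _ cs x y cx cy ->|f [d h]] := @germ_make _ _ _ _ M (gquo sP) 0
  (fun a x y => y = gproj sP x).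
- by move=> a _; rewrite /gproj qpi0.
- by move=> a _ x cx; exists (gproj sP x) => //; exists x.
- by move=> a _ y _ ->; rewrite /gproj qpi0.
- by move=> a _ x y x' y' -> ->; rewrite /gproj qpiD.
- by rewrite /gproj qpiZ.
exists f, d => a da x y; split=> [/(h a da)[cx cy e]|[cx e]] //.
by apply/(h a da); split=> //; rewrite e; exists x.
Qed.

Lemma gproj_eq0 M (P : set M) (sP : gsub P) x : gproj sP x = 0 <-> P x.
Proof.
rewrite -[x in P x]subr0 -(qpiP sP); split=> [h|]; first by rewrite qpi0.
by rewrite qpi0.
Qed.

(** If [f] is epi, it is tested on the quotient by its image in large degrees. *)
Lemma epiP X Y (f : qhom X Y) : epi (C := C) f <-> exists d, germ_surj f d.
Proof.
split=> [ef|[d sur] Z g h e].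
  have [d1 h1] := germ_fun f; pose sP := gsub_germ_im f d1.
  have [g [d2 hg]] := hom_proj sP.
  have g0 : g = 0.
    apply: (ef (gquo sP)); apply: germ_ext.
    have [d3 h3] := germ_comp g f; have [d4 h4] := germ_comp (0 : qhom Y (gquo sP)) f.
    have [d5 h5] := germ_zero Y (gquo sP).
    exists (Num.max d1 (Num.max d2 (Num.max d3 (Num.max d4 d5)))) => a.
    rewrite !ge_max => /and5P[a1 a2 a3 a4 a5] x z z'.
    move=> /(h3 a a3)[y [fy /(hg a a2)[cy ->]]].
    move=> /(h4 a a4)[y' [_ /(h5 a a5)->]].
    by apply/gproj_eq0; apply/(germ_imP f a1 cy); exists x.
  have [d3 h3] := germ_zero Y (gquo sP).
  exists (Num.max d1 (Num.max d2 d3)) => a; rewrite !ge_max => /and3P[a1 a2 a3] y cy.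
  apply/(germ_imP f a1 cy)/(gproj_eq0 sP); apply: (h3 a a3 y).
  by rewrite -g0; apply/(hg a a2).
apply: germ_ext; have [d1 h1] := germ_comp g f; have [d2 h2] := germ_comp h f.
have [d4 h4] := germ_fun (qcomp g f).
exists (Num.max d (Num.max d1 (Num.max d2 d4))) => a.
rewrite !ge_max => /and4P[a0 a1 a2 a4] y z z' gz hz'; have [cy _ _] := gz.
have [x fx] := sur a a0 y cy; apply: (h4 a a4 x); first by apply/(h1 a a1); exists y.
by rewrite [qcomp g f]e; apply/(h2 a a2); exists y.
Qed.

Lemma comp_eqP X Y Z (g : qhom Y Z) (f : qhom X Y) (h : qhom X Z) : qcomp g f = h <->
  exists d : int, forall a, d <= deg a -> forall x y z, germ f a x y ->
    germ g a y z -> germ h a x z.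
Proof.
have [d1 h1] := germ_comp g f; split=> [<-|[d hd]].
  by exists d1 => a da x y z fy gz; apply/(h1 a da); exists y.
have [d2 h2] := germ_fun h; apply: germ_ext.
exists (Num.max d (Num.max d1 d2)) => a; rewrite !ge_max => /and3P[a0 a1 a2].
move=> x z z' /(h1 a a1)[y [fy gz]] hz'.
exact: (h2 a a2 x z z' (hd a a0 x y z fy gz) hz').
Qed.

Lemma comp_eq0P X Y Z (g : qhom Y Z) (f : qhom X Y) : qcomp g f = 0 <->
  exists d : int, forall a, d <= deg a -> forall x y z, germ f a x y ->
    germ g a y z -> z = 0.
Proof.
split=> [/comp_eqP[d h]|[d h]].
  have [d1 h1] := germ_zero X Z; exists (Num.max d d1) => a.
  rewrite !ge_max => /andP[a0 a1] x y z fy gz.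
  exact: (h1 a a1 x z (h a a0 x y z fy gz)).
apply/comp_eqP; have [d1 h1] := germ_zero X Z; have [d2 h2] := germ_tail (0 : qhom X Z).
exists (Num.max d (Num.max d1 d2)) => a; rewrite !ge_max => /and3P[a0 a1 a2] x y z fy gz.
have [cx _ _] := fy; have [z' [z0 _]] := h2 a a2 x cx.
by rewrite (h a a0 x y z fy gz) -(h1 a a1 x z' z0).
Qed.

Lemma kernel_mono X Y N (f : qhom X Y) (k : qhom N X) :
  is_kernel (C := C) f k -> mono (C := C) k.
Proof.
move=> [fk0 uk] W g h e.
have [|m [mk mu]] := uk W (qcomp k g).
  rewrite /= qcompA [qcomp f k]fk0; apply/comp_eq0P.
  have [d h0] := germ_zero N Y; exists d => a da x y z _; exact: h0.
by rewrite -(mu g) // -(mu h).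
Qed.

Lemma cokernel_epi X Y Q (f : qhom X Y) (q : qhom Y Q) :
  is_cokernel (C := C) f q -> epi (C := C) q.
Proof.
move=> [qf0 uq] Z g h e.
have [|m [mq mu]] := uq Z (qcomp g q).
  rewrite /= -qcompA [qcomp q f]qf0; apply/comp_eq0P.
  have [d h0] := germ_zero X Q; have [d1 h1] := germ_fun g.
  exists (Num.max d d1) => a; rewrite ge_max => /andP[a0 a1] x y z /(h0 a a0)-> gz.
  exact: (h1 a a1 0 z 0 gz (germ0 g a)).
by rewrite -(mu g) // -(mu h).
Qed.

(** The cokernel property, tested on the quotient by the image of [i] in large
    degrees, shows that this image contains the kernel of [q]. Conversely the
    factorizations are constructed in large degrees by [germ_make]. *)
Lemma short_exactP X Y Z (i : qhom X Y) (q : qhom Y Z) :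
  short_exact (C := C) i q <-> exists d : int, [/\ germ_inj i d, germ_surj q d
    & forall a, d <= deg a -> forall y, germ q a y 0 <-> exists x, germ i a x y].
Proof.
split=> [[ki cq]|[d [inj sur ex]]].
  have /monoP[d1 inj] := kernel_mono ki; have /epiP[d2 sur] := cokernel_epi cq.
  have [/comp_eq0P[d3 h3] _] := ki; have [_ uq] := cq.
  have [d4 h4] := germ_fun i; have [d5 h5] := germ_tail q.
  pose sP := gsub_germ_im i d4; have [r [d6 h6]] := hom_proj sP.
  have [|h [/comp_eqP[d7 h7] _]] := uq (gquo sP) r.
    apply/comp_eq0P; exists (Num.max d4 d6) => a; rewrite ge_max => /andP[a4 a6] x y z iy.
    move=> /(h6 a a6)[cy ->]; apply/gproj_eq0; apply/(germ_imP i a4 cy).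
    by exists x.
  exists (Num.max (Num.max d1 d2) (Num.max (Num.max d3 d4) (Num.max (Num.max d5 d6) d7))); split.
  - by move=> a; rewrite !ge_max => /andP[/andP[a1 _] _]; apply: inj.
  - by move=> a; rewrite !ge_max => /andP[/andP[_ a2] _]; apply: sur.
  move=> a; rewrite !ge_max => /andP[_ /andP[/andP[a3 a4] /andP[/andP[a5 a6] a7]]] y.
  split=> [qy|[x iy]].
    have [cy _ _] := qy; apply/(germ_imP i a4 cy)/(gproj_eq0 sP).
    by have /(h6 a a6)[_ <-] := h7 a a7 y 0 0 qy (germ0 h a).
  have [_ cy _] := iy; have [z [qz _]] := h5 a a5 y cy.
  by rewrite -(h3 a a3 x y z iy qz).
have [d1 h1] := germ_fun i; have [d2 h2] := germ_fun q.
have mi : mono (C := C) i by apply/monoP; exists d.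
have eq : epi (C := C) q by apply/epiP; exists d.
have qi0 : qcomp q i = 0.
  apply/comp_eq0P; exists (Num.max d d2) => a; rewrite ge_max => /andP[a0 a2] x y z iy qz.
  by apply: (h2 a a2 y) qz _; apply/(ex a a0); exists x.
split; (split=> // W g /comp_eq0P[d3 h3]).
  have [d4 h4] := germ_tail g; have [d5 h5] := germ_tail q.
  pose D := Num.max (Num.max d (Num.max d1 d2)) (Num.max d3 (Num.max d4 d5)).
  have DP (a : L) : D <= deg a -> [/\ d <= deg a, d1 <= deg a, d3 <= deg a & d4 <= deg a /\ d5 <= deg a].
    by rewrite !ge_max => /andP[/and3P[? ? ?] /and3P[? ? ?]].
  have [||||a b s aD cs w x cw cx [y [gy iy]]|h [d6 h6]] := @germ_make _ _ _ _ W X D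
    (fun a w x => exists y, germ g a w y /\ germ i a x y).
  - by move=> a _; exists 0; split; apply: germ0.
  - move=> a /DP[a0 a1 a3 [a4 a5]] w cw; have [y [gy _]] := h4 a a4 w cw.
    have [_ cy _] := gy; have [z [qz _]] := h5 a a5 y cy.
    have [|x ix] := (ex a a0 y).1; first by rewrite -(h3 a a3 w y z gy qz).
    by have [cx _ _] := ix; exists x => //; exists y.
  - move=> a /DP[a0 a1 a3 [a4 a5]] x cx [y [gy iy]].
    have [y' [_ u]] := h4 a a4 0 (gm_comp0 _ a); apply: (inj a a0).
    by rewrite [0](u 0 (germ0 g a)) -(u y gy).
  - move=> a _ w x w' x' [y [gy iy]] [y' [gy' iy']]; exists (y + y').
    by split; apply: germD.
  - by exists (s *: y); split; rewrite addrC; apply: germZ.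
  have ih : qcomp i h = g.
    apply/comp_eqP; exists (Num.max d1 d6) => a; rewrite ge_max => /andP[a1 a6] w x y.
    move=> /(h6 a a6)[_ _ [y' [gy' iy']]] iy.
    by rewrite (h1 a a1 x y y' iy iy').
  by exists h; split=> // h' ih'; apply: mi; rewrite ih'; exact: ih.
have [d4 h4] := germ_tail g.
pose D := Num.max d (Num.max d3 d4).
have DP (a : L) : D <= deg a -> [/\ d <= deg a, d3 <= deg a & d4 <= deg a].
  by rewrite !ge_max => /and3P[? ? ?].
have [||||a b s aD cs z w cz cw [y [qy gy]]|h [d6 h6]] := @germ_make _ _ _ _ Z W D
  (fun a z w => exists y, germ q a y z /\ germ g a y w).
- by move=> a _; exists 0; split; apply: germ0.
- move=> a /DP[a0 a3 a4] z cz; have [y qy] := sur a a0 z cz.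
  have [cy _ _] := qy; have [w [gw _]] := h4 a a4 y cy.
  by have [_ cw _] := gw; exists w => //; exists y.
- move=> a /DP[a0 a3 a4] w cw [y [qy gy]].
  by have [x ix] := (ex a a0 y).1 qy; apply: (h3 a a3 x y).
- move=> a _ w x w' x' [y [gy iy]] [y' [gy' iy']]; exists (y + y').
  by split; apply: germD.
- by exists (s *: y); split; rewrite addrC; apply: germZ.
have hq : qcomp h q = g.
  apply/comp_eqP; exists (Num.max (Num.max d d3) (Num.max d4 d6)) => a.
  rewrite !ge_max => /andP[/andP[a0 a3] /andP[a4 a6]] y z w qz.
  move=> /(h6 a a6)[_ _ [y' [qy' gy']]]; have [cy _ _] := qz.
  have [w' [gw' _]] := h4 a a4 y cy.
  have [|x ix] := (ex a a0 (y - y')).1.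
    by have := germL (-1) qy' qz; rewrite cstN cstS1 !scaleN1r addNr addrC.
  have gd := germL (-1) gy' gw'; rewrite cstN cstS1 !scaleN1r [- y' + y]addrC in gd.
  have /eqP := h3 a a3 x _ _ ix gd; rewrite addrC subr_eq0 => /eqP e.
  by rewrite -e.
by exists h; split=> // h' hq'; apply: eq; rewrite hq'; exact: hq.
Qed.
End Category.

(** * Classes in the Grothendieck group *)

Section K0Group.
Variables (K : fieldType) (C : lincat K).

Lemma K0_idem (a : K0_term C) : K0_eq a (K0_add a a) -> K0_eq a (K0_zero C).
Proof.
move=> h; apply: K0_trans (K0_addN a).
apply: K0_trans (K0_addm (K0_refl (K0_opp a)) (K0_sym h)).
apply: K0_trans (K0_sym (K0_addA _ _ _)).
apply: K0_trans (K0_addm (K0_sym (K0_addN a)) (K0_refl a)).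
exact: K0_sym (K0_add0 a).
Qed.

Lemma K0_addr0 (a b : K0_term C) : K0_eq b (K0_zero C) -> K0_eq (K0_add a b) a.
Proof.
move=> h; apply: K0_trans (K0_addm (K0_refl a) h) _.
exact: K0_trans (K0_addC _ _) (K0_add0 a).
Qed.

Lemma dim_typeP (X Y : C) : dim_type X = dim_type Y <-> K0_eq (K0_of X) (K0_of Y).
Proof.
split=> [e|e].
  have := congr1 (fun r : K0 C => K0_class r (K0_of Y)) e => /= ->.
  exact: K0_refl.
have e1 : K0_eq (K0_of X) = K0_eq (K0_of Y).
  apply/funext => t; apply/propext; split; last exact: K0_trans.
  by apply: K0_trans; apply: K0_sym.
rewrite /dim_type; move: (ex_intro _ (K0_of X) _) (ex_intro _ (K0_of Y) _) => h1 h2.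
by case: _ / e1 h2 => h2; congr K0Class; apply: Prop_irrelevance.
Qed.

(** The subgroup of the Grothendieck group generated by a family of objects
    that is indexed by a small type [T], as an abelian group. *)
Variables (T : Type) (o : T -> C).

Inductive sterm : Type :=
  | Sgen of T | Szero | Sadd of sterm & sterm | Sopp of sterm.

Fixpoint seval (s : sterm) : K0_term C :=
  match s with
  | Sgen t => K0_of (o t)
  | Szero => K0_zero C
  | Sadd s t => K0_add (seval s) (seval t)
  | Sopp s => K0_opp (seval s)
  end.

HB.instance Definition _ := gen_eqMixin sterm.
HB.instance Definition _ := gen_choiceMixin sterm.

Definition seqv : rel sterm := fun s t => `[< K0_eq (seval s) (seval t) >].

Lemma seqv_equiv : equiv_class_of seqv.
Proof.
split=> [s|s t|t s u].
- by apply/asboolP; apply: K0_refl.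
- by apply/asboolP/asboolP; apply: K0_sym.
- by move=> /asboolP h1 /asboolP h2; apply/asboolP; apply: K0_trans h2.
Qed.

Canonical seqv_equiv_rel := EquivRelPack seqv_equiv.
Canonical seqv_encModRel := defaultEncModRel seqv.

Definition k0 := {eq_quot seqv}.
HB.instance Definition _ := EqQuotient.on k0.
HB.instance Definition _ := Choice.on k0.

Definition k0_class (s : sterm) : k0 := \pi_k0 s.

Lemma k0_classP s t : k0_class s = k0_class t <-> K0_eq (seval s) (seval t).
Proof.
split=> [/eqP|h]; last by apply/eqP; rewrite /k0_class piE; apply/asboolP.
by rewrite /k0_class piE => /asboolP.
Qed.

Lemma k0_surj (x : k0) : exists s, k0_class s = x.
Proof. by exists (repr x); exact: reprK. Qed.

Lemma repr_k0_class s : K0_eq (seval (repr (k0_class s))) (seval s).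
Proof. by apply/k0_classP; exact: reprK. Qed.

Definition k0_add (x y : k0) := k0_class (Sadd (repr x) (repr y)).
Definition k0_opp (x : k0) := k0_class (Sopp (repr x)).
Definition k0_zero := k0_class Szero.

Lemma k0_addE s t : k0_add (k0_class s) (k0_class t) = k0_class (Sadd s t).
Proof. by apply/k0_classP; apply: K0_addm; apply: repr_k0_class. Qed.
Lemma k0_oppE s : k0_opp (k0_class s) = k0_class (Sopp s).
Proof. by apply/k0_classP; apply: K0_oppm; apply: repr_k0_class. Qed.

Lemma k0_addA : associative k0_add.
Proof.
move=> x y z; have [s <-] := k0_surj x; have [t <-] := k0_surj y.
have [u <-] := k0_surj z.
by rewrite !k0_addE; apply/k0_classP; apply: K0_addA.
Qed.
Lemma k0_addC : commutative k0_add.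
Proof.
move=> x y; have [s <-] := k0_surj x; have [t <-] := k0_surj y.
by rewrite !k0_addE; apply/k0_classP; apply: K0_addC.
Qed.
Lemma k0_add0 : left_id k0_zero k0_add.
Proof.
by move=> x; have [s <-] := k0_surj x; rewrite k0_addE; apply/k0_classP/K0_add0.
Qed.
Lemma k0_addN : left_inverse k0_zero k0_opp k0_add.
Proof.
move=> x; have [s <-] := k0_surj x.
by rewrite k0_oppE k0_addE; apply/k0_classP/K0_addN.
Qed.

HB.instance Definition _ :=
  GRing.isZmodule.Build k0 k0_addA k0_addC k0_add0 k0_addN.

Definition k0_gen (t : T) : k0 := k0_class (Sgen t).

Definition k0_rep (s : K0_term C) (x : k0) := K0_eq s (seval (repr x)).

Lemma k0_rep_eq s t x : k0_rep s x -> k0_rep t x -> K0_eq s t.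
Proof. by move=> h h'; apply: K0_trans h (K0_sym h'). Qed.

Lemma k0_rep_inj s x y : k0_rep s x -> k0_rep s y -> x = y.
Proof.
move=> h h'; rewrite -[x]reprK -[y]reprK; apply/k0_classP.
exact: K0_trans (K0_sym h) h'.
Qed.

Lemma k0_rep_gen t : k0_rep (K0_of (o t)) (k0_gen t).
Proof. exact: K0_sym (repr_k0_class (Sgen t)). Qed.

Lemma k0_rep0 : k0_rep (K0_zero C) 0.
Proof. exact: K0_sym (repr_k0_class Szero). Qed.

Lemma k0_repD s t x y : k0_rep s x -> k0_rep t y -> k0_rep (K0_add s t) (x + y).
Proof.
move=> h h'; apply: K0_trans (K0_addm h h') (K0_sym _).
exact: (repr_k0_class (Sadd _ _)).
Qed.

Lemma k0_rep_trans s t x : K0_eq s t -> k0_rep t x -> k0_rep s x.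
Proof. exact: K0_trans. Qed.

Lemma k0_repN s x : k0_rep s x -> k0_rep (K0_opp s) (- x).
Proof.
move=> h; apply: K0_trans (K0_oppm h) (K0_sym _).
exact: (repr_k0_class (Sopp _)).
Qed.

Lemma k0_rep_ses (X Y Z : C) (i : hom X Y) (q : hom Y Z) x z : short_exact i q ->
  k0_rep (K0_of X) x -> k0_rep (K0_of Z) z -> k0_rep (K0_of Y) (x + z).
Proof. by move=> h hx hz; apply: k0_rep_trans (K0_ses h) _; apply: k0_repD. Qed.

Lemma k0_rep_coker (X Y Z : C) (i : hom X Y) (q : hom Y Z) x y : short_exact i q ->
  k0_rep (K0_of X) x -> k0_rep (K0_of Y) y -> k0_rep (K0_of Z) (y - x).
Proof.
move=> h hx hy; have := k0_repD (k0_repN hx) hy; rewrite addrC.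
apply: k0_rep_trans; apply: K0_sym.
apply: K0_trans (K0_addm (K0_refl _) (K0_ses h)) _.
apply: K0_trans (K0_addA _ _ _) _.
exact: K0_trans (K0_addm (K0_addN _) (K0_refl _)) (K0_add0 _).
Qed.
End K0Group.

(** * Images *)

Section Images.
Variables (K : closedFieldType) (n : nat) (p : weights n).
Variable l : 'I_n.+1 -> K * K.
Local Notation L := (Lp p).
Local Notation C := (coh p l).
Implicit Types M N X Y Z I J : grmod p l.

Definition germ_ker X Y (f : qhom X Y) (d : int) : set X := [set x | forall a b s,
  compS b s -> d <= deg (b + a) -> germ f (b + a) (s *: pr a x) 0].

Lemma gsub_germ_ker X Y (f : qhom X Y) d : gsub (germ_ker f d).
Proof.
apply: (gsub_family (Q := fun a => [set x : X | forall b s, compS b s ->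
  d <= deg (b + a) -> germ f (b + a) (s *: x) 0])) => [a b s cs h|a x y hx hy b s cs h|].
- by rewrite scaler0; apply: germ0.
- by have := germD (hx b s cs h) (hy b s cs h); rewrite scalerDr addr0.
move=> a b s x cs cx hx e t ct h; rewrite scalerA [a + b]addrC addrA.
by apply: hx; [apply: compSM|rewrite -addrA [b + a]addrC].
Qed.

Lemma germ_kerP X Y (f : qhom X Y) d a (x : X) : d <= deg a -> gm_comp a x ->
  germ_ker f d x <-> germ f a x 0.
Proof.
move=> da cx; split=> [/(_ a 0 1 (compS1 p l))|fx b e s cs h].
  by rewrite add0r scale1r (pr_id cx) => /(_ da).
rewrite (pr_hom _ cx); case: eqP => [->|_]; last by rewrite scaler0; apply: germ0.
by have := germZ cs fx; rewrite scaler0.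
Qed.

(** The image of [f] is represented by the quotient of its source by the
    kernel of [f] in large degrees. *)
Lemma image_ex X Y (f : qhom X Y) : exists I, exists i : qhom I Y,
  is_image (C := C) f i /\ exists d : int, germ_inj i d /\
    forall a, d <= deg a -> forall y, (exists z, germ i a z y) <-> (exists x, germ f a x y).
Proof.
have [d1 h1] := germ_fun f; have [d2 h2] := germ_tail f.
have [d0 d01] : exists d0 : int, forall a : L, d0 <= deg a -> d1 <= deg a /\ d2 <= deg a.
  by exists (Num.max d1 d2) => a; rewrite ge_max => /andP.
pose sP := gsub_germ_ker f d0; pose I := gquo sP.
have [q [d3 h3]] := hom_proj sP.
have projE a x x' : d0 <= deg a -> gm_comp a x -> gm_comp a x' ->
    gproj sP x = gproj sP x' -> germ f a (x - x') 0.
  by move=> da cx cx' /qpiP h; apply/(germ_kerP f da (gm_compB cx cx')).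
have [||||a b s ad cs z y cz cy [x [cx ez fx]]|i [d4 h4]] := @germ_make _ _ _ _ I Y d0
  (fun a (z : I) y => exists x, [/\ gm_comp a x, z = gproj sP x & germ f a x y]).
- by move=> a _; exists 0; split; [apply: gm_comp0|rewrite /gproj qpi0|apply: germ0].
- move=> a /d01[a1 a2] _ [x cx <-]; have [y [fx _]] := h2 a a2 x cx.
  by have [_ cy _] := fx; exists y => //; exists x.
- move=> a da y cy [x [cx ez fx]]; have [a1 a2] := d01 a da.
  have fx0 := projE a x 0 da cx (gm_comp0 _ a); rewrite subr0 in fx0.
  by apply: (h1 a a1 x) => //; apply: fx0; rewrite -ez /gproj qpi0.
- move=> a _ z y z' y' [x [cx -> fx]] [x' [cx' -> fx']]; exists (x + x').
  by split; [apply: gm_compD|rewrite /gproj qpiD|apply: germD].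
- exists (s *: x); rewrite addrC; split; [exact: gm_compZ| |exact: germZ].
  by rewrite ez /gproj qpiZ.
have inj : germ_inj i (Num.max d0 d4).
  move=> a; rewrite ge_max => /andP[a0 a4] z /(h4 a a4)[cz _ [x [cx -> fx]]].
  by apply/gproj_eq0; apply/(germ_kerP f a0 cx).
exists I, i; split; last first.
  exists (Num.max d0 d4); split=> // a; rewrite ge_max => /andP[a0 a4] y.
  split=> [[z /(h4 a a4)[_ _ [x [_ _ fx]]]]|[x fx]]; first by exists x.
  have [cx cy _] := fx; exists (gproj sP x); apply/(h4 a a4).
  by split=> //; [exists x|exists x].
split; first by apply/monoP; exists (Num.max d0 d4).
  exists q; apply: esym; apply/comp_eqP.
  exists (Num.max d0 (Num.max d3 d4)) => a; rewrite !ge_max => /and3P[a0 a3 a4] x z y.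
  move=> /(h3 a a3)[cx ->] /(h4 a a4)[_ cy [x' [cx' ez fx']]].
  by have := germD (projE a x x' a0 cx cx' ez) fx'; rewrite subrK add0r.
move=> J j /monoP[d5 jinj] [e /esym/comp_eqP[d6 h6]].
have [d7 h7] := germ_tail e; have [d8 h8] := germ_tail j.
pose D := Num.max (Num.max d0 d5) (Num.max (Num.max d6 d7) d8).
have DP (a : L) : D <= deg a -> [/\ d0 <= deg a, d5 <= deg a, d6 <= deg a, d7 <= deg a & d8 <= deg a].
  by rewrite !ge_max => /andP[/andP[? ?] /andP[/andP[? ?] ?]].
have [||||a b s ad cs z y cz cy [x [cx ez fx]]|h [d9 h9]] := @germ_make _ _ _ _ I J D
  (fun a (z : I) w => exists x, [/\ gm_comp a x, z = gproj sP x & germ e a x w]).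
- by move=> a _; exists 0; split; [apply: gm_comp0|rewrite /gproj qpi0|apply: germ0].
- move=> a /DP[a0 a5 a6 a7 a8] _ [x cx <-]; have [w [ex _]] := h7 a a7 x cx.
  by have [_ cw _] := ex; exists w => //; exists x.
- move=> a /DP[a0 a5 a6 a7 a8] w cw [x [cx ez ex]].
  have fx0 := projE a x 0 a0 cx (gm_comp0 _ a); rewrite subr0 in fx0.
  have [y [jw _]] := h8 a a8 w cw; have [a1 _] := d01 a a0.
  apply: (jinj a a5); suff <- : y = 0 by [].
  apply: (h1 a a1 x _ _ (h6 a a6 x w y ex jw)); apply: fx0.
  by rewrite -ez /gproj qpi0.
- move=> a _ z y z' y' [x [cx -> fx]] [x' [cx' -> fx']]; exists (x + x').
  by split; [apply: gm_compD|rewrite /gproj qpiD|apply: germD].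
- exists (s *: x); rewrite addrC; split; [exact: gm_compZ| |exact: germZ].
  by rewrite ez /gproj qpiZ.
exists h; apply: esym; apply/comp_eqP; exists (Num.max (Num.max d4 d6) d9) => a.
rewrite !ge_max => /andP[/andP[a4 a6] a9] z w y.
move=> /(h9 a a9)[cz _ [x [cx ez ex]]] jw; apply/(h4 a a4).
have fy := h6 a a6 x w y ex jw; have [_ cy _] := fy.
by split=> //; exists x.
Qed.

Lemma image_iso X Y I I' (f : qhom X Y) (i : qhom I Y) (i' : qhom I' Y) :
  is_image (C := C) f i -> is_image (C := C) f i' ->
  exists h : qhom I I', mono (C := C) h /\ epi (C := C) h.
Proof.
move=> [mi ei ui] [mi' ei' ui'].
have [h eh] := ui I' i' mi' ei'; have [h' eh'] := ui' I i mi ei.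
have hh' : qcomp h h' = qid I'.
  by apply: mi'; rewrite /= qcompA -[qcomp i' h]eh -[LHS]eh' -[LHS](qcompm1 i').
have h'h : qcomp h' h = qid I.
  by apply: mi; rewrite /= qcompA -[qcomp i h']eh' -[LHS]eh -[LHS](qcompm1 i).
exists h; split=> [W g g' e|W g g' e].
  rewrite -[g]qcomp1m -[g']qcomp1m -h'h -!qcompA.
  by congr (qcomp h' _).
rewrite -[g]qcompm1 -[g']qcompm1 -hh' !qcompA.
by congr (qcomp _ h').
Qed.

Definition zero_obj : grmod p l := gquo (@gsub_setT K n p l (free_mod l 0)).

Lemma zero_objE (z : zero_obj) : z = 0.
Proof. by have [x <-] := qpi_surj z; apply/gproj_eq0. Qed.

Lemma iso_exact X Y (h : qhom X Y) : mono (C := C) h -> epi (C := C) h ->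
  short_exact (C := C) h (0 : qhom Y zero_obj).
Proof.
move=> /monoP[d1 h1] /epiP[d2 h2]; apply/short_exactP.
have [d3 h3] := germ_tail (0 : qhom Y zero_obj).
exists (Num.max d1 (Num.max d2 d3)); split=> a; rewrite !ge_max => /and3P[a1 a2 a3].
- exact: h1.
- by move=> y _; exists 0; rewrite [y]zero_objE; apply: germ0.
move=> y; split=> [[cy _ _]|[x [_ cy _]]]; first exact: h2.
by have [z [g0 _]] := h3 a a3 y cy; rewrite -(zero_objE z).
Qed.

Lemma K0_zero_obj : K0_eq (K0_of (zero_obj : C)) (K0_zero C).
Proof.
have mono_id : mono (C := C) (qid zero_obj).
  by move=> W g h /=; rewrite !qcomp1m.
have epi_id : epi (C := C) (qid zero_obj).
  by move=> W g h /=; rewrite !qcompm1.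
exact: K0_idem (K0_ses (iso_exact mono_id epi_id)).
Qed.

Lemma K0_iso X Y (h : qhom X Y) : mono (C := C) h -> epi (C := C) h ->
  K0_eq (K0_of (Y : C)) (K0_of (X : C)).
Proof.
move=> mh eh; apply: K0_trans (K0_ses (iso_exact mh eh)) _.
exact: K0_addr0 K0_zero_obj.
Qed.

Lemma rank_unique X Y (f : qhom X Y) r r' :
  has_rank (C := C) f r -> has_rank (C := C) f r' -> r = r'.
Proof.
move=> [I [i [fi <-]]] [I' [i' [fi' <-]]]; apply/dim_typeP.
by have [h [mh eh]] := image_iso fi fi'; apply: K0_sym (K0_iso mh eh).
Qed.
End Images.

(** * The matrices of a morphism *)

Section Saturation.
Variables (K : closedFieldType) (n : nat) (p : weights n).
Variable l : 'I_n.+1 -> K * K.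
Local Notation L := (Lp p).
Local Notation cst := (cstS p l).
Local Notation c := (cdeg p).
Local Notation U := (uS p l).
Local Notation V := (vS p l).
Local Notation C := (coh p l).
Implicit Types M N X Y Z I J : grmod p l.

(** Descent of the graph of [f] from degree [a + e c] to degree [a]: by
    exactness of the Koszul complex of Y the resulting graph is that of a map
    as soon as [a] is beyond [regdeg Y], a bound that does not depend on [f]. *)
Fixpoint sgermn e X Y (f : qhom X Y) (a : L) (x : X) (y : Y) : Prop :=
  if e is j.+1 then [/\ gm_comp a x, gm_comp a y,
    sgermn j f (c + a) (U *: x) (U *: y) & sgermn j f (c + a) (V *: x) (V *: y)]
  else germ f a x y.

Lemma sgermn_comp e X Y (f : qhom X Y) a x y : sgermn e f a x y ->
  gm_comp a x /\ gm_comp a y.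
Proof. by case: e => [[]|e []]. Qed.

Lemma sgermnL e X Y (f : qhom X Y) a k x y x' y' : sgermn e f a x y ->
  sgermn e f a x' y' -> sgermn e f a (cst k *: x + x') (cst k *: y + y').
Proof.
elim: e a x y x' y' => [|e IH] a x y x' y'; first exact: germL.
move=> [cx cy ux vx] [cx' cy' ux' vx']; split.
- by apply: gm_compD => //; apply: gm_compC.
- by apply: gm_compD => //; apply: gm_compC.
- by have := IH _ _ _ _ _ ux ux'; rewrite !scalerDr !scalerA [cst k * _]mulrC.
- by have := IH _ _ _ _ _ vx vx'; rewrite !scalerDr !scalerA [cst k * _]mulrC.
Qed.

Lemma sgermnZ e X Y (f : qhom X Y) a b s x y : compS b s -> sgermn e f a x y ->
  sgermn e f (b + a) (s *: x) (s *: y).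
Proof.
move=> cs; elim: e a x y => [|e IH] a x y /=; first exact: germZ.
move=> [cx cy ux vx]; split; try exact: gm_compZ.
  by have := IH _ _ _ ux; rewrite !scalerA [s * _]mulrC addrCA.
by have := IH _ _ _ vx; rewrite !scalerA [s * _]mulrC addrCA.
Qed.

Lemma sgermnS e X Y (f : qhom X Y) a x y : sgermn e f a x y -> sgermn e.+1 f a x y.
Proof.
move=> h; have [cx cy] := sgermn_comp h; split=> //.
  by apply: sgermnZ h; apply: compS_u.
by apply: sgermnZ h; apply: compS_v.
Qed.

Lemma sgermn_le e e' X Y (f : qhom X Y) a x y : (e <= e')%N ->
  sgermn e f a x y -> sgermn e' f a x y.
Proof.
move=> /subnK <- h; elim: (e' - e)%N => // m IH.
by rewrite addSn; apply: sgermnS.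
Qed.

Lemma shift_c (a : L) e : c + a + c *+ e = a + c *+ e.+1.
Proof. by rewrite mulrS addrCA addrA. Qed.

Lemma regdeg_c Y (a : L) : regdeg Y <= deg a -> regdeg Y <= deg (c + a).
Proof. by rewrite degD; have := deg_c_gt0 p; lia. Qed.

Lemma sgermn_fun X Y (f : qhom X Y) : exists d : int, forall e a y,
  regdeg Y <= deg a -> d <= deg (a + c *+ e) -> sgermn e f a 0 y -> y = 0.
Proof.
have [d h] := germ_fun f; exists d; elim=> [|e IH] a y ra da.
  by move=> fy; apply: (h a _ 0) (germ0 f a) => //; rewrite mulr0n addr0 in da.
move=> [_ cy uy vy]; have [_ soc _] := regdegP ra; rewrite !scaler0 in uy vy.
by apply: soc => //; [apply: IH _ _ _ uy|apply: IH _ _ _ vy];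
  rewrite ?shift_c // regdeg_c.
Qed.

(** The images [y] and [z] of [U x] and [V x] satisfy [V y = U z] since both
    are the image of [U V x]; exactness of the Koszul complex gives the image
    of [x]. *)
Lemma sgermn_total X Y (f : qhom X Y) : exists d : int, forall e a x,
  regdeg Y <= deg a -> d <= deg (a + c *+ e) -> gm_comp a x ->
  exists y, sgermn e f a x y.
Proof.
have [d1 h1] := germ_tail f; have [d2 h2] := sgermn_fun f.
exists (Num.max d1 d2); elim=> [|e IH] a x ra.
  rewrite mulr0n addr0 ge_max => /andP[a1 a2] cx.
  by have [y [fy _]] := h1 a a1 x cx; exists y.
move=> da cx; have rca := regdeg_c ra.
have dca : Num.max d1 d2 <= deg (c + a + c *+ e) by rewrite shift_c.
have cu := compS_u p l; have cv := compS_v p l.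
have [y fy] := IH (c + a) (U *: x) rca dca (gm_compZ cu cx).
have [z fz] := IH (c + a) (V *: x) rca dca (gm_compZ cv cx).
have [_ cy] := sgermn_comp fy; have [_ cz] := sgermn_comp fz.
have e1 : V *: y = U *: z.
  have fVy := sgermnZ cv fy; have fUz := sgermnZ cu fz.
  rewrite !scalerA [U * V]mulrC -!scalerA in fUz.
  have := sgermnL (-1) fUz fVy; rewrite cstN cstS1 !scaleN1r !scalerA addNr => h0.
  apply/eqP; rewrite -subr_eq0 addrC; apply/eqP.
  apply: (h2 e (c + (c + a))); [exact: regdeg_c| |exact: h0].
  have : d2 <= deg (c + a + c *+ e) by apply: le_trans dca; rewrite le_max lexx orbT.
  by rewrite !degD; have := deg_c_gt0 p; lia.
have [_ _ kos] := regdegP ra; rewrite addrC in cy cz.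
by have [t [ct ey ez]] := kos y z cy cz e1; exists t; split=> //; rewrite ?ey ?ez.
Qed.

Definition sgerm X Y (f : qhom X Y) a (x : X) (y : Y) := exists e, sgermn e f a x y.

Lemma germ_sgerm X Y (f : qhom X Y) a x y : germ f a x y -> sgerm f a x y.
Proof. by exists 0%N. Qed.

Lemma sgerm_comp X Y (f : qhom X Y) a x y : sgerm f a x y -> gm_comp a x /\ gm_comp a y.
Proof. by move=> [e /sgermn_comp]. Qed.

Lemma sgermL X Y (f : qhom X Y) a k x y x' y' : sgerm f a x y -> sgerm f a x' y' ->
  sgerm f a (cst k *: x + x') (cst k *: y + y').
Proof.
move=> [e h] [e' h']; exists (maxn e e').
by apply: sgermnL; [apply: sgermn_le h|apply: sgermn_le h']; rewrite leq_max leqnn ?orbT.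
Qed.

Lemma sgermZ X Y (f : qhom X Y) a b s x y : compS b s -> sgerm f a x y ->
  sgerm f (b + a) (s *: x) (s *: y).
Proof. by move=> cs [e h]; exists e; apply: sgermnZ. Qed.

Lemma sgerm_fun X Y (f : qhom X Y) a x y y' : regdeg Y <= deg a ->
  sgerm f a x y -> sgerm f a x y' -> y = y'.
Proof.
move=> ra h h'; have [d hd] := sgermn_fun f.
have [e0] := sgermL (-1) h' h; rewrite cstN cstS1 !scaleN1r addNr => h0.
have [k hk] := ray_reach a d.
apply/eqP; rewrite -subr_eq0 addrC; apply/eqP; apply: (hd (maxn e0 k) a _ ra).
  by apply: hk; rewrite leq_max leqnn orbT.
by apply: sgermn_le h0; rewrite leq_max leqnn.
Qed.

Lemma sgerm_total X Y (f : qhom X Y) a x : regdeg Y <= deg a -> gm_comp a x ->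
  exists y, sgerm f a x y.
Proof.
move=> ra cx; have [d hd] := sgermn_total f; have [k hk] := ray_reach a d.
by have [y hy] := hd k a x ra (hk k (leqnn k)) cx; exists y, k.
Qed.

Lemma sgerm_germ X Y (f : qhom X Y) : exists d : int, forall a, d <= deg a ->
  forall x y, sgerm f a x y <-> germ f a x y.
Proof.
have [d h] := germ_tail f; exists (Num.max d (regdeg Y)) => a.
rewrite ge_max => /andP[da ra] x y; split=> [fy|]; last exact: germ_sgerm.
have [cx _] := sgerm_comp fy; have [y' [fy' _]] := h a da x cx.
by rewrite (sgerm_fun ra fy (germ_sgerm fy')).
Qed.

Lemma sgerm_lin X Y k (f g : qhom X Y) a x y z : sgerm f a x y -> sgerm g a x z ->
  sgerm (k *: f + g) a x (cst k *: y + z).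
Proof.
have [d1 h1] := germ_add (k *: f) g; have [d2 h2] := germ_scale k f.
have step e b u v w : Num.max d1 d2 <= deg (b + c *+ e) -> sgermn e f b u v ->
    sgermn e g b u w -> sgermn e (k *: f + g) b u (cst k *: v + w).
  elim: e b u v w => [|e IH] b u v w.
    rewrite mulr0n addr0 ge_max => /andP[b1 b2] fv gw; apply: (h1 b b1) => //.
    exact: (h2 b b2).
  move=> db [cu cv uf vf] [_ cw ug vg]; split=> //.
  - by apply: gm_compD => //; apply: gm_compC.
  - have := IH _ _ _ _ _ uf ug; rewrite scalerDr !scalerA [cst k * _]mulrC.
    by apply; rewrite shift_c.
  - have := IH _ _ _ _ _ vf vg; rewrite scalerDr !scalerA [cst k * _]mulrC.
    by apply; rewrite shift_c.
move=> [e fe] [e' ge']; have [j hj] := ray_reach a (Num.max d1 d2).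
exists (maxn j (maxn e e')); apply: step.
- by apply: hj; rewrite leq_maxl.
- by apply: sgermn_le fe; rewrite !leq_max leqnn orbT.
- by apply: sgermn_le ge'; rewrite !leq_max leqnn !orbT.
Qed.

Definition sev X Y (f : qhom X Y) a (x : X) : Y := xget 0 [set y | sgerm f a x y].

Lemma sevP X Y (f : qhom X Y) a x : regdeg Y <= deg a -> gm_comp a x ->
  sgerm f a x (sev f a x).
Proof. by move=> ra cx; apply: (xgetPex 0 (P := [set y | sgerm f a x y])); apply: sgerm_total. Qed.

Lemma sev_eq X Y (f : qhom X Y) a x y : regdeg Y <= deg a -> sgerm f a x y ->
  sev f a x = y.
Proof.
move=> ra h; have [cx _] := sgerm_comp h.
exact: sgerm_fun ra (sevP f ra cx) h.
Qed.

Definition smat X Y (f : qhom X Y) a : 'Hom('rV[K]_(gdim X a), 'rV[K]_(gdim Y a)) :=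
  hom_of a a (sev f a).

Lemma smatE X Y (f : qhom X Y) a v : regdeg Y <= deg a ->
  vec (smat f a v) = sev f a (vec v).
Proof.
move=> ra; apply: hom_ofE => [k x y cx cy|x cx].
  by apply: sev_eq => //; apply: sgermL; apply: sevP.
by have [] := sgerm_comp (sevP f ra cx).
Qed.

Lemma smatP X Y (f : qhom X Y) a v w : regdeg Y <= deg a ->
  smat f a v = w <-> sgerm f a (vec v) (vec w).
Proof.
move=> ra; split=> [<-|h].
  by rewrite smatE //; apply: sevP => //; apply: vec_comp.
by apply: (@vec_inj _ _ _ _ Y a); rewrite smatE //; apply: sev_eq.
Qed.

Lemma smat_linear X Y (f g : qhom X Y) k a v : regdeg Y <= deg a ->
  smat (k *: f + g) a v = k *: smat f a v + smat g a v.
Proof.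
move=> ra; apply/(smatP _ _ _ ra); rewrite vecL.
by apply: sgerm_lin; apply/(smatP _ _ _ ra).
Qed.

Lemma smat_limg X Y (f : qhom X Y) a w : regdeg Y <= deg a ->
  w \in limg (smat f a) <-> exists x, sgerm f a x (vec w).
Proof.
move=> ra; split=> [/memv_imgP[v _ ->]|[x h]].
  by exists (vec v); apply/(smatP _ _ _ ra).
have [cx _] := sgerm_comp h; rewrite -(vec_co cx) in h.
by apply/memv_imgP; exists (co a x); rewrite ?memvf //; apply/esym/(smatP _ _ _ ra).
Qed.

Lemma smat_ker X Y (f : qhom X Y) a v : regdeg Y <= deg a ->
  v \in lker (smat f a) <-> sgerm f a (vec v) 0.
Proof.
by move=> ra; rewrite memv_ker -(vec0 Y a) -(smatP _ _ _ ra); split=> /eqP.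
Qed.

Definition drank X Y (f : qhom X Y) a : nat := \dim (limg (smat f a)).

Lemma dim_rV d : \dim {: 'rV[K]_d} = d. Proof. by rewrite dimvf /dim /= mul1n. Qed.

Lemma drank_mono X Y (f : qhom X Y) : mono (C := C) f <->
  exists d : int, forall a, d <= deg a -> drank f a = gdim X a.
Proof.
have [d1 h1] := sgerm_germ f.
have ker_dim a := limg_ker_dim (smat f a) fullv.
split=> [/monoP[d inj]|[d h]]; last apply/monoP.
  exists (Num.max d (Num.max d1 (regdeg Y))) => a; rewrite !ge_max => /and3P[a0 a1 ra].
  rewrite /drank -[RHS]dim_rV -ker_dim capfv.
  suff -> : lker (smat f a) = 0%VS by rewrite dimv0.
  apply/eqP; rewrite -subv0; apply/subvP => v /(smat_ker _ _ ra)/(h1 a a1)/(inj a a0).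
  by move/vec_eq0->; rewrite mem0v.
exists (Num.max d (Num.max d1 (regdeg Y))) => a; rewrite !ge_max => /and3P[a0 a1 ra] x fx.
have [cx _ _] := fx; have := h a a0; rewrite /drank -[RHS]dim_rV -ker_dim capfv.
move/eqP; rewrite -{1}[\dim (limg _)]add0n eqn_add2r eq_sym dimv_eq0 => /eqP k0.
have : co a x \in lker (smat f a).
  by apply/(smat_ker _ _ ra); rewrite vec_co //; apply/(h1 a a1).
by rewrite k0 memv0 => /eqP e; rewrite -(vec_co cx) e vec0.
Qed.

Lemma drank_epi X Y (f : qhom X Y) : epi (C := C) f <->
  exists d : int, forall a, d <= deg a -> drank f a = gdim Y a.
Proof.
have [d1 h1] := sgerm_germ f.
split=> [/epiP[d sur]|[d h]]; last apply/epiP.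
  exists (Num.max d (Num.max d1 (regdeg Y))) => a; rewrite !ge_max => /and3P[a0 a1 ra].
  rewrite /drank -[RHS]dim_rV; congr (\dim _); apply/eqP; rewrite eqEsubv subvf /=.
  apply/subvP => w _; apply/(smat_limg _ _ ra).
  have [x fx] := sur a a0 (vec w) (vec_comp w); exists x; exact/(h1 a a1).
exists (Num.max d (Num.max d1 (regdeg Y))) => a; rewrite !ge_max => /and3P[a0 a1 ra] y cy.
have /eqP e : (limg (smat f a) == fullv)%VS by rewrite eqEdim subvf dim_rV /=; have := h a a0; rewrite /drank => ->.
have /(smat_limg _ _ ra)[x] : co a y \in limg (smat f a) by rewrite e memvf.
by rewrite vec_co // => /(h1 a a1) fx; exists x.
Qed.

Lemma drank_image X Y (f : qhom X Y) : exists J (j : qhom J Y), is_image (C := C) f j /\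
    exists d : int, forall a, d <= deg a -> gdim J a = drank f a.
Proof.
have [J [j [fj [d0 [inj im]]]]] := image_ex f.
exists J, j; split=> //; have [mj _ _] := fj; have /drank_mono[d hd] := mj.
have [d1 h1] := sgerm_germ f; have [d2 h2] := sgerm_germ j.
exists (Num.max (Num.max d d0) (Num.max d1 (Num.max d2 (regdeg Y)))) => a.
rewrite !ge_max => /andP[/andP[a0 a3] /and3P[a1 a2 ra]].
rewrite -(hd a a0) /drank; congr (\dim _); apply/vspaceP => w.
apply/idP/idP => /(smat_limg _ _ ra)[x hx]; apply/(smat_limg _ _ ra).
  have [|u fu] := (im a a3 (vec w)).1; first by exists x; apply/(h2 a a2).
  by exists u; apply/(h1 a a1).
have [|u fu] := (im a a3 (vec w)).2; first by exists x; apply/(h1 a a1).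
by exists u; apply/(h2 a a2).
Qed.

Lemma gdim_exact X Y Z (i : qhom X Y) (q : qhom Y Z) : short_exact (C := C) i q ->
  exists d : int, forall a, d <= deg a -> gdim Y a = (gdim X a + gdim Z a)%N.
Proof.
move=> ses; have /short_exactP[d [inj sur ex]] := ses.
have /drank_mono[d1 h1] : mono (C := C) i by apply/monoP; exists d.
have /drank_epi[d2 h2] : epi (C := C) q by apply/epiP; exists d.
have [d3 h3] := sgerm_germ i; have [d4 h4] := sgerm_germ q.
exists (Num.max (Num.max d (Num.max d1 d2)) (Num.max (Num.max d3 d4) (Num.max (regdeg Y) (regdeg Z)))) => a.
rewrite !ge_max => /andP[/and3P[a0 a1 a2] /andP[/andP[a3 a4] /andP[ry rz]]].
rewrite -(h1 a a1) -(h2 a a2) /drank -[LHS]dim_rV -(limg_ker_dim (smat q a) fullv) capfv.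
congr (_ + _)%N; congr (\dim _); apply/vspaceP => w.
apply/idP/idP => [/(smat_ker _ _ rz)/(h4 a a4)/(ex a a0)[x ix]|].
  by apply/(smat_limg _ _ ry); exists x; apply/(h3 a a3).
move=> /(smat_limg _ _ ry)[x /(h3 a a3) ix]; apply/(smat_ker _ _ rz)/(h4 a a4).
by apply/(ex a a0); exists x.
Qed.

Fixpoint hilb (t : K0_term C) (a : L) : int :=
  match t with
  | K0_of X => (gdim (X : grmod p l) a)%:Z
  | K0_zero => 0
  | K0_add s t => hilb s a + hilb t a
  | K0_opp s => - hilb s a
  end.

(** Short exact sequences are exact in each large degree, and so Hilbert
    functions, up to their values in small degrees, are defined on the
    Grothendieck group. *)
Lemma hilb_eq (s t : K0_term C) : K0_eq s t ->
  exists d : int, forall a, d <= deg a -> hilb s a = hilb t a.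
Proof.
elim=> {s t} /=.
- by move=> a; exists 0.
- by move=> a b _ [d h]; exists d => x dx; rewrite h.
- move=> a b e _ [d h] _ [d' h']; exists (Num.max d d') => x.
  by rewrite ge_max => /andP[dx dx']; rewrite h ?h'.
- move=> a a' b b' _ [d h] _ [d' h']; exists (Num.max d d') => x.
  by rewrite ge_max => /andP[dx dx']; rewrite h ?h'.
- by move=> a b _ [d h]; exists d => x dx; rewrite h.
- by move=> a b e; exists 0 => x _; rewrite addrA.
- by move=> a b; exists 0 => x _; rewrite addrC.
- by move=> a; exists 0 => x _; rewrite add0r.
- by move=> a; exists 0 => x _; rewrite addNr.
move=> X Y Z i q /gdim_exact[d h]; exists d => x dx.
by rewrite h // PoszD.
Qed.
End Saturation.

(** * Finitely many degrees suffice *)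

Section TestDegrees.
Variables (K : closedFieldType) (n : nat) (p : weights n).
Variable l : 'I_n.+1 -> K * K.
Local Notation L := (Lp p).
Local Notation c := (cdeg p).
Local Notation U := (uS p l).
Local Notation V := (vS p l).
Implicit Types M N X Y Z I J : grmod p l.

Lemma deg_ray (b : L) k : deg b <= deg (b + c *+ k).
Proof. by rewrite degD degMn deg_c -mulr_natr natz; have := wprod_gt0 p; nia. Qed.

Lemma smat_ray X Y (f : qhom X Y) b s k v : compS c s -> regdeg Y <= deg b ->
  smat f (b + c *+ k.+1) (ray_mul X b s k v) = ray_mul Y b s k (smat f (b + c *+ k) v).
Proof.
move=> cs rb; have rk j : regdeg Y <= deg (b + c *+ j) := le_trans rb (deg_ray b j).
apply/(smatP _ _ _ (rk _)); rewrite !ray_mulE //.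
have e : b + c *+ k.+1 = c + (b + c *+ k) by rewrite mulrS addrCA.
have : sgerm f (c + (b + c *+ k)) (s *: vec v) (s *: vec (smat f (b + c *+ k) v)).
  by apply: sgermZ => //; apply/(smatP _ _ _ (rk _)).
by rewrite -e.
Qed.

Lemma ray_reg M b : regdeg M <= deg b -> forall k,
  [/\ gen_at M (b + c *+ k), soc_at M (b + c *+ k) & kos_at M (b + c *+ k)].
Proof. by move=> rb k; apply: regdegP; apply: le_trans rb (deg_ray b k). Qed.

(** Beyond the regularity degrees X is generated along a ray by its first
    component, and hence so is the image. *)
Lemma limg_smat_gen X Y (f : qhom X Y) b k : regdeg X <= deg b -> regdeg Y <= deg b ->
  limg (smat f (b + c *+ k)) =
  gen (ray_mul Y b U) (ray_mul Y b V) (limg (smat f (b + c *+ 0))) k.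
Proof.
move=> rx ry; have cu := compS_u p l; have cv := compS_v p l.
elim: k => // k IH; apply/vspaceP => w; rewrite [gen _ _ _ _]/= -IH.
apply/idP/idP => [/memv_imgP[x _ ->]|].
  have gX j : gen_at X (b + c *+ j) by case: (ray_reg rx j).
  have [y [z ->]] := ray_gen gX x; rewrite linearD /= !smat_ray //.
  by apply: memv_add; apply: memv_img; apply: memv_img; apply: memvf.
move=> /memv_addP[_ /memv_imgP[_ /memv_imgP[y _ ->] ->]].
move=> [_ /memv_imgP[_ /memv_imgP[z _ ->] ->] ->].
by rewrite -!smat_ray //; apply: memvD; apply: memv_img; apply: memvf.
Qed.

Definition ray_linear (F : L -> nat) (b : L) k0 := exists r, forall k, (k0 <= k)%N ->
  F (b + c *+ k.+1) = (F (b + c *+ k)%R + r)%N.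

Lemma drank_linear X Y b : regdeg X <= deg b -> regdeg Y <= deg b ->
  exists k0, forall f : qhom X Y, ray_linear (drank f) b k0.
Proof.
move=> rx ry; have gY k : gen_at Y (b + c *+ k) by case: (ray_reg ry k).
have sY k : soc_at Y (b + c *+ k) by case: (ray_reg ry k).
have [k0 h] := gen_dim_linear (@ray_mulC _ _ _ _ Y b) (ray_gen gY) (ray_soc sY).
exists k0 => f; have [r hr] := h (limg (smat f (b + c *+ 0))); exists r => k kk.
by rewrite /drank (limg_smat_gen f k.+1 rx ry) (limg_smat_gen f k rx ry) hr.
Qed.

Lemma gdim_linear M b : regdeg M <= deg b -> exists k0, ray_linear (gdim M) b k0.
Proof.
move=> rb; have gM k : gen_at M (b + c *+ k) by case: (ray_reg rb k).
have sM k : soc_at M (b + c *+ k) by case: (ray_reg rb k).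
have [k0 h] := gen_dim_linear (@ray_mulC _ _ _ _ M b) (ray_gen gM) (ray_soc sM).
exists k0; have [r hr] := h fullv; exists r => k kk; have := hr k kk.
by rewrite !(gen_fullv (ray_gen gM)) !dim_rV.
Qed.

Lemma ray_linear_le F b k0 k1 : (k0 <= k1)%N -> ray_linear F b k0 -> ray_linear F b k1.
Proof. by move=> h [r hr]; exists r => k kk; apply: hr; apply: leq_trans kk. Qed.

Lemma ray_linear_agree F G b k0 : ray_linear F b k0 -> ray_linear G b k0 ->
  F (b + c *+ k0) = G (b + c *+ k0) -> F (b + c *+ k0.+1) = G (b + c *+ k0.+1) ->
  forall k, (k0 <= k)%N -> F (b + c *+ k) = G (b + c *+ k).
Proof.
move=> [r hF] [r' hG] e0; rewrite hF // hG // e0 => /addnI rr k /subnK <-.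
elim: (k - k0)%N => // m IH; rewrite addSn hF ?hG ?leq_addl //.
by rewrite IH rr.
Qed.

Lemma ray_linear_down F G b k0 k1 : ray_linear F b k0 -> ray_linear G b k0 ->
  (forall k, (k1 <= k)%N -> F (b + c *+ k) = G (b + c *+ k)) ->
  forall k, (k0 <= k)%N -> F (b + c *+ k) = G (b + c *+ k).
Proof.
move=> [r hF] [r' hG] e1 k kk; pose m := maxn k0 k1.
have rr : r = r'.
  apply: (@addnI (F (b + c *+ m))); rewrite -hF ?leq_maxl // e1 ?leq_max ?leqnn ?orbT //.
    by rewrite hG ?leq_maxl // e1 // leq_maxr.
  by rewrite leqW // leq_maxr.
have [/e1//|lt] := leqP k1 k.
have h j : (j <= k1 - k)%N -> F (b + c *+ (k1 - j)) = G (b + c *+ (k1 - j)).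
  elim: j => [|j IH jk]; first by rewrite subn0 e1.
  have jS : (k1 - j = (k1 - j.+1).+1)%N by lia.
  have := IH (ltnW jk); rewrite jS hF; last by lia.
  by rewrite hG; [rewrite rr; apply: addIn|lia].
by have := h (k1 - k)%N (leqnn _); rewrite subKn // ltnW.
Qed.

(** All the functions concerned are linear along each ray from a step on that
    is common to all morphisms from X to Y; so two degrees on each of finitely
    many rays covering L(p) in large degrees decide. *)
Lemma test_degrees X Y : exists T : seq L, (forall t, t \in T -> regdeg Y <= deg t) /\
  forall F G : L -> nat,
  (F = gdim X \/ F = gdim Y \/ exists f : qhom X Y, F = drank f) ->
  (G = gdim X \/ G = gdim Y \/ exists f : qhom X Y, G = drank f) ->
  (exists d : int, forall a, d <= deg a -> F a = G a) <-> {in T, forall t, F t = G t}.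
Proof.
pose D := Num.max (regdeg X) (regdeg Y).
have ex (r : L) : exists bk : L * nat, [/\ regdeg X <= deg bk.1, regdeg Y <= deg bk.1,
    exists j : nat, bk.1 = r + c *+ j
  & forall F : L -> nat, (F = gdim X \/ F = gdim Y \/ exists f : qhom X Y, F = drank f) ->
    ray_linear F bk.1 bk.2].
  have [j hj] := ray_reach r D; have := hj j (leqnn j); rewrite ge_max => /andP[rx ry].
  have [k1 h1] := drank_linear rx ry; have [k2 h2] := gdim_linear rx.
  have [k3 h3] := gdim_linear ry; pose k := maxn k1 (maxn k2 k3).
  have /andP[l1 /andP[l2 l3]] : (k1 <= k)%N && ((k2 <= k)%N && (k3 <= k)%N).
    by rewrite /k !leq_max !leqnn !orbT.
  exists (r + c *+ j, k); split=> //; first by exists j.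
  move=> F [->|[->|[f ->]]]; [exact: ray_linear_le h2|exact: ray_linear_le h3|].
  exact: ray_linear_le (h1 f).
have /choice[bk hbk] := ex.
pose t0 r := (bk r).1 + c *+ (bk r).2; pose t1 r := (bk r).1 + c *+ (bk r).2.+1.
exists ([seq t0 r | r <- coset_reps p] ++ [seq t1 r | r <- coset_reps p]); split.
  by move=> t; rewrite mem_cat => /orP[] /mapP[r _ ->]; have [_ ry _ _] := hbk r;
    apply: le_trans ry (deg_ray _ _).
move=> F G hF hG; split=> [[d e] t|e].
  rewrite mem_cat => h; have [r hr] : exists r, t = t0 r \/ t = t1 r.
    by case/orP: h => /mapP[r _ ->]; exists r; [left|right].
  have [_ _ _ lin] := hbk r; have [k1 hk1] := ray_reach (bk r).1 d.
  have down := ray_linear_down (lin F hF) (lin G hG) (fun k kk => e _ (hk1 k kk)).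
  by case: hr => ->; apply: down; rewrite ?leqnn.
apply: ray_uniform => a; have [r rr [m ->]] := coset_repsP a.
have [_ _ [j ej] lin] := hbk r.
have agree := ray_linear_agree (lin F hF) (lin G hG).
exists ((bk r).2 + j + `|m|)%N => k kk.
have -> : r + c *~ m + c *+ k = (bk r).1 + c *+ `|(m + k%:Z - j%:Z)%R|%N.
  rewrite ej -!addrA !pmulrn -!mulrzDr; congr (_ + _ *~ _); lia.
apply: agree; last lia.
  by apply: (e (t0 r)); rewrite mem_cat map_f.
by apply: (e (t1 r)); rewrite mem_cat [X in _ || X]map_f ?orbT.
Qed.
End TestDegrees.

(** * Prime elements of S *)

Section Prime.
Variables (K : closedFieldType) (n : nat) (p : weights n).
Variable l : 'I_n.+1 -> K * K.
Local Notation L := (Lp p).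
Local Notation S := (ringS p l).
Local Notation cst := (cstS p l).
Local Notation c := (cdeg p).
Local Notation x_ := (xdeg p).
Local Notation xS := (xS p l).
Local Notation linS := (linS p l).
Local Notation xmon := (xmon p l).

Definition det2 (u v : K * K) := u.1 * v.2 - u.2 * v.1.

(** A homogeneous prime element [pi] of degree [d] dividing the linear form
    [z]: either one of the [X_i], and then [excl] is [{i}], or a linear form
    independent of all [l_i], and then [excl] is empty. The powers of the
    linear form [w], times the reduced monomials in the [X_j] for [j] not in
    [excl], form a basis of S modulo [pi]. *)
Record prime_elt (pi : S) (d : L) (excl : {pred 'I_n.+1}) (z w : K * K) : Prop := PrimeElt {
  pe_comp : compS d pi;
  pe_dvd : exists2 rho, compS (c - d) rho & linS z = rho * pi;
  pe_det : det2 z w != 0;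
  pe_excl : forall q i, i \in excl -> (0 < q i)%N ->
    exists2 t, compS (\sum_j x_ j *+ q j - d) t & xmon q = t * pi;
  pe_indep : forall j, j \notin excl -> det2 z (l j) != 0;
  pe_point : exists u t y, [/\ on_surface p l u t y, evS u t y pi = 0,
    w.1 * u + w.2 * t != 0 & forall j, j \notin excl -> y j != 0]
}.

Lemma xmon_split q j : (0 < q j)%N -> exists2 q', xmon q = xmon q' * xS j
  & \sum_i x_ i *+ q i - x_ j = \sum_i x_ i *+ q' i.
Proof.
move=> qj; pose q' i := if i == j then (q j).-1 else q i; exists q'.
  rewrite [LHS]xmonE [in RHS]xmonE (bigD1 j) //= [in RHS](bigD1 j) //= /q' eqxx.
  rewrite -{1}(prednK qj) exprSr -!mulrA; congr (_ * _); rewrite mulrC.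
  by congr (_ * _); apply: eq_bigr => i /negPf->.
rewrite (bigD1 j) //= [in RHS](bigD1 j) //= /q' eqxx.
rewrite -{1}(prednK qj) mulrSr addrAC addrK; congr (_ + _).
by apply: eq_bigr => i /negPf->.
Qed.

Variables (pi : S) (d : L) (excl : {pred 'I_n.+1}) (z w : K * K).
Hypothesis pe : prime_elt pi d excl z w.

Lemma lin_comb v : exists a, linS v = cst a * linS z + cst (det2 z v / det2 z w) * linS w.
Proof.
have D0 := pe_det pe; exists (det2 v w / det2 z w).
have e1 : v.1 = det2 v w / det2 z w * z.1 + det2 z v / det2 z w * w.1.
  apply: (mulfI D0); rewrite mulrDr !mulrA ![det2 z w * _]mulrC !mulfK //.
  by rewrite /det2; ring.
have e2 : v.2 = det2 v w / det2 z w * z.2 + det2 z v / det2 z w * w.2.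
  apply: (mulfI D0); rewrite mulrDr !mulrA ![det2 z w * _]mulrC !mulfK //.
  by rewrite /det2; ring.
by rewrite [LHS]linSE e1 e2 !cstSD !cstSM !linSE; ring.
Qed.

(** Modulo [z], every linear form is a multiple of [w]. *)
Lemma form_mod k e : is_form (p := p) (l := l) k e -> exists t g,
  compS (c *+ k - c) t /\ e = t * linS z + cst g * linS w ^+ k.
Proof.
pose good k (e : S) := exists t g,
  compS (c *+ k - c) t /\ e = t * linS z + cst g * linS w ^+ k.
have good0 j : good j 0.
  by exists 0, 0; split; [apply: compS0|rewrite cst0 !mul0r addr0].
have goodD j e1 e2 : good j e1 -> good j e2 -> good j (e1 + e2).
  move=> [t [g [ct ->]]] [t' [g' [ct' ->]]]; exists (t + t'), (g + g').
  by split; [apply: compSD|rewrite cstSD; ring].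
have goodZ j a e1 : good j e1 -> good j (cst a * e1).
  move=> [t [g [ct ->]]]; exists (cst a * t), (a * g).
  by split; [apply: compSZ|rewrite cstSM; ring].
have goodM j v e1 : good j e1 -> good j.+1 (linS v * e1).
  move=> [t [g [ct ->]]]; have [a ->] := lin_comb v; set b := _ / _.
  exists (t * (cst a * linS z + cst b * linS w) + cst (g * a) * linS w ^+ j), (b * g).
  split; last by rewrite !cstSM exprS; ring.
  have -> : c *+ j.+1 - c = c *+ j by rewrite mulrSr addrK.
  apply: compSD; last by apply: compSZ; apply: compSX; apply: compS_lin.
  rewrite -{1}(subrK c (c *+ j)); apply: compSM => //.
  by apply: compSD; apply: compSZ; apply: compS_lin.
have goodX a b : good (a + b)%N (uS p l ^+ a * vS p l ^+ b).
  elim: a => [|a IH].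
    rewrite expr0 mul1r add0n; elim: b => [|b IH].
      by exists 0, 1; split; [apply: compS0|rewrite cstS1 mul0r add0r mul1r].
    by rewrite exprS -linS01; apply: goodM; rewrite linS01.
  by rewrite exprS -linS10 -mulrA; apply: goodM; rewrite linS10.
move=> [r _ ->].
suff : good k (\sum_(i < k.+1) cst r`_i * (uS p l ^+ (k - i) * vS p l ^+ i)) by [].
apply: (big_ind (good k)) => // [|i _]; first exact: goodD.
apply: goodZ.
have := goodX (k - i)%N i; rewrite subnK //.
by rewrite -ltnS.
Qed.

Lemma sum_reduced_deg q : (forall i, (q i <= p i)%N) ->
  deg (\sum_i x_ i *+ q i) <= n.+1%:Z * wprod p.
Proof.
move=> rq; rewrite (big_morph _ (@degD n p) (deg0 p)).
have -> : n.+1%:Z * wprod p = \sum_(i < n.+1) (wprod p)%:Z.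
  by rewrite sumr_const card_ord -mulr_natl natz.
apply: ler_sum => i _; rewrite -deg_c -(x_mulp p i) !degMn.
have := deg_x_gt0 p i; have := rq i.
by rewrite -!(mulr_natr (deg _)) !natz; nia.
Qed.

(** The normal form of an element modulo [pi]: a multiple of one basis element,
    as the degree determines [k] and [q]. *)
Lemma prime_mod b s : compS b s -> exists t g k q, [/\ compS (b - d) t,
  s = t * pi + cst g * (linS w ^+ k * xmon q)
  & g != 0 -> [/\ reduced p q, forall i, i \in excl -> q i = 0%N & b = nform p q k%:Z]].
Proof.
have [q [k [rq ->]]] := nform_exists b => /(compS_nform rq).
case: k => [k [e /form_mod[t [g [ct ->]]] ->]|k ->]; last first.
  exists 0, 0, 0%N, q; split; [exact: compS0|by rewrite cst0 !mul0r addr0|].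
  by rewrite eqxx.
have [rho crho ez] := pe_dvd pe.
have cbase : compS (nform p q k%:Z - d) (t * rho * xmon q).
  have -> : nform p q k%:Z - d = c *+ k - c + (c - d) + \sum_i x_ i *+ q i.
    by rewrite /nform -pmulrn addrA subrK [_ + c *+ k]addrC addrAC.
  by apply: compSM; [apply: compSM|apply: compS_xmon].
have [[i ei qi]|no] := EM (exists2 i, i \in excl & (0 < q i)%N).
  have [t' ct' eq] := pe_excl pe ei qi.
  exists (t * rho * xmon q + cst g * (linS w ^+ k * t')), 0, 0%N, q; split.
  - apply: compSD => //; apply: compSZ.
    have -> : nform p q k%:Z - d = c *+ k + (\sum_j x_ j *+ q j - d).
      by rewrite /nform -pmulrn addrAC addrC.
    by apply: compSM => //; apply: compSX; apply: compS_lin.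
  - by rewrite ez eq cst0; ring.
  - by rewrite eqxx.
exists (t * rho * xmon q), g, k, q; split=> //; first by rewrite ez; ring.
move=> _; split=> // i ei; apply/eqP; rewrite -leqn0 leqNgt.
by apply/negP => qi; apply: no; exists i.
Qed.

(** At the point of [pe_point], [pi] vanishes while [X_j] and all basis
    elements of S modulo [pi] do not. *)
Lemma prime_regular b s j t : j \notin excl -> compS b s -> s * xS j = t * pi ->
  exists2 t', compS (b - d) t' & s = t' * pi.
Proof.
move=> je cs e; have [t' [g [k [q [ct' es h]]]]] := prime_mod cs.
exists t' => //; have [g0|g0] := eqVneq g 0; first by rewrite es g0 cst0 mul0r addr0.
have [rq eq _] := h g0; have [u [v [y [sy pi0 w0 y0]]]] := pe_point pe.
have : evS u v y (s * xS j) = 0 by rewrite e evSM // pi0 mulr0.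
rewrite es evSM // evSD // !evSM // pi0 mulr0 add0r evS_cst // evSX // evS_lin //.
rewrite evS_xmon // evS_x // => /eqP; rewrite !mulf_eq0 (negPf g0) (negPf (y0 j je)).
rewrite expf_eq0 (negPf w0) andbF /= orbF => /prodf_eq0[i _].
rewrite expf_eq0; case: (boolP (i \in excl)) => [/eq-> //|/y0/negPf->].
by rewrite andbF.
Qed.

(** Modulo [pi], the form [w] is a multiple of [l_j], which is a power of
    [X_j], and basis elements of large degree contain [w] or [X_j]. *)
Lemma prime_comax j : j \notin excl -> exists D : int, forall b, D <= deg b ->
  forall s : S, compS b s -> exists t t',
    [/\ compS (b - d) t, compS (b - x_ j) t' & s = t * pi + t' * xS j].
Proof.
move=> je; exists (n.+1%:Z * wprod p + 1) => b db s cs.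
have [t [g [k [q [ct es h]]]]] := prime_mod cs.
have [g0|g0] := eqVneq g 0.
  by exists t, 0; split; rewrite ?es ?g0 ?cst0 ?mul0r //; apply: compS0.
have [rq _ eb] := h g0.
have cw i : compS (c *+ i) (linS w ^+ i) by apply: compSX; apply: compS_lin.
have [qj|qj] := ltnP 0 (q j).
  have [q' eq es'] := xmon_split qj.
  exists t, (cst g * (linS w ^+ k * xmon q')); split=> //.
    apply: compSZ; rewrite eb /nform -pmulrn addrAC es' addrC.
    by apply: compSM => //; apply: compS_xmon.
  by rewrite es eq; ring.
have k0 : (0 < k)%N.
  case: k eb {es h} => // eb; move: db; rewrite eb /nform mulr0z addr0.
  have := sum_reduced_deg (fun i => ltnW (rq i)); lia.
have [rho crho ez] := pe_dvd pe; have [a ea] := lin_comb (l j).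
set be := det2 z (l j) / det2 z w in ea.
have be0 : be != 0 by rewrite mulf_neq0 ?invr_eq0 ?(pe_det pe) ?(pe_indep pe).
have ew : linS w = cst be^-1 * (xS j ^+ (p j).-1) * xS j - cst (be^-1 * a) * rho * pi.
  rewrite -mulrA -exprSr prednK ?wt_gt0 // xS_exp ea ez mulrDr !mulrA cstV // mul1r.
  by rewrite cstSM; ring.
pose e' := linS w ^+ k.-1 * xmon q.
have ce' : compS (b - c) e'.
  rewrite eb /nform -pmulrn -addrA -{1}(prednK k0) mulrSr addrK addrC.
  by apply: compSM; [apply: cw|apply: compS_xmon].
exists (t - cst (g * (be^-1 * a)) * (e' * rho)), (cst (g * be^-1) * (e' * xS j ^+ (p j).-1)).
split.
- apply: compSB => //; apply: compSZ.
  by have -> : b - d = b - c + (c - d); [rewrite addrA subrK|apply: compSM].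
- apply: compSZ; have -> : b - x_ j = b - c + x_ j *+ (p j).-1.
    rewrite -(x_mulp p j) -{1}(prednK (wt_gt0 p j)) mulrS opprD -addrA.
    by rewrite -addrA addNr addr0.
  by apply: compSM => //; apply: compSX; apply: compS_x.
have -> : s = t * pi + cst g * (e' * linS w).
  by rewrite es /e' -{1}(prednK k0) exprSr; ring.
by rewrite ew !cstSM; ring.
Qed.

Implicit Type M : grmod p l.

Lemma lin_prod_act M (m : M) vs : linS z *: m = 0 -> all (fun v => det2 z v != 0) vs ->
  exists2 b, b != 0 & (\prod_(v <- vs) linS v) *: m = cst b * linS w ^+ size vs *: m.
Proof.
move=> zm; elim: vs => [_|v vs IH /= /andP[v0 /IH[b b0 e]]].
  by exists 1; rewrite ?oner_eq0 // big_nil cstS1 mul1r.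
have [a ev] := lin_comb v; exists (det2 z v / det2 z w * b).
  by rewrite !mulf_neq0 ?invr_eq0 ?(pe_det pe).
rewrite big_cons -scalerA e scalerA ev.
have -> : (cst a * linS z + cst (det2 z v / det2 z w) * linS w) * (cst b * linS w ^+ size vs) =
  cst a * (cst b * linS w ^+ size vs) * linS z +
  cst (det2 z v / det2 z w * b) * linS w ^+ (size vs).+1 by rewrite cstSM exprS; ring.
by rewrite scalerDl -scalerA zm scaler0 add0r.
Qed.

(** Modulo [pi], the element [s] is a multiple of [w^k] times a monomial in the
    [X_j], [j] not in [excl]. If it is nonzero, it divides a power of [w]
    modulo [pi], as each such [X_j] divides [l_j], a multiple of [w]. So a
    power of [w] kills [m], and all binary forms of that degree do. *)
Lemma prime_ann M (m : M) b s : pi *: m = 0 -> compS b s -> s *: m = 0 ->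
  (exists2 t, compS (b - d) t & s = t * pi) \/
  (exists N, forall r, compS (c *+ N) r -> r *: m = 0).
Proof.
move=> pm cs sm; have [t [g [k [q [ct es h]]]]] := prime_mod cs.
have [g0|g0] := eqVneq g 0.
  by left; exists t; rewrite // es g0 cst0 mul0r addr0.
right; have [rq eq _] := h g0; have [rho crho ez] := pe_dvd pe.
have zm : linS z *: m = 0 by rewrite ez -scalerA pm scaler0.
have m1 : (linS w ^+ k * xmon q) *: m = 0.
  move: sm; rewrite es scalerDl -scalerA pm scaler0 add0r -scalerA => e.
  by rewrite -[_ *: m]scale1r -cstS1 -(mulVf g0) cstSM -scalerA e scaler0.
pose vs := [seq l j | j <- enum (predC excl)].
have vs0 : all (fun v => det2 z v != 0) vs.
  apply/allP => v /mapP[j]; rewrite mem_enum => je ->.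
  exact: (pe_indep pe).
pose y := xmon (fun j => if j \in excl then 0%N else (p j - q j)%N).
have m2 : (linS w ^+ k * \prod_(v <- vs) linS v) *: m = 0.
  have -> : \prod_(v <- vs) linS v = y * xmon q.
    rewrite /y !xmonE -big_split big_map big_enum /= big_mkcond.
    apply: eq_bigr => j _; rewrite inE /= -[excl j]/(j \in excl).
    case: (boolP (j \in excl)) => [/eq->|_] /=; first by rewrite !expr0 mulr1.
    by rewrite -exprD subnK ?xS_exp // ltnW.
  by rewrite mulrCA -scalerA m1 scaler0.
have [be be0 e] := lin_prod_act zm vs0.
rewrite -scalerA e scalerA in m2; pose N := (k + size vs)%N.
have wN : linS w ^+ N *: m = 0.
  have -> : linS w ^+ N = cst be^-1 * (linS w ^+ k * (cst be * linS w ^+ size vs)).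
    transitivity (cst be^-1 * cst be * linS w ^+ N); first by rewrite cstV ?mul1r.
    by rewrite exprD; ring.
  by rewrite -scalerA m2 scaler0.
exists N => r cr.
have r0 : reduced p (fun _ => 0%N) by move=> j; apply: wt_gt0.
have cN : c *+ N = nform p (fun _ => 0%N) N%:Z.
  by rewrite /nform big1 ?add0r // => j _; rewrite mulr0n.
move: cr; rewrite cN => /(compS_nform r0)[f /form_mod[t' [g' [_ ->]]] ->].
rewrite xmonE big1 ?mulr1 => [|j _]; last by rewrite expr0.
by rewrite scalerDl -!scalerA zm wN !scaler0 addr0.
Qed.
End Prime.

(** * The variables and the ordinary points as primes *)

Section PrimeInstances.
Variables (K : closedFieldType) (n : nat) (p : weights n).
Variable l : 'I_n.+1 -> K * K.
Local Notation L := (Lp p).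
Local Notation S := (ringS p l).
Local Notation cst := (cstS p l).
Local Notation c := (cdeg p).
Local Notation x_ := (xdeg p).
Local Notation xS := (xS p l).
Local Notation linS := (linS p l).
Hypothesis l_neq0 : forall i, l i != (0, 0).
Hypothesis l_indep : forall i j, i != j -> det2 (l i) (l j) != 0.

Lemma lin_neq0S z : z != (0, 0) -> linS z != 0.
Proof.
move=> z0; apply: contraNneq z0 => e.
have e0 u t : z.1 * u + z.2 * t = 0.
  have [y sy] := on_surface_exists p l u t.
  by rewrite -(evS_lin sy) e evS0.
have := e0 1 0; have := e0 0 1; rewrite !mulr0 !mulr1 add0r addr0 => e2 e1.
by rewrite [z]surjective_pairing e1 e2.
Qed.

Lemma det2_compl (z : K * K) : z != (0, 0) -> exists w, det2 z w != 0.
Proof.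
case: z => a b; rewrite xpair_eqE negb_and => /orP[a0|b0].
  by exists (0, 1); rewrite /det2 /= mulr1 mulr0 subr0.
by exists (1, 0); rewrite /det2 /= mulr1 mulr0 sub0r oppr_eq0.
Qed.

Lemma lin_point (z w : K * K) : det2 z w != 0 -> exists u t y,
  [/\ on_surface p l u t y, z.1 * u + z.2 * t = 0, w.1 * u + w.2 * t != 0
    & forall j, det2 z (l j) != 0 -> y j != 0].
Proof.
move=> zw; have [y sy] := on_surface_exists p l (- z.2) z.1.
exists (- z.2), z.1, y; split=> //.
- by rewrite mulrN mulrC addNr.
- by apply: contraNneq zw; rewrite /det2 => e; apply/eqP; rewrite -[RHS]e; ring.
move=> j; apply: contraNneq => yj; have := sy j; rewrite yj expr0n gtn_eqF ?wt_gt0 //.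
by rewrite /det2 => e; apply/eqP; rewrite [RHS]e; ring.
Qed.

Lemma prime_x i : exists w, prime_elt (xS i) (x_ i) (fun j => j == i) (l i) w.
Proof.
have [w zw] := det2_compl (l_neq0 i); exists w; split=> //.
- exact: compS_x.
- exists (xS i ^+ (p i).-1); last by rewrite -exprSr prednK ?wt_gt0 // xS_exp.
  rewrite -(x_mulp p i) -{1}(prednK (wt_gt0 p i)) mulrSr addrK.
  by apply: compSX; apply: compS_x.
- move=> q j; rewrite unfold_in => /eqP-> qi; have [q' eq es] := xmon_split p l qi.
  by exists (xmon p l q'); rewrite ?es //; apply: compS_xmon.
- by move=> j; rewrite unfold_in => ji; apply: l_indep; rewrite eq_sym.
have [u [t [y [sy z0 w0 y0]]]] := lin_point zw; exists u, t, y; split=> //.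
  rewrite evS_x //; apply/eqP; have := sy i; rewrite z0 => /eqP.
  by rewrite expf_eq0 => /andP[].
by move=> j; rewrite unfold_in => ji; apply/y0/l_indep; rewrite eq_sym.
Qed.

Lemma prime_lin z : z != (0, 0) -> (forall j, det2 z (l j) != 0) ->
  exists w, prime_elt (linS z) c (fun=> false) z w.
Proof.
move=> z0 zl; have [w zw] := det2_compl z0; exists w; split=> //.
- exact: compS_lin.
- by exists 1; rewrite ?mul1r // subrr; apply: compS1.
have [u [t [y [sy e w0 y0]]]] := lin_point zw; exists u, t, y; split=> //.
  by rewrite evS_lin.
by move=> j _; apply: y0.
Qed.

Definition is_prime (pd : S * L) := exists excl z w, prime_elt pd.1 pd.2 excl z w.

(** A linear form proportional to some [l_i] is a power of [X_i] up to a
    scalar, and the others are prime. *)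
Lemma lin_primes z : z != (0, 0) -> exists (pds : seq (S * L)) a,
  [/\ forall pd, pd \in pds -> is_prime pd, a != 0
    & linS z = cst a * \prod_(pd <- pds) pd.1].
Proof.
move=> z0; have [[i zi]|no] := EM (exists i, det2 z (l i) = 0); last first.
  have [|w pw] := @prime_lin z z0.
    by move=> j; apply/eqP => e; apply: no; exists j.
  exists [:: (linS z, c)], 1; split; rewrite ?oner_eq0 //.
    by move=> pd; rewrite inE => /eqP->; exists (fun=> false), z, w.
  by rewrite big_seq1 cstS1 mul1r.
have [w pw] := prime_x i; have li0 := l_neq0 i; have zw := pe_det pw.
have [v ev] := lin_comb pw z.
have d0 : det2 (l i) z = 0 by rewrite -oppr0 -zi /det2; ring.
rewrite d0 mul0r cst0 mul0r addr0 in ev.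
exists (nseq (p i) (xS i, x_ i)), v; split.
- by move=> pd /nseqP[-> _]; exists (fun j => j == i), (l i), w.
- by apply: contraNneq (lin_neq0S z0) => v0; rewrite ev v0 cst0 mul0r.
by rewrite big_nseq iter_mulr_1 xS_exp.
Qed.

Lemma lin_prod_primes zs : all (fun z => z != (0, 0)) zs ->
  exists (pds : seq (S * L)) a, [/\ forall pd, pd \in pds -> is_prime pd, a != 0
    & \prod_(z <- zs) linS z = cst a * \prod_(pd <- pds) pd.1].
Proof.
elim: zs => [_|z zs IH /= /andP[z0 /IH[pds [a [hp a0 e]]]]].
  by exists [::], 1; split; rewrite ?oner_eq0 // !big_nil cstS1 mul1r.
have [pds' [a' [hp' a'0 e']]] := lin_primes z0.
exists (pds' ++ pds), (a' * a); split; rewrite ?mulf_neq0 //.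
  by move=> pd; rewrite mem_cat => /orP[/hp'|/hp].
by rewrite big_cons big_cat /= e e' cstSM; ring.
Qed.

Lemma ordinary_lin : exists z, z != (0, 0) /\ forall j, det2 z (l j) != 0.
Proof.
have g0 : \prod_i ((l i).1%:P + (l i).2 *: 'X) != 0.
  by apply/prodf_neq0 => i _; apply: lin_neq0.
have [t] := closed_nonrootP _ g0; rewrite /root horner_prod => /prodf_neq0 h.
exists (- t, 1); split=> [|j]; first by rewrite xpair_eqE oner_eq0 andbF.
have := h j isT; rewrite !hornerE; apply: contraNneq; rewrite /det2 /= => e.
by apply/eqP; rewrite -oppr0 -e; ring.
Qed.

Lemma is_prime_comp pd : is_prime pd -> compS pd.2 pd.1.
Proof. by move=> [excl [z [w pe]]]; apply: pe_comp pe. Qed.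

Lemma is_prime_neq0 pd : is_prime pd -> pd.1 != 0.
Proof.
move=> [excl [z [w pe]]]; apply/eqP => e; have [rho _ ez] := pe_dvd pe.
have z0 : z != (0, 0).
  by apply: contraNneq (pe_det pe) => ->; rewrite /det2 /= !mul0r subrr.
by have := lin_neq0S z0; rewrite ez e mulr0 eqxx.
Qed.
End PrimeInstances.

(** * Line bundles generate the Grothendieck group *)

Section Devissage.
Variables (K : closedFieldType) (n : nat) (p : weights n).
Variable l : 'I_n.+1 -> K * K.
Local Notation L := (Lp p).
Local Notation S := (ringS p l).
Local Notation cst := (cstS p l).
Local Notation c := (cdeg p).
Local Notation C := (coh p l).
Implicit Types M X Y Z I J : grmod p l.
Hypothesis l_neq0 : forall i, l i != (0, 0).
Hypothesis l_indep : forall i j, i != j -> det2 (l i) (l j) != 0.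

Definition line (a : L) : C := free_mod l a.
Notation k0 := (k0 line).
Notation u_ a := (k0_gen line a).

Definition rep M (x : k0) := k0_rep (K0_of (M : C)) x.

Lemma rep_ses X Y Z (i : qhom X Y) (q : qhom Y Z) x z :
  (exists d : int, [/\ germ_inj i d, germ_surj q d
    & forall a, d <= deg a -> forall y, germ q a y 0 <-> exists x, germ i a x y]) ->
  rep X x -> rep Z z -> rep Y (x + z).
Proof. by move=> /short_exactP h; apply: k0_rep_ses h. Qed.

Lemma rep_coker X Y Z (i : qhom X Y) (q : qhom Y Z) x y :
  (exists d : int, [/\ germ_inj i d, germ_surj q d
    & forall a, d <= deg a -> forall y, germ q a y 0 <-> exists x, germ i a x y]) ->
  rep X x -> rep Y y -> rep Z (y - x).
Proof. by move=> /short_exactP h; apply: k0_rep_coker h. Qed.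

Lemma rep_iso X Y (h : qhom X Y) d x : germ_inj h d -> germ_surj h d -> rep X x -> rep Y x.
Proof.
move=> hi hs; apply: k0_rep_trans; apply: (K0_iso (h := h)).
  by apply/monoP; exists d.
by apply/epiP; exists d.
Qed.

Lemma rep_zero M (d : int) : (forall b, d <= deg b -> forall x, gm_comp b x -> x = 0 :> M) ->
  rep M 0.
Proof.
move=> h; have rz : rep (zero_obj p l) 0.
  exact: k0_rep_trans (K0_zero_obj p l) (k0_rep0 line).
apply: (@rep_iso _ _ (0 : qhom (zero_obj p l) M) d) rz => b db x.
  by rewrite (zero_objE x).
by move=> cx; exists 0; rewrite (h b db x cx); apply: germ0.
Qed.

Lemma rep_line a : rep (free_mod l a) (u_ a).
Proof. exact: k0_rep_gen line a. Qed.

Definition ann M a (m : M) : set (free_mod l a) := [set s | (s : S) *: m = 0].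
Arguments ann : clear implicits.

Lemma pr_scale M a (m : M) b (s : free_mod l a) : gm_comp a m ->
  pr b ((s : S) *: m) = (pr b s : S) *: m.
Proof.
move=> cm; have [r [ur p0 e]] := pr_ex s.
have -> : (s : S) *: m = \sum_(d <- r) (pr d s : S) *: m.
  by rewrite {1}e -scaler_suml.
rewrite pr_sum; have h d : pr b ((pr d s : S) *: m) = if b == d then (pr d s : S) *: m else 0.
  by apply: pr_hom; have := gm_compZ (pr_comp d s : compS (d - a) (pr d s : S)) cm; rewrite subrK.
have [br|br] := boolP (b \in r); last first.
  rewrite p0 // scale0r big_seq big1 // => d dr; rewrite h.
  by case: eqP dr br => [->->|].
rewrite (bigD1_seq b) //= h eqxx big1 ?addr0 // => d db.
by rewrite h eq_sym (negPf db).
Qed.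

Lemma gsub_ann M a (m : M) : gm_comp a m -> gsub (ann M a m).
Proof.
move=> cm; split=> [|s x y hx hy|r f ur cf h b br]; rewrite /ann /=.
- by rewrite scale0r.
- have -> : ((s *: x + y : free_mod l a) : S) = s * x + y by [].
  by rewrite scalerDl -scalerA hx hy scaler0 addr0.
have /(congr1 (pr b)) := h; rewrite pr0 pr_scale // pr_sum (bigD1_seq b) //=.
rewrite (pr_id (cf b)) big1 ?addr0 // => d db.
by rewrite (pr_hom _ (cf d)) eq_sym (negPf db).
Qed.

Definition gen_sub M a (m : M) : set M := [set x | exists s : free_mod l a, x = (s : S) *: m].
Arguments gen_sub : clear implicits.

Lemma gsub_gen M a (m : M) : gm_comp a m -> gsub (gen_sub M a m).
Proof.
move=> cm; split=> [|s _ _ [x ->] [y ->]|r f ur cf [s es] b br].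
- by exists 0; rewrite scale0r.
- by exists (s * (x : S) + y); rewrite scalerDl scalerA.
exists (pr b s); rewrite -pr_scale // -es pr_sum (bigD1_seq b) //=.
rewrite (pr_id (cf b)) big1 ?addr0 // => d db.
by rewrite (pr_hom _ (cf d)) eq_sym (negPf db).
Qed.

(** [S m], as a quotient of a line bundle. *)
Definition cyc M a (m : M) (cm : gm_comp a m) := gquo (gsub_ann cm).
Definition coker M a (m : M) (cm : gm_comp a m) := gquo (gsub_gen cm).

Lemma rep_cyc M a (m : M) (cm : gm_comp a m) x y :
  rep (cyc cm) x -> rep (coker cm) y -> rep M (x + y).
Proof.
have cs b (s : free_mod l a) : gm_comp b s -> gm_comp b ((s : S) *: m).
  by move=> h; have := gm_compZ (h : compS (b - a) (s : S)) cm; rewrite subrK.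
have eq0 (s : free_mod l a) : gproj (gsub_ann cm) s = 0 <-> (s : S) *: m = 0.
  exact: gproj_eq0.
have [q [d1 h1]] := hom_proj (gsub_gen cm).
have [||||b b' s _ ct z z' cz cz' [t [ct' ez ez']]|i [d h]] := @germ_make _ _ _ _ (cyc cm) M 0
  (fun b (z : cyc cm) y => exists s : free_mod l a,
     [/\ gm_comp b s, z = gproj (gsub_ann cm) s & y = (s : S) *: m]).
- by move=> b _; exists 0; split; [apply: gm_comp0|rewrite /gproj qpi0|rewrite scale0r].
- by move=> b _ _ [s css <-]; exists ((s : S) *: m); [apply: cs|exists s].
- by move=> b _ y' cy' [s [_ es ->]]; apply/eq0; rewrite -es.
- move=> b _ z y' z' y'' [s [hs -> ->]] [s' [hs' -> ->]]; exists (s + s').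
  by split; [apply: gm_compD|rewrite /gproj qpiD|rewrite scalerDl].
- exists (s *: t); split; [by rewrite addrC; apply: gm_compZ|by rewrite ez /gproj qpiZ|].
  by rewrite ez' scalerA.
apply: (@rep_ses _ _ _ i q); exists (Num.max d d1); split=> b; rewrite ge_max => /andP[db db1].
- by move=> z /(h b db)[cz _ [s [_ -> /esym/eq0]]].
- by move=> _ [x' cx' <-]; exists x'; apply/(h1 b db1).
move=> y'; split=> [/(h1 b db1)[cy' /esym/gproj_eq0[s es]]|[z /(h b db)[cz cy' [s [hs _ es]]]]].
  have es' : y' = (pr b s : S) *: m by rewrite -(pr_id cy') es pr_scale.
  exists (gproj (gsub_ann cm) (pr b s)); apply/(h b db); split=> //.
    by exists (pr b s) => //; apply: pr_comp.
  by exists (pr b s); split=> //; apply: pr_comp.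
apply/(h1 b db1); split=> //; apply/esym/gproj_eq0; by exists s.
Qed.

Lemma rep_cyc_free M a (m : M) (cm : gm_comp a m) :
  (forall b (s : S), compS b s -> s *: m = 0 -> s = 0) -> rep (cyc cm) (u_ a).
Proof.
move=> inj; have [q [d h]] := hom_proj (gsub_ann cm).
apply: (@rep_iso _ _ q d) (rep_line a) => b db.
  by move=> s /(h b db)[cs /esym/gproj_eq0 sm]; apply: (inj (b - a)).
by move=> _ [s cs <-]; exists s; apply/(h b db).
Qed.

Lemma rep_cyc_principal M a (m : M) (cm : gm_comp a m) (pi : S) d : compS d pi -> pi != 0 ->
  pi *: m = 0 -> (forall b s, compS b s -> s *: m = 0 ->
    exists2 t, compS (b - d) t & s = t * pi) -> rep (cyc cm) (u_ a - u_ (a + d)).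
Proof.
move=> cpi pi0 pm hann; have [q [d1 h1]] := hom_proj (gsub_ann cm).
have cpi' : gm_comp (a + d) (pi : free_mod l a) by rewrite free_compE addrC addKr.
have [i [d2 h2]] := hom_free cpi'.
apply: (@rep_coker _ _ _ i q) (rep_line _) (rep_line _).
exists (Num.max d1 d2); split=> b; rewrite ge_max => /andP[b1 b2].
- move=> s /(h2 b b2)[cs e]; have /esym e' : (0 : S) = (s : S) * pi := e.
  by case: (compS_domain l_neq0 cs cpi e') => // pi00; rewrite pi00 eqxx in pi0.
- by move=> _ [x cx <-]; exists x; apply/(h1 b b1).
move=> s; split=> [/(h1 b b1)[cs /esym/gproj_eq0 sm]|[t /(h2 b b2)[ct ->]]].
  have [t ct es] := hann _ _ cs sm; exists t; apply/(h2 b b2); split.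
    by move: ct; rewrite opprD addrA.
  exact: es.
apply/(h1 b b1); split.
  by have := gm_compZ ct cpi'; rewrite subrK.
apply/esym/gproj_eq0; rewrite /ann /=.
have -> : ((t : S) *: (pi : free_mod l a) : S) = (t : S) * pi by [].
by rewrite -scalerA pm scaler0.
Qed.

(** A monomial in U and V of degree at least [N] is divisible by one of degree
    exactly [N], and every element of large degree is a form of large degree
    times a reduced monomial. *)
Lemma kill_large M (m : M) (N : nat) : (forall r, compS (c *+ N) r -> r *: m = 0) ->
  exists D : int, forall b (s : S), D <= deg b -> compS b s -> s *: m = 0.
Proof.
move=> h; exists (n.+1%:Z * wprod p + (N * wprod p)%:Z + 1) => b s db cs.
have [q [k [rq eb]]] := nform_exists b; move: cs; rewrite eb => /(compS_nform rq).
have Nk : N%:Z <= k.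
  have := sum_reduced_deg (fun i => ltnW (rq i)); move: db.
  rewrite eb /nform degD degMz deg_c -mulrzr intz => h1 h2.
  have := wprod_gt0 p; nia.
case: k eb Nk => // k eb; rewrite lez_nat => Nk [e [r _ ->] ->].
rewrite mulrC -scalerA; suff -> : formS p l k r *: m = 0 by rewrite scaler0.
rewrite /formS scaler_suml big1 // => i _; rewrite -scalerA.
pose a := minn (k - i) N; pose a' := (N - a)%N.
have ik : (i <= k)%N by rewrite -ltnS.
have -> : uS p l ^+ (k - i) * vS p l ^+ i =
    uS p l ^+ (k - i - a) * vS p l ^+ (i - a') * (uS p l ^+ a * vS p l ^+ a').
  rewrite mulrACA -!exprD; congr (_ ^+ _ * _ ^+ _); rewrite /a' /a; lia.
have -> : (uS p l ^+ (k - i - a) * vS p l ^+ (i - a') * (uS p l ^+ a * vS p l ^+ a')) *: m = 0.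
  rewrite -scalerA h ?scaler0 //.
  have -> : N = (a + a')%N by rewrite /a' /a; lia.
  by rewrite mulrnDr; apply: compSM; apply: compSX; [apply: compS_u|apply: compS_v].
by rewrite scaler0.
Qed.

(** By [prime_ann] the module [S m] is either zero in large degrees or a twist
    of S modulo a prime element, the cokernel of a map of line bundles. *)
Lemma rep_cyc_prime M a (m : M) (cm : gm_comp a m) pd : is_prime pd ->
  pd.1 *: m = 0 -> exists x, rep (cyc cm) x.
Proof.
move=> hp pm; have [excl [z [w pe]]] := hp.
have [[N hN]|no] := EM (exists N, forall r, compS (c *+ N) r -> r *: m = 0).
  exists 0; have [D hD] := kill_large hN; apply: (@rep_zero _ (D + deg a)) => b db _ [s cs <-].
  by apply/gproj_eq0; apply: (hD (b - a)) => //; rewrite degB; lia.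
exists (u_ a - u_ (a + pd.2)); apply: (@rep_cyc_principal _ _ _ _ pd.1) => //.
- exact: is_prime_comp.
- exact: is_prime_neq0 hp.
by move=> b s cs sm; case: (prime_ann pe pm cs sm).
Qed.

(** The submodule generated by the product of all primes but the first, applied
    to the generator, is killed by the first prime; the quotient by it is
    killed by the product of the others. *)
Lemma rep_torsion pds : (forall pd, pd \in pds -> is_prime pd) ->
  forall M a (m : M), gm_comp a m -> (forall x : M, exists s : S, x = s *: m) ->
    (\prod_(pd <- pds) pd.1) *: m = 0 -> exists x, rep M x.
Proof.
elim: pds => [|pd pds IH] hp M a m cm hm.
  rewrite big_nil scale1r => m0; exists 0; apply: (@rep_zero _ 0) => b _ x _.
  by have [s ->] := hm x; rewrite m0 scaler0.
rewrite big_cons => pm; have hp' q : q \in pds -> is_prime q.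
  by move=> qp; apply: hp; rewrite inE qp orbT.
have cprod : compS (\sum_(q <- pds) q.2) (\prod_(q <- pds) q.1).
  elim: pds hp' {IH pm hp} => [|q r IH] hp'; first by rewrite !big_nil; apply: compS1.
  rewrite !big_cons; apply: compSM; first by apply/is_prime_comp/hp'; rewrite inE eqxx.
  by apply: IH => q' q'r; apply: hp'; rewrite inE q'r orbT.
have cm' := gm_compZ cprod cm.
have [||x hx] := @rep_cyc_prime _ _ _ cm' pd.
- by apply: hp; rewrite inE eqxx.
- by rewrite scalerA.
have [|||y hy] := IH hp' (coker cm') a (gproj (gsub_gen cm') m).
- by exists m.
- move=> y; have [x' <-] := qpi_surj y; have [s ->] := hm x'; exists s.
  by rewrite /gproj qpiZ.
- rewrite /gproj -qpiZ; apply/gproj_eq0.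
  by exists 1; rewrite scale1r.
by exists (x + y); apply: rep_cyc hx hy.
Qed.

(** A cyclic module is free, or its generator is killed by a nonzero
    homogeneous element, which divides a product of linear forms and so a
    product of primes. *)
Lemma rep_cyc_ex M a (m : M) (cm : gm_comp a m) : exists x, rep (cyc cm) x.
Proof.
have [[b [s [cs s0 sm]]]|no] := EM (exists b (s : S), [/\ compS b s, s != 0 & s *: m = 0]);
    last first.
  exists (u_ a); apply: rep_cyc_free => b s cs sm; apply/eqP/negPn/negP => s0.
  by apply: no; exists b, s.
have [t [zs [zs0 e]]] := compS_dvd_lin l_neq0 cs s0.
have [pds [k [hp k0 e']]] := lin_prod_primes p l_neq0 l_indep zs0.
have pm : (\prod_(pd <- pds) pd.1) *: m = 0.
  have : (cst k * \prod_(pd <- pds) pd.1) *: m = 0 by rewrite -e' -e -scalerA sm scaler0.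
  rewrite -scalerA => /(congr1 (fun x => cst k^-1 *: x)).
  by rewrite scalerA cstV // scale1r scaler0.
have sc1 (s' : S) : s' *: (1 : free_mod l a) = s' := mulr1 s'.
apply: (rep_torsion hp (M := cyc cm) (a := a) (m := gproj (gsub_ann cm) (1 : free_mod l a))).
- by exists 1 => //; rewrite free_compE subrr; apply: compS1.
- move=> y; have [x <-] := qpi_surj y; exists (x : S).
  by rewrite /gproj -qpiZ [(x : S) *: _]sc1.
by rewrite /gproj -qpiZ sc1; apply/gproj_eq0.
Qed.

(** Induction on the number of homogeneous generators. *)
Lemma rep_ex M : exists x, rep M x.
Proof.
suff h N : forall M (G : seq (L * M)), size G = N -> (forall g, g \in G -> gm_comp g.1 g.2) ->
    (forall Q : set M, gsub Q -> (forall g, g \in G -> Q g.2) -> forall x, Q x) ->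
    exists x, rep M x.
  apply: (h _ M (hgens M)) => //; first by move=> g; apply: hgens_comp.
  move=> Q sQ QG x; have [_ hG] := projT2 (cid (hom_gens M)).
  apply: hG => [||g m k gG]; [exact: gs0 sQ|by move=> y z; apply: (gsD sQ)|].
  by apply: (gsZ sQ); apply: QG.
elim: N => [|N IH] {}M G.
  move=> /size0nil -> _ span; exists 0; apply: (@rep_zero _ 0) => b _ x _.
  by apply: (span [set 0]) => //; apply: gsub_set0.
case: G => // -[a m] G [sG] cG span.
have cm : gm_comp a m by apply: (cG (a, m)); rewrite inE eqxx.
have [x hx] := rep_cyc_ex cm.
have [|||y hy] := IH (coker cm) [seq (g.1, gproj (gsub_gen cm) g.2) | g <- G].
- by rewrite size_map.
- move=> _ /mapP[g gG ->] /=; exists g.2 => //; apply: cG.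
  by rewrite inE gG orbT.
- move=> Q sQ QG y; have [x' <-] := qpi_surj y.
  apply: (span [set x' | Q (gproj (gsub_gen cm) x')]) => [|g] /=.
    split=> [|s x1 x2|r f ur cf] /=.
    + by rewrite /gproj qpi0; apply: gs0 sQ.
    + by rewrite /gproj qpiD qpiZ; apply: (gsL sQ).
    rewrite /gproj qpi_sum => Qf d dr.
    by apply: (gsH sQ ur (f := fun d => gproj (gsub_gen cm) (f d))) Qf d dr => e; exists (f e).
  rewrite inE => /orP[/eqP->|gG] /=.
    have -> : gproj (gsub_gen cm) m = 0 by apply/gproj_eq0; exists 1; rewrite scale1r.
    exact: gs0 sQ.
  by apply: (QG (g.1, gproj (gsub_gen cm) g.2)); apply/mapP; exists g.
by exists (x + y); apply: rep_cyc hx hy.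
Qed.
End Devissage.

(** * Relations between the classes of line bundles *)

Section Relations.
Variables (K : closedFieldType) (n : nat) (p : weights n).
Variable l : 'I_n.+1 -> K * K.
Local Notation S := (ringS p l).
Local Notation c := (cdeg p).
Local Notation x_ := (xdeg p).
Local Notation k0 := (k0 (@line K n p l)).
Local Notation u_ a := (k0_gen (@line K n p l) a).
Implicit Types M X Y Z : grmod p l.
Hypothesis l_neq0 : forall i, l i != (0, 0).
Hypothesis l_indep : forall i j, i != j -> det2 (l i) (l j) != 0.

Lemma rep_cyc_gen M a (m : M) (cm : gm_comp a m) x (d : int) : rep (cyc cm) x ->
  (forall b y, d <= deg b -> gm_comp b y -> exists s : S, y = s *: m) -> rep M x.
Proof.
move=> hx hm; rewrite -[x]addr0; apply: rep_cyc hx _.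
apply: (@rep_zero _ _ _ _ _ d) => b db _ [y cy <-]; apply/gproj_eq0.
exact: hm cy.
Qed.

(** The sheaf S/pi has two presentations by line bundles: multiplication by
    [X_j] is invertible on it. *)
Lemma u_shift (pi : S) d excl z w j a : prime_elt pi d excl z w -> j \notin excl ->
  u_ a - u_ (a + d) = u_ (a + x_ j) - u_ (a + x_ j + d).
Proof.
move=> pe je; have cpi := pe_comp pe.
have pi0 : pi != 0.
  by apply: (@is_prime_neq0 _ _ _ _ (pi, d)); exists excl, z, w.
have cpi' : gm_comp (a + d) (pi : free_mod l a) by rewrite free_compE addrC addKr.
pose Q := coker cpi'; pose pr1 (s : S) : Q := gproj (gsub_gen cpi') (s : free_mod l a).
have sc1 (s : S) : s *: pr1 1 = pr1 s.
  by rewrite /pr1 /gproj -qpiZ; congr qpi; apply: mulr1.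
have scM (s t : S) : s *: pr1 t = pr1 (s * t) by rewrite /pr1 /gproj -qpiZ.
have pr10 b s : compS b s -> pr1 s = 0 -> exists2 t, compS (b - d) t & s = t * pi.
  move=> cs /gproj_eq0[t e].
  have cs' : gm_comp (b + a) (s : free_mod l a) by rewrite free_compE addrK.
  exists (pr (b + a) t : S).
    by have := pr_comp (b + a) t; rewrite free_compE opprD addrA addrK.
  by have := pr_scale (b + a) t cpi'; rewrite -e (pr_id cs').
have prD s t : pr1 (s + t) = pr1 s + pr1 t by rewrite /pr1 /gproj -qpiD.
have prpi t : pr1 (t * pi) = 0 by apply/gproj_eq0; exists t.
have c1 : gm_comp a (pr1 1) by exists 1 => //; rewrite free_compE subrr; apply: compS1.
have cj : gm_comp (a + x_ j) (pr1 (xS p l j)).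
  by exists (xS p l j) => //; rewrite free_compE addrC addKr; apply: compS_x.
have surj b y : gm_comp b y -> exists2 s : S, compS (b - a) s & y = pr1 s.
  by move=> [s cs <-]; exists s.
have r1 : rep Q (u_ a - u_ (a + d)).
  apply: (rep_cyc_gen (cm := c1) (d := 0)).
    apply: (rep_cyc_principal l_neq0 _ cpi pi0) => [|b s cs].
      by rewrite sc1 -[pi]mul1r prpi.
    by rewrite sc1; apply: pr10.
  by move=> b y _ /surj[s cs ->]; exists s; rewrite sc1.
apply: k0_rep_inj r1 _.
have [D hD] := prime_comax pe je.
apply: (rep_cyc_gen (cm := cj) (d := D + deg a)).
  apply: (rep_cyc_principal l_neq0 _ cpi pi0) => [|b s cs].
    by rewrite scM mulrC prpi.
  rewrite scM => e; have cX := compSM cs (compS_x p l j).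
  have [t ct est] := pr10 _ _ cX e; exact: (prime_regular pe je cs est).
move=> b y db /surj[s cs ->]; have [|t [t' [ct ct' ->]]] := hD (b - a) _ s cs.
  by rewrite degB; lia.
by exists t'; rewrite prD prpi add0r scM.
Qed.

(** The classes of the sheaves S/z, for z a general linear form, and S/X_i,
    twisted by [a]. The first does not depend on [a] ([v_const]), and the
    second depends only on the coordinate of [a] at [x_i] ([e_shiftMn] and
    [v_const]). *)
Definition v_ a : k0 := u_ a - u_ (a + c).
Definition e_ i a : k0 := u_ a - u_ (a + x_ i).

Lemma e_shift i j a : j != i -> e_ i (a + x_ j) = e_ i a.
Proof.
move=> ji; have [w pw] := prime_x p l_neq0 l_indep i.
by have := u_shift a pw (j := j); rewrite unfold_in => /(_ ji).
Qed.

Lemma v_shift j a : v_ (a + x_ j) = v_ a.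
Proof.
have [z [z0 zl]] := ordinary_lin l_neq0; have [w pw] := prime_lin p z0 zl.
by have := u_shift a pw (j := j); rewrite unfold_in => /(_ isT).
Qed.

Lemma e_shiftMn i j a t : j != i -> e_ i (a + x_ j *+ t) = e_ i a.
Proof.
move=> ji; elim: t => [|t IH]; first by rewrite mulr0n addr0.
by rewrite mulrSr addrA e_shift.
Qed.

Lemma v_shiftMn j a t : v_ (a + x_ j *+ t) = v_ a.
Proof.
elim: t => [|t IH]; first by rewrite mulr0n addr0.
by rewrite mulrSr addrA v_shift.
Qed.

Lemma v_const a : v_ a = v_ 0.
Proof.
have vc b t : v_ (b + c *+ t) = v_ b.
  by rewrite -(x_mulp p ord0) -mulrnA v_shiftMn.
have [m [k [_ ->]]] := nform_exists a.
have -> : v_ (nform p m k) = v_ (\sum_i x_ i *+ m i).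
  rewrite /nform; case: k => k; first by rewrite -pmulrn vc.
  by rewrite NegzE mulrNz -pmulrn -[in RHS](subrK (c *+ k.+1) (\sum_i _)) vc.
elim/big_rec: _ => // i b _ IH.
by rewrite addrC v_shiftMn.
Qed.

Lemma u_c a (k : int) : u_ (a + c *~ k) = u_ a - v_ 0 *~ k.
Proof.
have h b : u_ (b + c) = u_ b - v_ 0 by rewrite -(v_const b) /v_ subKr.
have nat_case b t : u_ (b + c *+ t) = u_ b - v_ 0 *+ t.
  elim: t => [|t IH]; first by rewrite !mulr0n addr0 subr0.
  by rewrite !mulrSr addrA h IH [- (_ + v_ 0)]opprD addrA.
case: k => k; first by rewrite -!pmulrn nat_case.
rewrite NegzE !mulrNz -!pmulrn opprK -[in RHS](subrK (c *+ k.+1) a) nat_case.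
by rewrite subrK.
Qed.

Definition E_ i s : k0 := e_ i (x_ i *+ s).

Lemma u_nform m k : u_ (nform p m k) =
  u_ 0 - \sum_i \sum_(s < m i) E_ i s - v_ 0 *~ k.
Proof.
rewrite /nform u_c; congr (_ - _).
have step i a t : (forall s, e_ i (a + x_ i *+ s) = E_ i s) ->
    u_ (a + x_ i *+ t) = u_ a - \sum_(s < t) E_ i s.
  move=> h; elim: t => [|t IH]; first by rewrite mulr0n addr0 big_ord0 subr0.
  rewrite big_ord_recr /= opprD addrA -IH mulrSr addrA -h /e_ subKr.
  by [].
suff h (r : seq 'I_n.+1) : uniq r ->
    u_ (\sum_(i <- r) x_ i *+ m i) = u_ 0 - \sum_(i <- r) \sum_(s < m i) E_ i s.
  by apply: h; apply: index_enum_uniq.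
elim: r => [|i r IH]; first by rewrite !big_nil subr0.
rewrite /= => /andP[ir ur]; rewrite !big_cons addrC step ?IH ?opprD ?addrA //.
  by rewrite addrAC.
move=> s; have h (q : seq 'I_n.+1) : i \notin q ->
    e_ i (\sum_(j <- q) x_ j *+ m j + x_ i *+ s) = E_ i s.
  elim: q => [|j q IHq]; first by rewrite big_nil add0r.
  rewrite inE negb_or => /andP[ij iq]; rewrite big_cons [x_ j *+ _ + _]addrC.
  by rewrite addrAC e_shiftMn ?IHq // eq_sym.
exact: h.
Qed.

(** The sheaf S/l_i is filtered by [p_i] twists of S/X_i, as [l_i] is the
    [p_i]-th power of [X_i]; its class is that of S/z. *)
Lemma sum_E i : \sum_(s < p i) E_ i s = v_ 0.
Proof.
have h t : \sum_(s < t) E_ i s = u_ 0 - u_ (x_ i *+ t).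
  elim: t => [|t IH]; first by rewrite big_ord0 mulr0n subrr.
  by rewrite big_ord_recr /= IH /E_ /e_ mulrSr addrA subrK.
by rewrite h x_mulp /v_ add0r.
Qed.

Definition nform_class (r : int) (al : 'I_n.+1 -> nat -> int) (be : int) : k0 :=
  u_ 0 *~ r + \sum_i \sum_(s < p i) E_ i s *~ al i s + v_ 0 *~ be.

Lemma nform_classD r al be r' al' be' :
  nform_class r al be + nform_class r' al' be' =
  nform_class (r + r') (fun i s => al i s + al' i s) (be + be').
Proof.
rewrite /nform_class !mulrzDr addrACA; congr (_ + _).
rewrite addrACA -big_split; congr (_ + _); apply: eq_bigr => i _ /=.
by rewrite -big_split; apply: eq_bigr => s _ /=; rewrite mulrzDr.
Qed.

Lemma nform_classN r al be :
  - nform_class r al be = nform_class (- r) (fun i s => - al i s) (- be).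
Proof.
rewrite /nform_class !mulrNz !opprD -sumrN; congr (_ + _ + _).
by apply: eq_bigr => i _; rewrite -sumrN; apply: eq_bigr => s _; rewrite mulrNz.
Qed.

Lemma nform_class_ex (x : k0) : exists r al be, x = nform_class r al be.
Proof.
have [s <-] := k0_surj x; elim: s => [a||s [r [al [be e]]] t [r' [al' [be' e']]]|s [r [al [be e]]]].
- have [m [k [rm ->]]] := nform_exists a.
  exists 1, (fun i s => - (s < m i)%N%:R), (- k).
  rewrite -[LHS]/(u_ _) u_nform /nform_class mulr1z mulrNz -sumrN.
  congr (_ + _ - _); apply: eq_bigr => i _; rewrite -sumrN.
  rewrite [LHS](big_ord_widen (p i) (fun s => - E_ i s) (ltnW (rm i))) big_mkcond.
  by apply: eq_bigr => s _; case: ltnP => _; rewrite ?mulrN1z ?oppr0 ?mulr0z.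
- exists 0, (fun _ _ => 0), 0; rewrite /nform_class !mulr0z big1 ?addr0 // => i _.
  by rewrite big1 // => s _; rewrite mulr0z.
- exists (r + r'), (fun i s => al i s + al' i s), (be + be').
  by rewrite -nform_classD -e -e' -k0_addE.
exists (- r), (fun i s => - al i s), (- be).
by rewrite -nform_classN -e -k0_oppE.
Qed.
End Relations.

(** * The Hilbert function determines the class *)

Section HilbertValues.
Variables (K : closedFieldType) (n : nat) (p : weights n).
Variable l : 'I_n.+1 -> K * K.
Local Notation S := (ringS p l).
Local Notation c := (cdeg p).
Local Notation x_ := (xdeg p).
Local Notation C := (coh p l).
Local Notation k0 := (k0 (@line K n p l)).
Local Notation u_ a := (k0_gen (@line K n p l) a).
Local Notation v_ := (@v_ K n p l).
Local Notation E_ := (@E_ K n p l).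
Implicit Types M X Y Z : grmod p l.
Hypothesis l_neq0 : forall i, l i != (0, 0).
Hypothesis l_indep : forall i j, i != j -> det2 (l i) (l j) != 0.

(** The component of S of degree [nform q j] is a copy of the space of binary
    forms of degree [j]. *)
Lemma gdim_free a b q (j : nat) : reduced p q -> b - a = nform p q j%:Z ->
  gdim (free_mod l a) b = j.+1.
Proof.
move=> rq e; pose f (r : 'rV[K]_j.+1) : S := formS p l j (rVpoly r) * xmon p l q.
have cf r : gm_comp b (f r : free_mod l a).
  rewrite free_compE e /nform -pmulrn addrC; apply: compSM; last exact: compS_xmon.
  apply: (big_ind (fun s => compS (c *+ j) s)) => [||i _]; [exact: compS0|exact: compSD|].
  apply: compSZ; have ij : (i <= j)%N by rewrite -ltnS.
  have -> : c *+ j = c *+ (j - i) + c *+ i by rewrite -mulrnDr subnK.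
  by apply: compSM; apply: compSX; [apply: compS_u|apply: compS_v].
pose g r : 'rV[K]_(gdim (free_mod l a) b) := co b (f r : free_mod l a).
have gE r : vec (g r) = f r by apply: vec_co.
have gL : linear g.
  move=> k r s; apply: vec_inj; rewrite vecL !gE /f linearP /= formS_linear.
  by rewrite mulrDl -mulrA.
have ginj r : g r = 0 -> r = 0.
  move=> gr; have fr0 : f r = 0 by have := gE r; rewrite gr vec0.
  apply: (@rVpoly_inj K); rewrite linear0.
  by apply: (form_xmon_inj l_neq0 _ fr0); apply: size_poly.
have gsurj v : exists r, g r = v.
  have := vec_comp v; rewrite free_compE e => /(compS_nform rq)[s [r sr ->] es].
  exists (poly_rV r); apply: vec_inj; rewrite gE /f poly_rV_K //.
have := limg_ker_dim (linfun g) fullv; rewrite capfv !dim_rV.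
have -> : lker (linfun g) = 0%VS.
  apply/eqP; rewrite -subv0; apply/subvP => r; rewrite memv_ker memv0 linfun_lin //.
  by move=> /eqP/ginj->.
have -> : limg (linfun g) = fullv.
  apply/vspaceP => v; rewrite memvf; have [r <-] := gsurj v.
  by rewrite -(linfun_lin gL) memv_img ?memvf.
by rewrite dimv0 add0n dim_rV => ->.
Qed.

(** The Hilbert function of [x] has the value [F q j] in degree [nform q j], if
    this degree is large. *)
Definition hval (x : k0) (F : ('I_n.+1 -> nat) -> nat -> int) := exists D : int,
  forall q j, reduced p q -> (0 < j)%N -> D <= deg (nform p q j%:Z) ->
    hilb (seval (@line K n p l) (repr x)) (nform p q j%:Z) = F q j.

Lemma hval_eq (s : K0_term C) (x : k0) (F : ('I_n.+1 -> nat) -> nat -> int) :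
  k0_rep s x -> (forall q j, reduced p q -> (0 < j)%N -> hilb s (nform p q j%:Z) = F q j) ->
  hval x F.
Proof.
move=> /hilb_eq[d h] e; exists d => q j rq j0 dd.
by rewrite -h // e.
Qed.

Lemma hvalD x y F G : hval x F -> hval y G -> hval (x + y) (fun q j => F q j + G q j).
Proof.
move=> [d h] [d' h'].
have /hilb_eq[d2 h2] := k0_repD (K0_refl (seval _ (repr x))) (K0_refl (seval _ (repr y))).
exists (Num.max d (Num.max d' d2)) => q j rq j0; rewrite !ge_max => /and3P[d0 d1 d3].
by rewrite -(h2 _ d3) /= h ?h'.
Qed.

Lemma hvalN x F : hval x F -> hval (- x) (fun q j => - F q j).
Proof.
move=> [d h]; have /hilb_eq[d2 h2] := k0_repN (K0_refl (seval _ (repr x))).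
exists (Num.max d d2) => q j rq j0; rewrite ge_max => /andP[d0 d3].
by rewrite -(h2 _ d3) /= h.
Qed.

Lemma hval_ext x F G : (forall q j, reduced p q -> (0 < j)%N -> F q j = G q j) ->
  hval x F -> hval x G.
Proof. by move=> e [d h]; exists d => q j rq j0 dd; rewrite h // e. Qed.

Lemma hval0 : hval 0 (fun _ _ => 0).
Proof. exact: hval_eq (k0_rep0 _) _. Qed.

Lemma hvalMz x F (k : int) : hval x F -> hval (x *~ k) (fun q j => F q j * k).
Proof.
move=> hx; have hn m : hval (x *+ m) (fun q j => F q j * m%:Z).
  elim: m => [|m IH].
    by apply: hval_ext hval0 => q j _ _; rewrite mulr0.
  rewrite mulrS; apply: hval_ext (hvalD hx IH) => q j _ _.
  by rewrite -[m.+1]add1n PoszD mulrDr mulr1.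
case: k => m; first exact: hn.
rewrite NegzE mulrNz; apply: hval_ext (hvalN (hn m.+1)) => q j _ _.
by rewrite mulrN.
Qed.

Lemma hval_sum (I : Type) (r : seq I) (x : I -> k0) F :
  (forall i, hval (x i) (F i)) ->
  hval (\sum_(i <- r) x i) (fun q j => \sum_(i <- r) F i q j).
Proof.
move=> h; elim: r => [|i r IH].
  by rewrite big_nil; apply: hval_ext hval0 => q j _ _; rewrite big_nil.
rewrite big_cons; apply: hval_ext (hvalD (h i) IH) => q j _ _.
by rewrite big_cons.
Qed.

Lemma hval_u i t : (t <= p i)%N ->
  hval (u_ (x_ i *+ t)) (fun q j => (j.+1 - (q i < t)%N)%:Z).
Proof.
move=> tp; apply: hval_eq (k0_rep_gen _ _) _ => q j rq j0 /=.
pose q' h := if h == i then (if (t <= q i)%N then q i - t else q i + p i - t)%N else q h.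
have rq' : reduced p q'.
  move=> h; rewrite /q'; case: eqP => [->|_]; last exact: rq.
  have := rq i; case: (leqP t); lia.
rewrite (@gdim_free _ _ q' (j - (q i < t))%N rq'); first by congr Posz; case: ltnP; lia.
rewrite /nform (bigD1 i) //= [in RHS](bigD1 i) //= /q' eqxx.
rewrite [in RHS](eq_bigr (fun h => x_ h *+ q h)) => [|h /negPf->//].
case: (ltnP (q i) t) => tq; last first.
  by rewrite subn0 mulrnBr // -!addrA; congr (_ + _); rewrite [RHS]addrC addrA.
have -> : (q i + p i - t)%N = (q i + (p i - t))%N by lia.
have -> : j%:Z = 1 + (j - 1)%:Z by lia.
rewrite mulrzDr mulr1z mulrnDr mulrnBr // x_mulp -!addrA; congr (_ + _).
by rewrite addrCA; congr (_ + _); rewrite [RHS]addrC addrA.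
Qed.

Lemma hval_E i s : (s < p i)%N -> hval (E_ i s) (fun q j => (q i == s)%:R).
Proof.
move=> sp; have -> : E_ i s = u_ (x_ i *+ s) - u_ (x_ i *+ s.+1) by rewrite mulrSr.
have h := hvalD (hval_u (ltnW sp)) (hvalN (hval_u sp)).
apply: hval_ext h => q j rq j0.
by rewrite ltnS; case: (ltngtP (q i) s) => _; lia.
Qed.

Lemma hval_v : hval (v_ 0) (fun _ _ => 1).
Proof.
have -> : v_ 0 = u_ (x_ ord0 *+ 0) - u_ (x_ ord0 *+ p ord0).
  by rewrite mulr0n x_mulp -[cdeg p in RHS]add0r.
have h := hvalD (hval_u (leq0n (p ord0))) (hvalN (hval_u (leqnn (p ord0)))).
by apply: hval_ext h => q j rq j0; rewrite ltn0 rq; lia.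
Qed.

Lemma hval_nform r al be : hval (nform_class p l r al be)
  (fun q j => j.+1%:Z * r + \sum_i al i (q i) + be).
Proof.
have h0 : hval (u_ 0) (fun q j => j.+1%:Z).
  have := hval_u (leq0n (p ord0)); rewrite mulr0n; apply: hval_ext => q j _ _.
  by rewrite ltn0 subn0.
have hE i (s : 'I_(p i)) := hvalMz (al i s) (hval_E (ltn_ord s)).
have h := hvalD (hvalD (hvalMz r h0) (hval_sum (index_enum _)
  (fun i => hval_sum (index_enum _) (hE i)))) (hvalMz be hval_v).
apply: hval_ext h => q j rq _ /=; rewrite mul1r; congr (_ + _ + _).
apply: eq_bigr => i _; rewrite (bigD1 (Ordinal (rq i))) //= eqxx mul1r big1 ?addr0 // => s si.
have /negPf -> : q i != s by rewrite eq_sym -[_ == q i]/(s == Ordinal (rq i) :> nat) val_eqE.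
by rewrite mul0r.
Qed.

(** The difference of the two classes is of the form [nform_class r al be],
    with Hilbert function [(j + 1) r + \sum_i al_i(q_i) + be] in degree [nform
    q j]. If this vanishes for all reduced [q] and large [j], then [r] is 0 and
    each [al_i] is constant, and [sum_E] reduces the class to [v_ 0] times an
    integer that is 0. *)
Lemma K0_gdim M N : (exists d : int, forall a, d <= deg a -> gdim M a = gdim N a) ->
  K0_eq (K0_of (M : C)) (K0_of (N : C)).
Proof.
move=> [d h]; have [x hx] := rep_ex l_neq0 l_indep M; have [y hy] := rep_ex l_neq0 l_indep N.
suff e : x = y by rewrite e in hx; apply: k0_rep_eq hx hy.
have [r [al [be exy]]] := nform_class_ex l_neq0 l_indep (x - y).
have [D hD] := hval_nform r al be.
have [d1 h1] := hilb_eq (k0_repD hx (k0_repN hy)).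
pose B := Num.max d (Num.max d1 D).
have zero q j : reduced p q -> (`|B| < j)%N ->
    j.+1%:Z * r + \sum_i al i (q i) + be = 0.
  move=> rq Bj; have : B <= deg (nform p q j%:Z).
    rewrite /nform degD degMz deg_c -mulrzr intz.
    have : 0 <= deg (\sum_i x_ i *+ q i).
      rewrite (big_morph _ (@degD n p) (deg0 p)) sumr_ge0 // => i _.
      by rewrite degMn mulrn_wge0 // ltW ?deg_x_gt0.
    have := wprod_gt0 p; nia.
  rewrite !ge_max => /and3P[b0 b1 b2].
  rewrite -(hD q j) //; last by lia.
  by rewrite -exy -(h1 _ b1) /= h // subrr.
(* compare two consecutive values of j *)
have r0 : r = 0.
  have rq : reduced p (fun _ => 0%N) by move=> i; apply: wt_gt0.
  have := zero _ `|B|.+1 rq (ltnSn _); have := zero _ `|B|.+2 rq (leqnSn _).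
  set s := \sum_i _; move=> e1 e2; have : `|B|.+3%:Z * r - `|B|.+2%:Z * r = 0.
    by rewrite -[RHS](subrr (0 : int)) -{1}e1 -e2; ring.
  by rewrite -mulrBl => /eqP; rewrite mulf_eq0 => /orP[/eqP|/eqP//]; lia.
have zero' q : reduced p q -> \sum_i al i (q i) + be = 0.
  by move=> rq; have := zero q `|B|.+1 rq (ltnSn _); rewrite r0 mulr0 add0r.
(* compare the zero tuple with the one that has s in place i *)
have al_const i s : (s < p i)%N -> al i s = al i 0%N.
  move=> sp; pose q h := if h == i then s else 0%N.
  have rq : reduced p q by move=> h'; rewrite /q; case: eqP => [->//|_]; apply: wt_gt0.
  have rq0 : reduced p (fun _ => 0%N) by move=> h'; apply: wt_gt0.
  have e0 := zero' _ rq0; have := zero' _ rq; rewrite -[in RHS]e0.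
  move=> /addIr; rewrite (bigD1 i) //= [in RHS](bigD1 i) //= /q eqxx.
  have -> : \sum_(h' < n.+1 | h' != i) al h' (if h' == i then s else 0%N) =
    \sum_(h' < n.+1 | h' != i) al h' 0%N by apply: eq_bigr => h' /negPf->.
  exact: addIr.
have : x - y = 0.
  rewrite exy /nform_class r0 mulr0z add0r.
  have -> : \sum_i \sum_(s < p i) E_ i s *~ al i s = \sum_i v_ 0 *~ al i 0%N.
    apply: eq_bigr => i _; rewrite -(sum_E p l i) mulrz_suml.
    by apply: eq_bigr => s _; rewrite al_const.
  rewrite -mulrz_sumr -mulrzDr zero' ?mulr0z // => i; exact: wt_gt0.
by move=> /eqP; rewrite subr_eq0 => /eqP.
Qed.
End HilbertValues.

(** * Rank and minors *)

Section Minors.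
Variables (K : fieldType) (m n : nat).
Implicit Types A : 'M[K]_(m, n).

Lemma minor_rank A s (f : 'I_s -> 'I_m) (g : 'I_s -> 'I_n) :
  \det (mxsub f g A) != 0 -> (s <= \rank A)%N.
Proof.
rewrite -unitfE -unitmxE -row_free_unit => /eqP <-.
have -> : mxsub f g A = rowsub f 1%:M *m (A *m (rowsub g 1%:M)^T).
  rewrite -rowsubE -[A in A *m _]trmxK -trmx_mul -rowsubE.
  by apply/matrixP => i j; rewrite !mxE.
exact: leq_trans (mxrankM_maxr _ _) (mxrankM_maxl _ _).
Qed.

Lemma rank_minor A :
  exists (f : 'I_(\rank A) -> 'I_m) (g : 'I_(\rank A) -> 'I_n), \det (mxsub f g A) != 0.
Proof.
have := maxrowsub_free A; set B := rowsub _ A => fB.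
have fullB : row_full B^T by rewrite /row_full mxrank_tr.
exists (maxrankfun A), (fullrankfun fullB).
rewrite -unitfE -unitmxE; have := fullrowsub_unit fullB.
by rewrite -unitmx_tr; congr (_ \in unitmx); apply/matrixP => i j; rewrite !mxE.
Qed.
End Minors.

Section LinearRank.
Variable K : fieldType.

Lemma limg_rank m n (f : 'Hom('rV[K]_m, 'rV[K]_n)) :
  \dim (limg f) = \rank (\matrix_(i, j) f (delta_mx 0 i) 0 j).
Proof.
set A := \matrix_(i, j) _; have fA v : f v = v *m A.
  rewrite {1}(row_sum_delta v) linear_sum mulmx_sum_row; apply: eq_bigr => i _.
  by rewrite linearZ /=; congr (_ *: _); apply/rowP => j; rewrite !mxE.
set b := vbasis (limg f); pose B := \matrix_(i < \dim (limg f)) b`_i.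
have Bb i : row i B = b`_i by rewrite rowK.
have free_b : free b := basis_free (vbasisP _).
have BE (v : 'rV_(\dim (limg f))) : v *m B = \sum_i v 0 i *: b`_i.
  by rewrite mulmx_sum_row; apply: eq_bigr => i _; rewrite Bb.
have freeB : row_free B.
  apply: inj_row_free => v; rewrite BE => v0; apply/rowP => i; rewrite mxE.
  exact: (freeP free_b (fun i => v 0 i) v0).
rewrite -(eqP freeB); apply/eqP; rewrite eqn_leq; apply/andP; split; apply: mxrankS.
  apply/row_subP => i; rewrite Bb.
  have /memv_imgP[w _ ->] : b`_i \in limg f by rewrite vbasis_mem // mem_nth // size_tuple.
  by rewrite fA submxMl.
apply/row_subP => i; have : row i A \in limg f.
  by rewrite rowE -fA memv_img ?memvf.
move=> /coord_vbasis ->; rewrite summx_sub // => j _; rewrite scalemx_sub //.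
by rewrite -Bb row_sub.
Qed.
End LinearRank.

(** * Zariski closed sets *)

Section ZariskiTopology.
Variables (K : fieldType) (V : lmodType K).
Implicit Types Z : set V.

Lemma polyfun_sum (I : Type) (r : seq I) (f : I -> V -> K) :
  (forall i, polyfun (f i)) -> polyfun (fun v => \sum_(i <- r) f i v).
Proof.
move=> h; elim: r => [|i r IH].
  by have -> : (fun v => \sum_(i <- [::]) f i v) = (fun=> 0);
    [apply/funext => v; rewrite big_nil|apply: polyfun_cst].
have -> : (fun v => \sum_(j <- i :: r) f j v) = (fun v => f i v + \sum_(j <- r) f j v).
  by apply/funext => v; rewrite big_cons.
exact: polyfun_add.
Qed.

Lemma polyfun_prod (I : Type) (r : seq I) (f : I -> V -> K) :
  (forall i, polyfun (f i)) -> polyfun (fun v => \prod_(i <- r) f i v).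
Proof.
move=> h; elim: r => [|i r IH].
  by have -> : (fun v => \prod_(i <- [::]) f i v) = (fun=> 1);
    [apply/funext => v; rewrite big_nil|apply: polyfun_cst].
have -> : (fun v => \prod_(j <- i :: r) f j v) = (fun v => f i v * \prod_(j <- r) f j v).
  by apply/funext => v; rewrite big_cons.
exact: polyfun_mul.
Qed.

Lemma polyfun_det s (A : V -> 'M[K]_s) :
  (forall i j, polyfun (fun v => A v i j)) -> polyfun (fun v => \det (A v)).
Proof.
move=> h; apply: polyfun_sum => f; apply: polyfun_mul (polyfun_cst _ _) _.
by apply: polyfun_prod => i; apply: h.
Qed.

Lemma zclosed_all (I : Type) (P : set I) (Z : I -> set V) :
  (forall i, P i -> zclosed (Z i)) -> zclosed [set v | forall i, P i -> Z i v].
Proof.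
move=> h; exists [set f | polyfun f /\ exists2 i, P i & forall v, Z i v -> f v = 0].
split=> [f []//|]; apply/seteqP; split=> v /=.
  by move=> Zv f [_ [i Pi]]; apply; apply: Zv.
move=> Fv i Pi; have [F [pF ZF]] := h i Pi; rewrite ZF => f Ff.
by apply: Fv; split; [exact: pF|exists i => // w; rewrite ZF; apply].
Qed.

Lemma zclosed0 : zclosed (set0 : set V).
Proof.
exists [set fun=> 1]; split=> [f ->|]; first exact: polyfun_cst.
by apply/seteqP; split=> v //= /(_ _ erefl)/eqP; rewrite oner_eq0.
Qed.

Lemma zclosedU Z1 Z2 : zclosed Z1 -> zclosed Z2 -> zclosed (Z1 `|` Z2).
Proof.
move=> [F [pF ->]] [G [pG ->]].
exists [set h | exists f g, [/\ F f, G g & h = fun v => f v * g v]]; split.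
  by move=> _ [f [g [/pF hf /pG hg ->]]]; apply: polyfun_mul.
apply/seteqP; split=> v /=.
  by move=> [h|h] _ [f [g [Ff Gg ->]]]; rewrite ?(h _ Ff) ?(h _ Gg) ?mul0r ?mulr0.
move=> h; case: (pselect (forall f, F f -> f v = 0)) => [|nF]; first by left.
right=> g Gg; apply: contra_notP nF => /eqP g0 f Ff.
have /eqP : f v * g v = 0 by apply: (h (fun v => f v * g v)); exists f, g.
by rewrite mulf_eq0 (negPf g0) orbF => /eqP.
Qed.

Lemma zclosed_has (I : eqType) (T : seq I) (Z : I -> set V) :
  {in T, forall t, zclosed (Z t)} -> zclosed [set v | exists2 t, t \in T & Z t v].
Proof.
elim: T => [_|i T IH h].
  by have -> : [set v | exists2 t, t \in [::] & Z t v] = set0;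
    [apply/seteqP; split=> v // -[]|apply: zclosed0].
have -> : [set v | exists2 t, t \in i :: T & Z t v] =
    Z i `|` [set v | exists2 t, t \in T & Z t v].
  apply/seteqP; split=> v /=.
    by move=> [t]; rewrite inE => /orP[/eqP->|tT] Zt; [left|right; exists t].
  move=> [Zi|[t tT Zt]]; first by exists i; rewrite ?mem_head.
  by exists t; rewrite // inE tT orbT.
apply: zclosedU; first by apply: h; rewrite mem_head.
by apply: IH => t tT; apply: h; rewrite inE tT orbT.
Qed.

(** The rank of a matrix depending polynomially on a parameter is lower
    semicontinuous: it is less than [r] where all minors of size at least [r]
    vanish. *)
Lemma zclosed_rank m s (A : V -> 'M[K]_(m, s)) (r : nat) :
  (forall i j, polyfun (fun v => A v i j)) -> zclosed [set v | (\rank (A v) < r)%N].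
Proof.
move=> pA; exists [set h | exists k (f : 'I_k -> 'I_m) (g : 'I_k -> 'I_s),
  (r <= k)%N /\ h = fun v => \det (mxsub f g (A v))]; split.
  move=> _ [k [f [g [_ ->]]]]; apply: polyfun_det => i j.
  by have -> : (fun v => mxsub f g (A v) i j) = (fun v => A v (f i) (g j));
    [apply/funext => v; rewrite mxE|apply: pA].
apply/seteqP; split=> v /=.
  move=> rA _ [k [f [g [rk ->]]]]; apply/eqP; apply: contraTT rA => /minor_rank h.
  by rewrite -leqNgt (leq_trans rk).
move=> h; rewrite ltnNge; apply/negP => rA.
have [f [g /eqP]] := rank_minor (A v); apply; apply: (h (fun w => \det (mxsub f g (A w)))).
by exists (\rank (A v)), f, g.
Qed.

End ZariskiTopology.

(** * The stratification by rank *)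

Section Stratification.
Variables (K : closedFieldType) (n : nat) (p : weights n).
Variable l : 'I_n.+1 -> K * K.
Local Notation L := (Lp p).
Local Notation C := (coh p l).
Implicit Types M X Y Z : grmod p l.

(** The entries of [smat f t] are linear in [f], as [t] is beyond [regdeg Y]. *)
Lemma drank_closed X Y (t : L) (r : nat) : regdeg Y <= deg t ->
  zclosed [set f : qhom X Y | (drank f t < r)%N].
Proof.
move=> ry; have -> : [set f : qhom X Y | (drank f t < r)%N] = [set f : qhom X Y |
    (\rank (\matrix_(i, j) smat f t (delta_mx 0 i) 0 j)%R < r)%N].
  by apply/seteqP; split=> f /=; rewrite /drank limg_rank.
apply: zclosed_rank => i j.
pose g (f : qhom X Y) : K := smat f t (delta_mx 0 i) 0 j.
have gL : scalar g by move=> k f f'; rewrite /g smat_linear // !mxE.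
pose g' : {scalar (qhom X Y)} := HB.pack g (GRing.isLinear.Build _ _ _ _ g gL).
have -> : (fun f : qhom X Y => (\matrix_(i, j) smat f t (delta_mx 0 i) 0 j) i j) = g'.
  by apply/funext => f; rewrite mxE.
exact: polyfun_lin.
Qed.

Lemma drank_le_cod X Y (f : qhom X Y) a : (drank f a <= gdim Y a)%N.
Proof. by rewrite /drank -[leqRHS](@dim_rV K) dimvS // subvf. Qed.

Lemma drank_le_dom X Y (f : qhom X Y) a : (drank f a <= gdim X a)%N.
Proof. by rewrite /drank -[leqRHS](@dim_rV K) -(limg_ker_dim (smat f a) fullv) leq_addl. Qed.

(** The complement is the union of the closed conditions that one of the ranks
    is smaller. *)
Lemma drank_top_open X Y (T : seq L) (F : L -> nat) :
  (forall t, t \in T -> regdeg Y <= deg t) -> (forall (f : qhom X Y) a, drank f a <= F a)%N ->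
  zopen [set f : qhom X Y | {in T, forall t, drank f t = F t}].
Proof.
move=> hT top; rewrite /zopen.
have -> : ~` [set f : qhom X Y | {in T, forall t, drank f t = F t}] =
    [set f | exists2 t, t \in T & (drank f t < F t)%N].
  apply/seteqP; split=> f /=.
    move=> nf; apply: contra_notP nf => h t tT; apply/eqP; rewrite eqn_leq top /= leqNgt.
    by apply/negP => lt; apply: h; exists t.
  by move=> [t tT lt] /(_ t tT) e; rewrite e ltnn in lt.
by apply: zclosed_has => t /hT; apply: drank_closed.
Qed.

Lemma rank_ex X Y (f : qhom X Y) : exists r, has_rank (C := C) f r.
Proof. by have [J [j [fj _]]] := drank_image f; exists (dim_type (J : C)), J, j. Qed.

Hypothesis l_neq0 : forall i, l i != (0, 0).
Hypothesis l_indep : forall i j, i != j -> det2 (l i) (l j) != 0.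

(** The rank of [f] and the Hilbert function of its image determine each other,
    by [hilb_eq] and [K0_gdim]. *)
Lemma rank_drank X Y (f g : qhom X Y) r : has_rank (C := C) f r ->
  has_rank (C := C) g r <->
  exists d : int, forall a, d <= deg a -> drank g a = drank f a.
Proof.
move=> fr; have [I [i [fi [d hi]]]] := drank_image f.
have [J [j [gj [d' hj]]]] := drank_image g.
have {fr} -> : r = dim_type (I : C) by apply: rank_unique fr _; exists I, i.
have gr : has_rank (C := C) g (dim_type (J : C)) by exists J, j.
split=> [gI|[e h]].
  have /dim_typeP/hilb_eq[e h] := rank_unique gr gI.
  exists (Num.max d (Num.max d' e)) => a; rewrite !ge_max => /and3P[da d'a ea].
  by rewrite -hi // -hj //; have /= [] := h _ ea.
have -> // : dim_type (I : C) = dim_type (J : C).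
apply/dim_typeP/K0_gdim => //; exists (Num.max d (Num.max d' e)) => a.
by rewrite !ge_max => /and3P[da d'a ea]; rewrite hi // hj // h.
Qed.

Lemma coh_rank_stratified : rank_stratified C.
Proof.
move=> X Y; have [T [hT test]] := test_degrees X Y.
have dr (f : qhom X Y) : drank f = gdim X \/ drank f = gdim Y \/
    exists g : qhom X Y, drank f = drank g by right; right; exists f.
have rankP (f g : qhom X Y) r : has_rank (C := C) f r ->
    has_rank (C := C) g r <-> {in T, forall t, drank g t = drank f t}.
  by move=> fr; apply: iff_trans (rank_drank _ fr) _; apply: test (dr g) (dr f).
split=> [f|||| ].
- by have [r fr] := rank_ex f; exists r; split=> // r'; apply: rank_unique fr.
- pose B := (\max_(t <- T) gdim Y t).+1.
  have boundB (f : qhom X Y) t : t \in T -> (drank f t < B)%N.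
    move=> tT; rewrite ltnS (leq_trans (drank_le_cod f t)) //.
    by rewrite (big_rem t tT) leq_maxl.
  (* the ranks in the test degrees, which are bounded by the dimensions for Y *)
  pose code (f : qhom X Y) : {ffun 'I_(size T) -> 'I_B} :=
    [ffun k : 'I_(size T) => inord (drank f T`_k)].
  have codeP f g r : has_rank (C := C) f r -> code f = code g -> has_rank (C := C) g r.
    move=> fr e; apply/(rankP _ _ _ fr) => t tT.
    have kT : (index t T < size T)%N by rewrite index_mem.
    have := congr1 (fun c : {ffun 'I_(size T) -> 'I_B} => val (c (Ordinal kT))) e.
    by rewrite !ffunE /= nth_index // !inordK ?boundB.
  have rs_ex (k : 'I_#|{ffun 'I_(size T) -> 'I_B}|) : exists r : K0 C,
      forall f : qhom X Y, code f = enum_val k -> has_rank (C := C) f r.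
    case: (pselect (exists f, code f = enum_val k)) => [[f ef]|nf].
      by have [r fr] := rank_ex f; exists r => g eg; apply: codeP fr _; rewrite ef.
    have [r _] := rank_ex (0 : qhom X Y); exists r => f ef.
    by case: nf; exists f.
  have [rs hrs] := choice rs_ex.
  exists _, rs => f r fr; exists (enum_rank (code f)).
  by apply: rank_unique fr _; apply: hrs; rewrite enum_rankK.
- move=> r; case: (pselect (exists f : qhom X Y, has_rank (C := C) f r)) => [[f fr]|nr].
    exists [set g : qhom X Y | {in T, forall t, (drank f t <= drank g t)%N}].
    exists [set g : qhom X Y | forall t, t \in T -> (drank g t < (drank f t).+1)%N].
    split.
    + rewrite /zopen; have -> : ~` [set g : qhom X Y | {in T, forall t, (drank f t <= drank g t)%N}] =
          [set g | exists2 t, t \in T & (drank g t < drank f t)%N].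
        apply/seteqP; split=> g /=.
          move=> ng; apply: contra_notP ng => h t tT; rewrite leqNgt.
          by apply/negP => lt; apply: h; exists t.
        by move=> [t tT lt] /(_ t tT); rewrite leqNgt lt.
      by apply: zclosed_has => t /hT; apply: drank_closed.
    + apply: (@zclosed_all _ _ _ [set` T] (fun t => [set g | (drank g t < (drank f t).+1)%N])).
      by move=> t /hT; apply: drank_closed.
    + apply/seteqP; split=> g /=.
        by move=> /(rankP _ _ _ fr) h; split=> t tT; rewrite ?ltnS h.
      move=> [h1 h2]; apply/(rankP _ _ _ fr) => t tT; apply/eqP.
      by rewrite eqn_leq h1 // andbT -ltnS h2.
  (* a class that is the rank of no morphism *)
  exists (~` set0), set0; split; [|exact: zclosed0|].
    by rewrite /zopen setCK; apply: zclosed0.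
  by rewrite setI0; apply/seteqP; split=> f //= fr; apply: nr; exists f.
- rewrite (_ : [set f : qhom X Y | _] = [set f : qhom X Y | {in T, forall t, drank f t = gdim X t}]).
    exact: drank_top_open hT (@drank_le_dom X Y).
  apply/seteqP; split=> f /=.
    by move=> /drank_mono/(test _ _ (dr f) (or_introl erefl)).
  by move=> /(test _ _ (dr f) (or_introl erefl))/drank_mono.
- rewrite (_ : [set f : qhom X Y | _] = [set f : qhom X Y | {in T, forall t, drank f t = gdim Y t}]).
    exact: drank_top_open hT (@drank_le_cod X Y).
  apply/seteqP; split=> f /=.
    by move=> /drank_epi/(test _ _ (dr f) (or_intror (or_introl erefl))).
  by move=> /(test _ _ (dr f) (or_intror (or_introl erefl)))/drank_epi.
Qed.
End Stratification.

Theorem theorem7p5 (K : closedFieldType) (n : nat) (p : weights n)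
    (lambda l : 'I_n.+1 -> K * K)
    (lambda_neq0 : forall i, lambda i != (0, 0))
    (lambda_distinct : forall i j, i != j -> ~ same_point (lambda i) (lambda j))
    (l_neq0 : forall i, l i != (0, 0))
    (l_zero : forall i, vanishes_at (l i) (lambda i)) :
  rank_stratified (coh p l).
Proof.
apply: coh_rank_stratified => // i j ij; apply/negP => /eqP d0.
apply: (lambda_distinct i j ij); rewrite /same_point.
have := l_zero i; have := l_zero j; have := l_neq0 i; have := l_neq0 j.
rewrite /vanishes_at; move: d0; rewrite /det2.
case: (l i) (l j) (lambda i) (lambda j) => [a b] [a' b'] [u v] [u' v'] /=.
move=> d0 l'0 l0 z' z.
have pair0 (s t w : K) : (s, t) != (0, 0) -> s * w = 0 -> t * w = 0 -> w = 0.
  rewrite xpair_eqE negb_and => /orP[] /negPf h /eqP + /eqP.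
    by rewrite mulf_eq0 h => /eqP.
  by rewrite [t * w == 0]mulf_eq0 h => _ /eqP.
(* The two forms are proportional, so both vanish at (u, v). *)
have z'' : a' * u + b' * v = 0.
  apply: pair0 l0 _ _.
    have -> : a * (a' * u + b' * v) = a' * (a * u + b * v) + v * (a * b' - b * a') by ring.
    by rewrite z d0 !mulr0 addr0.
  have -> : b * (a' * u + b' * v) = b' * (a * u + b * v) - u * (a * b' - b * a') by ring.
  by rewrite z d0 !mulr0 subr0.
(* The zero of a nonzero form is unique up to scalars. *)
apply/eqP; rewrite -subr_eq0; apply/eqP; apply: pair0 l'0 _ _.
  have -> : a' * (u * v' - v * u') =
    v' * (a' * u + b' * v) - v * (a' * u' + b' * v') by ring.
  by rewrite z'' z' !mulr0 subr0.
have -> : b' * (u * v' - v * u') =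
  u * (a' * u' + b' * v') - u' * (a' * u + b' * v) by ring.
by rewrite z'' z' !mulr0 subr0.
Qed.
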